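(* Let $m,n\ge 1$ and let $\mathbb{B}$ be the open unit ball of $(\mathcal{Q}_m)^n_s$. Let $f\in\mathcal{SR}(\mathbb{B},(\mathbb{R}_m)^n)$ be a slice regular mapping such that, for some $I\in\mathbb{S}_m$, one has $f(\mathbb{B}_I)\subseteq\mathbb{C}_I^n$ and the restriction $f_I:=f|_{\mathbb{B}_I}:\mathbb{B}_I\to\mathbb{C}_I^n$ is a starlike mapping. If $f(0)=0$ and $f'(0)=\mathbb{I}_n$ (the identity matrix of order $n$), then $$\frac{\|x\|}{(1+\|x\|)^2}\le\|f(x)\|\le\frac{\|x\|}{(1-\|x\|)^2},\qquad \forall\,x\in\mathbb{B}.$$ These estimates are sharp, i.e. for each of the two inequalities and each $r\in(0,1)$ equality is attained for some data satisfying the hypotheses and some $x\in\mathbb{B}$ with $\|x\|=r$.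
   Context: $\mathbb{R}_m$ is the real Clifford algebra generated by $e_1,\dots,e_m$ with $e_\imath e_\jmath+e_\jmath e_\imath=-2\delta_{\imath\jmath}$; every $x\in\mathbb{R}_m$ is uniquely $x=\sum_A x_Ae_A$ with $x_A\in\mathbb{R}$, $A$ ranging over subsets $\{h_1<\dots<h_r\}$ of $\{1,\dots,m\}$, $e_A=e_{h_1}\cdots e_{h_r}$, $e_\varnothing=1$. $|x|=(\sum_A x_A^2)^{1/2}$ and, for $x=(x_1,\dots,x_n)\in(\mathbb{R}_m)^n$, $\|x\|=(\sum_t|x_t|^2)^{1/2}$. $x^c$ is Clifford conjugation (the anti-involution with $e_\imath^c=-e_\imath$), $t(x)=x+x^c$, $n(x)=xx^c$. The quadratic cone is $\mathcal{Q}_m=\mathbb{R}\cup\{x\in\mathbb{R}_m: t(x)\in\mathbb{R},\,n(x)\in\mathbb{R},\,4n(x)>t(x)^2\}$, and $\mathbb{S}_m=\{J\in\mathcal{Q}_m:J^2=-1\}=\{x\in\mathbb{R}_m: t(x)=0,\ n(x)=1\}$. Elements of $\mathbb{R}_m$ act on $(\mathbb{R}_m)^n$ by componentwise left multiplication. For $I\in\mathbb{S}_m$, $\mathbb{C}_I^n=\mathbb{R}^n+I\mathbb{R}^n$ (identified with $\mathbb{C}^n$ via $i\leftrightarrow I$), and $(\mathcal{Q}_m)^n_s=\bigcup_{I\in\mathbb{S}_m}\mathbb{C}_I^n$. The unit ball is $\mathbb{B}=\{x\in(\mathcal{Q}_m)^n_s:\|x\|<1\}$ and $\mathbb{B}_I=\mathbb{B}\cap\mathbb{C}_I^n$.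 Let $D$ be the open unit ball of $\mathbb{C}^n$ and $(\mathbb{R}_m)^n_{\mathbb{C}}=(\mathbb{R}_m)^n+i(\mathbb{R}_m)^n$ the complexification. A stem mapping is $F=F_1+iF_2:D\to(\mathbb{R}_m)^n_{\mathbb{C}}$ ($F_1,F_2$ with values in $(\mathbb{R}_m)^n$) with $F_1(\bar z)=F_1(z)$, $F_2(\bar z)=-F_2(z)$. It induces the slice mapping $f=\mathcal{I}(F):\mathbb{B}\to(\mathbb{R}_m)^n$, $f(\alpha+J\beta)=F_1(\alpha+i\beta)+JF_2(\alpha+i\beta)$ for $\alpha,\beta\in\mathbb{R}^n$, $\alpha+i\beta\in D$, $J\in\mathbb{S}_m$. $f$ is slice regular if $F$ is $C^1$ and holomorphic, i.e. $\frac{\partial F}{\partial\bar z_t}=\frac12\big(\frac{\partial F}{\partial\alpha_t}+i\frac{\partial F}{\partial\beta_t}\big)=0$ for $t=1,\dots,n$; $\mathcal{SR}(\mathbb{B},(\mathbb{R}_m)^n)$ is the set of slice regular mappings. The derivative $f'=\frac{\partial f}{\partial x}$ is the $n\times n$ matrix whose $(s,t)$ entry is the slice function induced by $\frac{\partial F^s}{\partial z_t}=\frac12\big(\frac{\partial F^s}{\partial\alpha_t}-i\frac{\partial F^s}{\partial\beta_t}\big)$, where $F=(F^1,\dots,F^n)$. A starlike mapping is, as usual in several complex variables, a holomorphic mapping that is biholomorphic onto its image, sends $0$ to $0$, and has image starlike with respect to $0$. *)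

(* Defs.v *)
From HB Require Import structures.
From mathcomp Require Import all_boot all_order all_algebra.
From mathcomp Require Import all_classical all_reals all_analysis.
From mathcomp Require Import ring.
Set Implicit Arguments.
Unset Strict Implicit.
Unset Printing Implicit Defensive.
Import Order.TTheory GRing.Theory Num.Theory.
Import numFieldNormedType.Exports.
Local Open Scope classical_set_scope.
Local Open Scope ring_scope.

Section SymmetricDifference.
Variable T : finType.
Implicit Types A B C : {set T}.

Definition symd A B : {set T} := (A :\: B) :|: (B :\: A).

Lemma in_symd A B i : (i \in symd A B) = (i \in A) (+) (i \in B).
Proof. by rewrite !inE; case: (i \in A); case: (i \in B). Qed.

Lemma symdA : associative symd.
Proof. by move=> A B C; apply/setP => i; rewrite !in_symd addbA. Qed.

Lemma symdC : commutative symd.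
Proof. by move=> A B; apply/setP => i; rewrite !in_symd addbC. Qed.

Lemma symd0s : left_id finset.set0 symd.
Proof. by move=> A; apply/setP => i; rewrite in_symd inE. Qed.

Lemma symds0 : right_id finset.set0 symd.
Proof. by move=> A; rewrite symdC symd0s. Qed.

Lemma symdss A : symd A A = finset.set0.
Proof. by apply/setP => i; rewrite in_symd inE addbb. Qed.

Lemma symdK A B : symd A (symd A B) = B.
Proof. by rewrite symdA symdss symd0s. Qed.

Lemma symd_eq A B C : (symd A B == C) = (B == symd A C).
Proof.
by apply/eqP/eqP => [<-|->]; rewrite symdK.
Qed.

End SymmetricDifference.

(* The coefficient of e_A in x is x A. *)
Definition clifford (R : realType) (m : nat) : Type := {ffun {set 'I_m} -> R}.

HB.instance Definition _ (R : realType) (m : nat) :=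
  GRing.Lmodule.copy (clifford R m) {ffun {set 'I_m} -> R^o}.

Section Clifford.
Variables (R : realType) (m : nat).
Local Notation Cl := (clifford R m).
Implicit Types (A B C : {set 'I_m}) (x y z J : Cl) (a : R) (i j : 'I_m).

(* e_A e_B = bsign A B e_(A symd B): sorting the generators of e_A e_B costs
   a factor -1 for each pair j < i with i in A and j in B, and each common
   generator then contributes e_i ^ 2 = -1. *)
Definition bsign A B : R := \prod_(i in A) \prod_(j in B | (j <= i)%N) -1.

Definition blade A : Cl := [ffun B => (B == A)%:R].

Definition clmul x y : Cl :=
  [ffun C => \sum_A \sum_(B | symd A B == C) bsign A B * x A * y B].

Lemma clmulE x y C :
  clmul x y C = \sum_A bsign A (symd A C) * x A * y (symd A C).
Proof.
rewrite ffunE; apply: eq_bigr => A _.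
by rewrite (eq_bigl _ _ (fun B => symd_eq A B C)) big_pred1_eq.
Qed.

Lemma bsign_symdl A B C : bsign (symd A B) C = bsign A C * bsign B C.
Proof.
rewrite /bsign [in LHS]big_mkcond [X in _ = X * _]big_mkcond.
rewrite [X in _ = _ * X]big_mkcond -big_split/=; apply: eq_bigr => i _.
rewrite in_symd; set c := \prod_(_ in _ | _) _.
have c2 : c * c = 1.
  by rewrite /c -big_split/= big1// => j _; rewrite mulrNN mulr1.
by case: (i \in A); case: (i \in B); rewrite /= ?mulr1 ?mul1r.
Qed.

Lemma bsign_symdr A B C : bsign A (symd B C) = bsign A B * bsign A C.
Proof.
rewrite /bsign -big_split/=; apply: eq_bigr => i _.
rewrite [in LHS]big_mkcond [X in _ = X * _]big_mkcond.
rewrite [X in _ = _ * X]big_mkcond -big_split/=; apply: eq_bigr => j _.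
rewrite in_symd; case: (j \in B); case: (j \in C); case: (_ <= _)%N;
  by rewrite /= ?mulr1 ?mul1r// mulrNN mulr1.
Qed.

Lemma bsign0l B : bsign finset.set0 B = 1.
Proof. by rewrite /bsign big_set0. Qed.

Lemma bsign0r A : bsign A finset.set0 = 1.
Proof.
by rewrite /bsign big1// => i _; rewrite big_pred0// => j; rewrite inE.
Qed.

Lemma clmulA : associative clmul.
Proof.
move=> x y z; apply/ffunP => D; rewrite !clmulE.
under eq_bigr => A _ do rewrite clmulE mulr_sumr.
under [RHS]eq_bigr => C _ do rewrite clmulE mulr_sumr mulr_suml.
rewrite [RHS]exchange_big/=; apply: eq_bigr => A _.
rewrite [RHS](reindex_inj (h := symd A)); last first.
  by move=> B C /(congr1 (symd A)); rewrite !symdK.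
apply: eq_bigr => B _; rewrite symdK -[symd (symd A B) D]symdA.
have -> : symd A (symd B D) = symd B (symd A D).
  by rewrite !symdA (symdC A).
set E := symd B (symd A D).
have -> : symd A D = symd B E by rewrite /E symdK.
rewrite bsign_symdr bsign_symdl.
ring.
Qed.

Lemma clmul1l : left_id (blade finset.set0) clmul.
Proof.
move=> x; apply/ffunP => C; rewrite clmulE (bigD1 finset.set0)//= big1.
  by rewrite bsign0l symd0s ffunE eqxx !mul1r addr0.
by move=> A /negPf A0; rewrite ffunE A0 mulr0 mul0r.
Qed.

Lemma clmul1r : right_id (blade finset.set0) clmul.
Proof.
move=> x; apply/ffunP => C; rewrite clmulE (bigD1 C)//= big1.
  by rewrite symdss bsign0r ffunE eqxx mul1r mulr1 addr0.
by move=> A neAC; rewrite ffunE symd_eq symds0 eq_sym (negPf neAC) mulr0.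
Qed.

Lemma clmulDl : left_distributive clmul +%R.
Proof.
move=> x y z; apply/ffunP => C.
rewrite [RHS]ffunE !clmulE -big_split; apply: eq_bigr => A _ /=.
by rewrite ffunE mulrDr mulrDl.
Qed.

Lemma clmulDr : right_distributive clmul +%R.
Proof.
move=> x y z; apply/ffunP => C.
rewrite [RHS]ffunE !clmulE -big_split; apply: eq_bigr => A _ /=.
by rewrite ffunE mulrDr.
Qed.

Lemma blade0_neq0 : blade finset.set0 != 0 :> Cl.
Proof.
apply/eqP => /ffunP/(_ finset.set0); rewrite !ffunE eqxx => /eqP.
by rewrite oner_eq0.
Qed.

HB.instance Definition _ := GRing.Zmodule_isNzRing.Build Cl
  clmulA clmul1l clmul1r clmulDl clmulDr blade0_neq0.

Lemma clscaleE a x A : (a *: x) A = a * x A.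
Proof. by rewrite ffunE. Qed.

Lemma claddE x y A : (x + y) A = x A + y A.
Proof. by rewrite ffunE. Qed.

Lemma clmulrE x y C :
  (x * y) C = \sum_A bsign A (symd A C) * x A * y (symd A C).
Proof. exact: clmulE. Qed.

Lemma clscalerAl a x y : a *: (x * y) = (a *: x) * y.
Proof.
apply/ffunP => C; rewrite clscaleE !clmulrE mulr_sumr.
by apply: eq_bigr => A _; rewrite clscaleE; ring.
Qed.

HB.instance Definition _ := GRing.Lmodule_isLalgebra.Build R Cl clscalerAl.

Lemma clscalerAr a x y : a *: (x * y) = x * (a *: y).
Proof.
apply/ffunP => C; rewrite clscaleE !clmulrE mulr_sumr.
by apply: eq_bigr => A _; rewrite clscaleE; ring.
Qed.

HB.instance Definition _ := GRing.Lalgebra_isAlgebra.Build R Cl clscalerAr.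

Definition gen i : Cl := blade (finset.set1 i).

Lemma blade_mul A B : blade A * blade B = bsign A B *: blade (symd A B).
Proof.
apply/ffunP => C; rewrite clmulrE clscaleE [in RHS]ffunE.
rewrite (bigD1 A)//= big1 => [|D /negPf DA]; last first.
  by rewrite ffunE DA mulr0 mul0r.
rewrite addr0 !ffunE eqxx mulr1 [symd A C == B]eq_sym -symd_eq [C == _]eq_sym.
by case: eqP => [<-|_]; rewrite ?mulr0// symdK.
Qed.

Lemma clifford_blades x : x = \sum_A x A *: blade A.
Proof.
apply/ffunP => C; rewrite sum_ffunE (bigD1 C)//= big1 => [|A /negPf nCA].
  by rewrite addr0 clscaleE ffunE eqxx mulr1.
by rewrite clscaleE ffunE eq_sym nCA mulr0.
Qed.

Lemma bsign11 i j : bsign (finset.set1 i) (finset.set1 j) = (-1) ^+ (j <= i)%N.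
Proof.
rewrite /bsign big_set1 big_mkcond (bigD1 j)//= big1 => [|k /negPf kj].
  by rewrite inE eqxx mulr1 /=; case: (_ <= _)%N.
by rewrite inE kj.
Qed.

Lemma gen_rel i j : gen i * gen j + gen j * gen i = (- (i == j)%:R *+ 2)%:A.
Proof.
rewrite !blade_mul !bsign11 (symdC (finset.set1 j)) -scalerDl.
have [->|ne] := eqVneq i j; first by rewrite symdss leqnn/= mulr2n expr1.
suff -> : (-1) ^+ (j <= i)%N + (-1) ^+ (i <= j)%N = 0 :> R.
  by rewrite oppr0 mul0rn !scale0r.
have := ne; rewrite -val_eqE/=; case: ltngtP => //= _ _;
  by rewrite ?subrr ?addNr ?expr0 ?expr1 ?subrr ?addNr.
Qed.

Lemma blade_gens A : blade A = \prod_(i <- enum A) gen i.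
Proof.
suff H (s : seq 'I_m) : sorted (relpre val ltn) s ->
    \prod_(i <- s) gen i = blade [set i in s].
  rewrite H; first by congr blade; apply/setP => i; rewrite inE mem_enum.
  rewrite /enum_mem sorted_filter//; first by move=> ? ? ?; exact: ltn_trans.
  by rewrite -sorted_map -enumT val_enum_ord iota_ltn_sorted.
elim: s => [_|i s IHs is_sorted].
  by rewrite big_nil; congr blade; apply/setP => i; rewrite !inE.
have i_lt : all (fun j => (i < j)%N) s.
  by apply: order_path_min is_sorted => ? ? ?; exact: ltn_trans.
rewrite big_cons IHs ?(path_sorted is_sorted)// blade_mul.
rewrite /bsign big_set1 big_pred0 => [|j]; last first.
  rewrite inE; apply/negbTE/negP => /andP[/(allP i_lt)/= ij ji].
  by rewrite leqNgt ij in ji.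
rewrite scale1r; congr blade; apply/setP => j; rewrite in_symd !inE.
have [->|//] := eqVneq j i.
by case: (boolP (i \in s)) => // /(allP i_lt)/=; rewrite ltnn.
Qed.

(* e_A ^c = bsign A A e_A is the inverse of e_A; see [clconj_gen], [clconjM]. *)
Definition clconj x : Cl := [ffun A => bsign A A * x A].

Lemma clconj_linear a x y : clconj (a *: x + y) = a *: clconj x + clconj y.
Proof.
apply/ffunP => A; rewrite claddE clscaleE [LHS]ffunE [clconj x A]ffunE.
by rewrite [clconj y A]ffunE claddE clscaleE; ring.
Qed.

Lemma clconj_gen i : clconj (gen i) = - gen i.
Proof.
apply/ffunP => A; rewrite !ffunE; case: eqP => [->|_].
  by rewrite bsign11 leqnn mulr1 expr1.
by rewrite mulr0 oppr0.
Qed.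

Lemma clconjM x y : clconj (x * y) = clconj y * clconj x.
Proof.
apply/ffunP => C; rewrite ffunE !clmulrE mulr_sumr.
rewrite [RHS](reindex_inj (h := fun A => symd A C)); last first.
  move=> A B /(congr1 (fun D : {set 'I_m} => symd D C)).
  by rewrite -!symdA symdss !symds0.
apply: eq_bigr => A _ /=; rewrite -symdA symdss symds0 !ffunE.
set B := symd A C; have -> : C = symd A B by rewrite symdK.
move: B => B; rewrite bsign_symdl !bsign_symdr.
have b2 : bsign A B * bsign A B = 1.
  by rewrite -bsign_symdl symdss bsign0l.
by rewrite -[RHS]mulr1 -[X in _ = _ * X]b2; ring.
Qed.

Definition cltrace x : Cl := x + clconj x.

Definition clsqnorm x : Cl := x * clconj x.

Definition quadratic_cone : set Cl :=
  [set x | (exists a : R, x = a%:A) \/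
           (exists t q : R, [/\ cltrace x = t%:A, clsqnorm x = q%:A &
                                4 * q > t ^+ 2])].

Definition imag_units : set Cl :=
  [set J | quadratic_cone J /\ J * J = -1].

Lemma cl_alg_inj : injective (fun a => a%:A : Cl).
Proof.
move=> a b /(congr1 (fun x : Cl => x finset.set0)).
by rewrite !clscaleE ffunE eqxx !mulr1.
Qed.

Lemma cl_algM a b : (a * b)%:A = a%:A * b%:A :> Cl.
Proof. by rewrite -[RHS]clscalerAl mul1r scalerA. Qed.

Lemma imag_unitsP J : imag_units J <-> cltrace J = 0 /\ clsqnorm J = 1.
Proof.
split=> [[[[a Ja]|[t [q [tJ qJ tq]]]] JJ]|[tJ qJ]].
- have : a * a = -1.
    by apply: cl_alg_inj; rewrite cl_algM -Ja JJ scaleN1r.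
  by have := sqr_ge0 a; rewrite expr2 => /[swap] ->; rewrite ler0N1.
- have tJE : t *: J = q%:A - 1.
    rewrite -qJ -JJ addrC /clsqnorm -mulrDr -/(cltrace J) tJ.
    by rewrite -scalerAr mulr1.
  have t0 : t = 0.
    apply/eqP/negPn/negP => t0.
    have JE : J = (t^-1 * (q - 1))%:A.
      by rewrite -scalerA scalerBl scale1r -tJE scalerA mulVf// scale1r.
    have : (t^-1 * (q - 1)) * (t^-1 * (q - 1)) = -1.
      by apply: cl_alg_inj; rewrite cl_algM -JE JJ scaleN1r.
    have := sqr_ge0 (t^-1 * (q - 1)); rewrite expr2 => /[swap] ->.
    by rewrite ler0N1.
  split; first by rewrite tJ t0 scale0r.
  by move: tJE; rewrite t0 scale0r qJ => /esym/eqP; rewrite subr_eq0 => /eqP.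
- have JcE : clconj J = - J by apply/eqP; rewrite -addr_eq0 addrC; apply/eqP.
  split; last by rewrite -qJ /clsqnorm JcE mulrN opprK.
  right; exists 0, 1; split; rewrite ?scale0r ?scale1r//.
  by rewrite expr0n/= mulr1.
Qed.

Definition clnorm x : R := Num.sqrt (\sum_A x A ^+ 2).

Lemma clnorm_ge0 x : 0 <= clnorm x. Proof. exact: sqrtr_ge0. Qed.

Lemma clnorm_sqr x : clnorm x ^+ 2 = \sum_A x A ^+ 2.
Proof. by rewrite sqr_sqrtr// sumr_ge0// => A _; exact: sqr_ge0. Qed.

Lemma cl_CauchySchwarz x y : \sum_A x A * y A <= clnorm x * clnorm y.
Proof.
have [xy0|xy0] := leP (\sum_A x A * y A) 0.
  by rewrite (le_trans xy0)// mulr_ge0// clnorm_ge0.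
rewrite -(@ler_pXn2r _ 2)// ?nnegrE ?mulr_ge0 ?clnorm_ge0 ?(ltW xy0)//.
rewrite exprMn !clnorm_sqr.
suff : 0 <= \sum_A \sum_B (x A * y B - x B * y A) ^+ 2.
  have -> : \sum_A \sum_B (x A * y B - x B * y A) ^+ 2 =
      2 * ((\sum_A x A ^+ 2) * (\sum_A y A ^+ 2) - (\sum_A x A * y A) ^+ 2).
    have e1 : (\sum_A x A ^+ 2) * (\sum_A y A ^+ 2) =
        \sum_A \sum_B (x A ^+ 2 * y B ^+ 2).
      by rewrite mulr_suml; apply: eq_bigr => A _; rewrite mulr_sumr.
    have e2 : (\sum_A x A * y A) ^+ 2 = \sum_A \sum_B (x A * y A * (x B * y B)).
      by rewrite expr2 mulr_suml; apply: eq_bigr => A _; rewrite mulr_sumr.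
    have e3 : \sum_A \sum_B (x A ^+ 2 * y B ^+ 2) =
        \sum_A \sum_B (x B ^+ 2 * y A ^+ 2) by rewrite exchange_big.
    rewrite mulrBr mulr_natl mulr2n e1 {2}e3 e2 -big_split/=.
    rewrite mulr_sumr -sumrB; apply: eq_bigr => A _.
    rewrite -big_split mulr_sumr -sumrB; apply: eq_bigr => B _ /=; ring.
  by rewrite pmulr_rge0// subr_ge0.
by apply: sumr_ge0 => A _; apply: sumr_ge0 => B _; exact: sqr_ge0.
Qed.

Lemma clnormD x y : clnorm (x + y) <= clnorm x + clnorm y.
Proof.
rewrite -(@ler_pXn2r _ 2)// ?nnegrE ?addr_ge0 ?clnorm_ge0//.
rewrite sqrrD !clnorm_sqr.
under eq_bigr do rewrite claddE sqrrD.
rewrite !big_split/= lerD2r lerD2l.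
by rewrite mulr2n lerD// cl_CauchySchwarz.
Qed.

Lemma clnormZ a x : clnorm (a *: x) = `|a| * clnorm x.
Proof.
rewrite /clnorm -sqrtr_sqr -sqrtrM ?sqr_ge0// mulr_sumr; congr Num.sqrt.
by apply: eq_bigr => A _; rewrite clscaleE exprMn.
Qed.

Lemma clnorm0_eq0 x : clnorm x = 0 -> x = 0.
Proof.
move=> x0; apply/ffunP => A; rewrite ffunE; apply/eqP.
have /eqP : \sum_A x A ^+ 2 = 0 by rewrite -clnorm_sqr x0 expr0n.
rewrite psumr_eq0 => [/allP/(_ A)|B _]; last exact: sqr_ge0.
by rewrite mem_index_enum sqrf_eq0 => /(_ isT).
Qed.

HB.instance Definition _ := Lmodule_isNormed.Build R Cl
  clnormD clnormZ clnorm0_eq0.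

Lemma normclE x : `|x| = Num.sqrt (\sum_A x A ^+ 2).
Proof. by []. Qed.

End Clifford.

(* The pair (a, b) stands for a + i b; in particular Cx 'rV[R]_n is C^n. *)
Notation Cx V := (V * V)%type.

Definition muli (V : zmodType) (w : Cx V) : Cx V := (- w.2, w.1).

Definition cxconj (V : zmodType) (w : Cx V) : Cx V := (w.1, - w.2).

Definition cxentry (D T : Type) (p q : nat) (F : D -> Cx 'M[T]_(p, q))
  (s : 'I_p) (t : 'I_q) : D -> Cx T := fun z => ((F z).1 s t, (F z).2 s t).

Section Wirtinger.
Variables (R : realType) (n : nat) (V : normedModType R).
Implicit Types (h : Cx 'rV[R]_n -> Cx V) (U : set (Cx 'rV[R]_n)).

Definition dalpha (t : 'I_n) h (z : Cx 'rV[R]_n) : Cx V :=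
  'D_(delta_mx ord0 t, 0) h z.

Definition dbeta (t : 'I_n) h (z : Cx 'rV[R]_n) : Cx V :=
  'D_(0, delta_mx ord0 t) h z.

Definition dz t h z : Cx V := 2^-1 *: (dalpha t h z - muli (dbeta t h z)).

Definition dzbar t h z : Cx V := 2^-1 *: (dalpha t h z + muli (dbeta t h z)).

Definition C1_on U h := forall z t, U z ->
  [/\ derivable h z (delta_mx ord0 t, 0), derivable h z (0, delta_mx ord0 t),
      {for z, continuous (dalpha t h)} & {for z, continuous (dbeta t h)}].

Definition holomorphic_on U h :=
  C1_on U h /\ forall z t, U z -> dzbar t h z = 0.

Definition holomorphic_mx (p q : nat) U (F : Cx 'rV[R]_n -> Cx 'M[V]_(p, q)) :=
  forall s t, holomorphic_on U (cxentry F s t).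

End Wirtinger.

Section Starlike.
Variables (R : realType) (n : nat).
Implicit Types (U A : set (Cx 'rV[R]_n)) (g : Cx 'rV[R]_n -> Cx 'rV[R]_n).

Definition unit_ball : set (Cx 'rV[R]_n) :=
  [set z : Cx 'rV[R]_n | Num.sqrt (\sum_t (z.1 ord0 t ^+ 2 + z.2 ord0 t ^+ 2)) < 1].

Definition holomorphic_map U g := @holomorphic_mx R n R^o 1 n U g.

Definition biholomorphic_onto_image U g :=
  [/\ holomorphic_map U g, open (g @` U) &
      exists2 k, holomorphic_map (g @` U) k & forall z, U z -> k (g z) = z].

Definition starlike_set A :=
  forall (w : Cx 'rV[R]_n) (t : R), A w -> 0 <= t <= 1 -> A (t *: w).

Definition starlike_mapping U g :=
  [/\ biholomorphic_onto_image U g, g 0 = 0 & starlike_set (g @` U)].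

End Starlike.

Section Slice.
Variables (R : realType) (m n : nat).
Local Notation Cl := (clifford R m).
Local Notation Cn := (Cx 'rV[R]_n).
Local Notation D := (@unit_ball R n).
Implicit Types (I J : Cl) (z : Cn) (x : 'rV[Cl]_n).

Definition vnorm x : R := Num.sqrt (\sum_t `|x ord0 t| ^+ 2).

Definition real_vec (a : 'rV[R]_n) : 'rV[Cl]_n := map_mx (fun c => c%:A) a.

Definition slice_pt J z : 'rV[Cl]_n := real_vec z.1 + J *: real_vec z.2.

Definition cplane I : set 'rV[Cl]_n := range (slice_pt I).

Definition slice_cone : set 'rV[Cl]_n := \bigcup_(I in @imag_units R m) cplane I.

Definition slice_ball : set 'rV[Cl]_n := slice_cone `&` [set x | vnorm x < 1].

Definition ball_slice I : set 'rV[Cl]_n := slice_ball `&` cplane I.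

Definition stem (p q : nat) (F : Cn -> Cx 'M[Cl]_(p, q)) :=
  forall z, D z -> F (cxconj z) = cxconj (F z).

Definition induces (p q : nat) (F : Cn -> Cx 'M[Cl]_(p, q))
    (f : 'rV[Cl]_n -> 'M[Cl]_(p, q)) :=
  forall z J, D z -> imag_units J -> f (slice_pt J z) = (F z).1 + J *: (F z).2.

Definition regular_stem (F : Cn -> Cx 'rV[Cl]_n) :=
  stem F /\ holomorphic_mx D F.

Definition slice_regular (f : 'rV[Cl]_n -> 'rV[Cl]_n) :=
  exists2 F, regular_stem F & induces F f.

Definition stem_deriv (F : Cn -> Cx 'rV[Cl]_n) : Cn -> Cx 'M[Cl]_n :=
  fun z => (\matrix_(s, t) (dz t (cxentry F ord0 s) z).1,
            \matrix_(s, t) (dz t (cxentry F ord0 s) z).2).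

(* f' is the derivative df/dx of f on the ball; the stem mapping F is
   determined by f on the unit ball as soon as 0 < m. *)
Definition is_slice_deriv (f : 'rV[Cl]_n -> 'rV[Cl]_n)
    (f' : 'rV[Cl]_n -> 'M[Cl]_n) :=
  exists F, [/\ regular_stem F, induces F f & induces (stem_deriv F) f'].

(* When f maps ball_slice I into cplane I, this is the restriction f_I read as
   a map of C^n through i <-> I. *)
Definition slice_restr I (f : 'rV[Cl]_n -> 'rV[Cl]_n) : Cn -> Cn :=
  fun z => xget 0 [set w | slice_pt I w = f (slice_pt I z)].

Definition slice_starlike (f : 'rV[Cl]_n -> 'rV[Cl]_n) :=
  exists I, [/\ imag_units I, f @` ball_slice I `<=` cplane I &
                starlike_mapping D (slice_restr I f)].

Definition normalized_slice_starlike (f : 'rV[Cl]_n -> 'rV[Cl]_n) :=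
  [/\ slice_regular f, slice_starlike f, f 0 = 0 &
      exists2 f', is_slice_deriv f f' & f' 0 = 1%:M].

End Slice.

(* Main.v *)
(* The growth theorem for a normalized starlike mapping g of the unit ball of
   C^n rests on the mappings v_t = g^-1 (t g) of the ball into itself.  For
   unit vectors u and p, the function 1 - <v_t (zeta u), p> / zeta of zeta in
   the disc has nonnegative real part, and Harnack's inequality for it gives

     |z| (1 - (1-t) (1+|z|)/(1-|z|)) <= |v_t z| <= |z| (1 - (1-t) (1-|z|)/(1+|z|)).

   Along the chain t = j/(j+1) these bounds telescope for |w| / (1 +- |w|)^2 up
   to errors O((1-t)^2), and they turn into bounds on |g z| because g is tangent
   to the identity at 0.  Harnack's inequality follows from the Poisson formula,
   in which the circle means are replaced by means over N-th roots of unity, so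
   that no integral is needed.

   For J in S_m, |f (alpha + J beta)|^2 is the convex combination of
   |f (alpha + I beta)|^2 and |f (alpha - I beta)|^2 with weights
   (1 + <I, J>)/2 and (1 - <I, J>)/2, hence the slice C_I controls all others.

   Equality holds for the componentwise Koebe function x (1 - x)^-2 at the real
   points (r, 0, ..., 0) and (-r, 0, ..., 0). *)
Require Import Defs.
From mathcomp Require Import all_boot all_order all_algebra.
From mathcomp Require Import all_classical all_reals all_analysis.
From mathcomp.real_closed Require Import complex.
From mathcomp Require Import ring lra.
Import Order.TTheory GRing.Theory Num.Theory.
Import numFieldNormedType.Exports.
Import Normc.
Local Notation Re := complex.Re.
Local Notation Im := complex.Im.
Local Open Scope classical_set_scope.
Local Open Scope ring_scope.

(** * Strict complex differentiability *)

(** All differentiation goes through strict differentiability. It bounds increments between any two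
    points near the base point, hence becomes uniform on a closed disc by compactness, and on open
    sets it matches continuous partial derivatives subject to the Cauchy-Riemann equations, in both
    directions.

    The function <v_t (zeta u), p> / zeta has a removable singularity at 0, and its value there
    would be a derivative of v_t. Harnack's inequality is therefore proved between two points of (0,
    1) for a function that vanishes at 0, and one of the points then tends to 0. The limit is t <u,
    p>, because g (v_t) = t g and g is tangent to the identity.

    The bounds for v_t are Euler steps, with tau = 1 - t, of the equations r' = - r (1 - r) / (1 +
    r) and r' = - r (1 + r) / (1 - r). Along their solutions r / (1 - r)^2, respectively r / (1 +
    r)^2, decays exactly like an exponential, since their logarithmic derivatives are (1 + r) / (r
    (1 - r)) and (1 - r) / (r (1 + r)). This singles out the Koebe quotients. *)

Section ComplexModulus.
Context {R : realType}.
Local Notation C := R[i].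
Implicit Types (x y z : C) (a b : R).

Lemma normcE z : normc z = Num.sqrt (Re z ^+ 2 + Im z ^+ 2).
Proof. by case: z. Qed.

Lemma normc_def z : `|z| = (normc z)%:C%C.
Proof. by case: z. Qed.

Lemma normc_ge0 z : 0 <= normc z.
Proof. by rewrite normcE sqrtr_ge0. Qed.

Lemma normc_eq0 z : (normc z == 0) = (z == 0).
Proof. by apply/eqP/eqP => [/eq0_normc//|->]; rewrite normc0. Qed.

Lemma normc_gt0 z : (0 < normc z) = (z != 0).
Proof. by rewrite lt_def normc_ge0 andbT normc_eq0. Qed.

Lemma normcD x y : normc (x + y) <= normc x + normc y.
Proof. by rewrite -lecR rmorphD/= -!normc_def ler_normD. Qed.

Lemma normcN z : normc (- z) = normc z.
Proof. by apply: complexI; rewrite -!normc_def normrN. Qed.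

Lemma normcB x y : normc (x - y) <= normc x + normc y.
Proof. by rewrite -[normc y]normcN normcD. Qed.

Lemma normc_distC x y : normc (x - y) = normc (y - x).
Proof. by rewrite -normcN opprB. Qed.

Lemma normcX z k : normc (z ^+ k) = normc z ^+ k.
Proof. by elim: k => [|k IH]; rewrite ?expr0 ?normc1// !exprS normcM IH. Qed.

Lemma normc_real a : normc a%:C%C = `|a|.
Proof. by rewrite /= expr0n/= addr0 sqrtr_sqr. Qed.

Lemma normc_conj z : normc (z^*)%C = normc z.
Proof. by case: z => a b /=; rewrite sqrrN. Qed.

Lemma normc_sum (I : Type) (r : seq I) (P : pred I) (F : I -> C) :
  normc (\sum_(i <- r | P i) F i) <= \sum_(i <- r | P i) normc (F i).
Proof.
elim/big_ind2: _ => //[|x a y b h1 h2]; first by rewrite normc0.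
by rewrite (le_trans (normcD _ _))// lerD.
Qed.

Lemma normc_triangle x y z : normc (x - z) <= normc (x - y) + normc (y - z).
Proof. by have := normcD (x - y) (y - z); rewrite addrA subrK. Qed.

Lemma normc_ge_Re z : `|Re z| <= normc z.
Proof.
by rewrite normcE -sqrtr_sqr ler_wsqrtr// lerDl sqr_ge0.
Qed.

Lemma normc_ge_Im z : `|Im z| <= normc z.
Proof.
by rewrite normcE -sqrtr_sqr ler_wsqrtr// lerDr sqr_ge0.
Qed.

Lemma normc_le_ReIm z : normc z <= `|Re z| + `|Im z|.
Proof.
have -> : z = (Re z)%:C%C + 'i%C * (Im z)%:C%C by exact: complexE.
rewrite (le_trans (normcD _ _))// normcM !normc_real.
have -> : normc 'i%C = 1 :> R by rewrite /= expr0n expr1n/= add0r sqrtr1.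
by rewrite mul1r; case: z => p q /=; rewrite !(mul0r, mul1r, mulr0, subr0, addr0, add0r).
Qed.

Lemma normc_sqr z : normc z ^+ 2 = Re z ^+ 2 + Im z ^+ 2.
Proof. by rewrite normcE sqr_sqrtr// addr_ge0 ?sqr_ge0. Qed.

Lemma mulc_conj z : z * (z^*)%C = (normc z ^+ 2)%:C%C.
Proof.
rewrite normc_sqr; case: z => a b; apply/eqP.
by rewrite eq_complex/=; apply/andP; split; apply/eqP; ring.
Qed.

Lemma cReD x y : Re (x + y) = Re x + Re y. Proof. by case: x y => ? ? []. Qed.
Lemma cImD x y : Im (x + y) = Im x + Im y. Proof. by case: x y => ? ? []. Qed.
Lemma cReN x : Re (- x) = - Re x. Proof. by case: x. Qed.
Lemma cImN x : Im (- x) = - Im x. Proof. by case: x. Qed.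
Lemma cReB x y : Re (x - y) = Re x - Re y. Proof. by rewrite cReD cReN. Qed.
Lemma cImB x y : Im (x - y) = Im x - Im y. Proof. by rewrite cImD cImN. Qed.
Lemma cReM x y : Re (x * y) = Re x * Re y - Im x * Im y.
Proof. by case: x y => ? ? []. Qed.
Lemma cImM x y : Im (x * y) = Re x * Im y + Im x * Re y.
Proof. by case: x y => ? ? []. Qed.
Lemma cReMr a x : Re (a%:C%C * x) = a * Re x.
Proof. by rewrite cReM/= mul0r subr0. Qed.

Lemma cImMr a x : Im (a%:C%C * x) = a * Im x.
Proof. by rewrite cImM/= mul0r addr0. Qed.

Lemma complex_ext x y : Re x = Re y -> Im x = Im y -> x = y.
Proof. by case: x y => ? ? [? ?] /= -> ->. Qed.

Lemma cRe_sum (I : Type) (r : seq I) (P : pred I) (F : I -> C) :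
  Re (\sum_(i <- r | P i) F i) = \sum_(i <- r | P i) Re (F i).
Proof. by apply: (big_morph (@Re R) cReD). Qed.

Lemma cIm_sum (I : Type) (r : seq I) (P : pred I) (F : I -> C) :
  Im (\sum_(i <- r | P i) F i) = \sum_(i <- r | P i) Im (F i).
Proof. by apply: (big_morph (@Im R) cImD). Qed.

End ComplexModulus.

Section StrictDerivative.
Context {R : realType}.
Local Notation C := R[i].
Implicit Types (f g : C -> C) (x y z c d : C).

(* Strict differentiability: unlike plain differentiability, on an open set it
   amounts to the existence of a continuous derivative. *)
Definition sder f x c := forall e : R, 0 < e -> exists2 d : R, 0 < d &
  forall y z, normc (y - x) < d -> normc (z - x) < d ->
  normc (f y - f z - c * (y - z)) <= e * normc (y - z).

Lemma sder_affine a b x : sder (fun y => a * y + b) x a.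
Proof.
move=> e e0; exists 1 => // y z _ _.
have -> : a * y + b - (a * z + b) - a * (y - z) = 0 by ring.
by rewrite normc0 mulr_ge0 ?normc_ge0// ltW.
Qed.

Lemma sder_id x : sder id x 1.
Proof.
move=> e e0; exists 1 => // y z _ _.
by rewrite mul1r subrr normc0 mulr_ge0 ?normc_ge0// ltW.
Qed.

Lemma sder_cst a x : sder (fun=> a) x 0.
Proof.
move=> e e0; exists 1 => // y z _ _.
by rewrite subrr mul0r subr0 normc0 mulr_ge0 ?normc_ge0// ltW.
Qed.

Lemma sder_lip f x c : sder f x c -> exists2 d : R, 0 < d &
  forall y z, normc (y - x) < d -> normc (z - x) < d ->
  normc (f y - f z) <= (normc c + 1) * normc (y - z).
Proof.
move=> /(_ 1 ltr01)[d d0 H]; exists d => // y z yd zd.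
have := normcD (f y - f z - c * (y - z)) (c * (y - z)).
rewrite subrK normcM => /le_trans; apply.
by rewrite mulrDl addrC lerD2l H.
Qed.

Lemma sder_cont f x c : sder f x c -> forall e : R, 0 < e ->
  exists2 d : R, 0 < d & forall y, normc (y - x) < d -> normc (f y - f x) < e.
Proof.
move=> /sder_lip[d d0 H] e e0.
have c1 : 0 < normc c + 1 by rewrite ltr_wpDl ?normc_ge0.
exists (Num.min d (e / (normc c + 1))); first by rewrite lt_min d0 divr_gt0.
move=> y; rewrite lt_min => /andP[yd ye].
rewrite (le_lt_trans (H _ _ yd _)) ?subrr ?normc0//.
by rewrite mulrC -ltr_pdivlMr.
Qed.

Lemma sderD f g x c d :
  sder f x c -> sder g x d -> sder (fun y => f y + g y) x (c + d).
Proof.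
move=> df dg e e0; have e20 : 0 < e / 2 by rewrite divr_gt0.
have [d1 d10 H1] := df _ e20; have [d2 d20 H2] := dg _ e20.
exists (Num.min d1 d2); first by rewrite lt_min d10.
move=> y z; rewrite !lt_min => /andP[y1 y2] /andP[z1 z2].
have -> : f y + g y - (f z + g z) - (c + d) * (y - z) =
  (f y - f z - c * (y - z)) + (g y - g z - d * (y - z)) by ring.
rewrite (le_trans (normcD _ _))//.
have := H1 _ _ y1 z1; have := H2 _ _ y2 z2; lra.
Qed.

Lemma sderM f g x c d : sder f x c -> sder g x d ->
  sder (fun y => f y * g y) x (c * g x + f x * d).
Proof.
move=> df dg e e0.
have [d1 d10 Lf] := sder_lip _ _ _ df.
set M := normc (f x) + normc (g x) + normc c + normc d + 2.
have ? := normc_ge0 (f x). have ? := normc_ge0 (g x).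
have ? := normc_ge0 c. have ? := normc_ge0 d.
have M0 : 0 < M by rewrite /M; lra.
pose e1 := Num.min 1 (e / (4 * M)).
have e10 : 0 < e1 by rewrite lt_min ltr01 divr_gt0// mulr_gt0.
have [d2 d20 H2] := df _ e10; have [d3 d30 H3] := dg _ e10.
have [d4 d40 H4] := sder_cont _ _ _ df _ e10.
have [d5 d50 H5] := sder_cont _ _ _ dg _ e10.
exists (Num.min d1 (Num.min d2 (Num.min d3 (Num.min d4 d5)))).
  by rewrite !lt_min d10 d20 d30 d40.
move=> y z; rewrite !lt_min => /and5P[y1 y2 y3 y4 y5] /and5P[z1 z2 z3 z4 z5].
(* (fy-fz)gy - c gx (y-z) = (fy - fz - c(y-z)) gx + (fy-fz)(gy - gx) *)
have -> : f y * g y - f z * g z - (c * g x + f x * d) * (y - z) =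
  (f y - f z - c * (y - z)) * g x + (f y - f z) * (g y - g x)
  + ((g y - g z - d * (y - z)) * f x + (f z - f x) * (g y - g z)) by ring.
have t4 (p q r s : C) : normc (p + q + (r + s)) <=
    normc p + normc q + (normc r + normc s).
  by rewrite (le_trans (normcD _ _))// lerD ?normcD.
rewrite (le_trans (t4 _ _ _ _))// !normcM.
have [h2 h3 h4 h5] := And4 (H2 _ _ y2 z2) (H3 _ _ y3 z3) (H4 _ z4) (H5 _ y5).
have hf := Lf _ _ y1 z1.
have hg : normc (g y - g z) <= (normc d + 1) * normc (y - z).
  have := normcD (g y - g z - d * (y - z)) (d * (y - z)).
  rewrite subrK normcM => /le_trans; apply.
  rewrite mulrDl addrC lerD2l (le_trans h3)// ler_wpM2r ?normc_ge0//.
  by rewrite /e1 ge_min lexx.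
have ? := normc_ge0 (y - z).
have : e1 * (4 * M) <= e by rewrite -ler_pdivlMr ?mulr_gt0// /e1 ge_min lexx orbT.
move: h2 h3 h4 h5 hf hg; set u := normc (y - z).
have ? : 0 <= u by [].
move=> h2 h3 h4 h5 hf hg eM.
have k1 : normc (f y - f z - c * (y - z)) * normc (g x) <= e1 * u * M.
  by rewrite ler_pM ?normc_ge0//; rewrite /M; lra.
have k2 : normc (f y - f z) * normc (g y - g x) <= (M * u) * e1.
  rewrite ler_pM ?normc_ge0// ?(ltW h5)// (le_trans hf)// ler_wpM2r// /M; lra.
have k3 : normc (g y - g z - d * (y - z)) * normc (f x) <= e1 * u * M.
  by rewrite ler_pM ?normc_ge0//; rewrite /M; lra.
have k4 : normc (f z - f x) * normc (g y - g z) <= e1 * (M * u).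
  rewrite ler_pM ?normc_ge0// ?(ltW h4)// (le_trans hg)// ler_wpM2r// /M; lra.
have := ler_wpM2r (_ : 0 <= u) eM => /(_ ltac:(assumption)); lra.
Qed.

Lemma sderV f x c : sder f x c -> f x != 0 ->
  sder (fun y => (f y)^-1) x (- c / f x ^+ 2).
Proof.
move=> df fx0 e e0.
set m := normc (f x); have m0 : 0 < m by rewrite normc_gt0.
have [d1 d10 Lf] := sder_lip _ _ _ df.
have hm : 0 < m / 2 by rewrite divr_gt0.
have [d2 d20 H2] := sder_cont _ _ _ df _ hm.
have ? := normc_ge0 c.
(* 1/fy - 1/fz = -(fy - fz)/(fy fz) and
   1/(fy fz) - 1/fx^2 = ((fx - fy) fx + fy (fx - fz))/(fy fz fx^2) *)
pose e1 := Num.min (e * m ^+ 2 / 8) (e * m ^+ 3 / (24 * (normc c + 1))).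
have c10 : 0 < normc c + 1 by lra.
have e10 : 0 < e1.
  by rewrite lt_min !divr_gt0 ?mulr_gt0 ?exprn_gt0.
have [d3 d30 H3] := df _ e10; have [d4 d40 H4] := sder_cont _ _ _ df _ e10.
exists (Num.min d1 (Num.min d2 (Num.min d3 d4))).
  by rewrite !lt_min d10 d20 d30.
move=> y z; rewrite !lt_min => /and4P[y1 y2 y3 y4] /and4P[z1 z2 z3 z4].
have far w : normc (w - x) < d2 -> m / 2 < normc (f w).
  move=> /H2 h; have := normcD (f w) (f x - f w).
  rewrite addrC subrK normc_distC -/m; lra.
have [my mz] := (far _ y2, far _ z2).
have fy0 : f y != 0 by rewrite -normc_gt0; lra.
have fz0 : f z != 0 by rewrite -normc_gt0; lra.
have -> : (f y)^-1 - (f z)^-1 - - c / f x ^+ 2 * (y - z) =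
   - ((f y - f z - c * (y - z)) / (f y * f z)
     + c * (y - z) * ((f x - f y) * f x + f y * (f x - f z))
       / (f y * f z * f x ^+ 2)).
  by field; rewrite fx0 fy0 fz0.
rewrite normcN (le_trans (normcD _ _))// !normcM !normcV !normcM -!expr2.
have h3 := H3 _ _ y3 z3.
have h4 : normc (f x - f y) <= e1 by rewrite normc_distC ltW// H4.
have h5 : normc (f x - f z) <= e1 by rewrite normc_distC ltW// H4.
have hy : normc (f y) <= 3 / 2 * m.
  have := normcD (f y - f x) (f x); rewrite subrK -/m => ?.
  by have := H2 _ y2; lra.
move: h3 my mz hy; rewrite -/m.
set u := normc (y - z); set p := normc (f y); set q := normc (f z).
have u0 : 0 <= u := normc_ge0 _.
move=> h3 my mz hy.
have p0 : 0 < p by lra. have q0 : 0 < q by lra.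
have pq : m ^+ 2 / 4 <= p * q.
  have -> : m ^+ 2 / 4 = (m / 2) * (m / 2) by field.
  by rewrite ler_pM//; lra.
have k1 : normc (f y - f z - c * (y - z)) / (p * q) <= e / 2 * u.
  rewrite ler_pdivrMr ?mulr_gt0// (le_trans h3)//.
  have : e1 <= e * m ^+ 2 / 8 by rewrite /e1 ge_min lexx.
  move=> /(ler_wpM2r u0) /le_trans; apply.
  have -> : e * m ^+ 2 / 8 * u = e / 2 * u * (m ^+ 2 / 4) by field.
  by rewrite ler_wpM2l// mulr_ge0//; lra.
have nn : normc ((f x - f y) * f x + f y * (f x - f z)) <= 5 / 2 * m * e1.
  rewrite (le_trans (normcD _ _))// !normcM -/m -/p.
  have : normc (f x - f y) * m <= e1 * m by rewrite ler_wpM2r//; lra.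
  have : p * normc (f x - f z) <= (3 / 2 * m) * e1.
    by rewrite ler_pM ?normc_ge0//; lra.
  lra.
suff k2 : normc c * u * normc ((f x - f y) * f x + f y * (f x - f z))
    / (p * q * m ^+ 2) <= e / 2 * u.
  by move: k1 k2; rewrite -/p -/q; lra.
rewrite ler_pdivrMr ?mulr_gt0 ?exprn_gt0//.
have k3 : normc c * u * normc ((f x - f y) * f x + f y * (f x - f z))
    <= normc c * u * (5 / 2 * m * e1).
  by rewrite ler_wpM2l ?mulr_ge0.
apply: (le_trans k3).
have : e1 * (normc c + 1) <= e * m ^+ 3 / 24.
  have : e1 <= e * m ^+ 3 / (24 * (normc c + 1)) by rewrite /e1 ge_min lexx orbT.
  move=> /(ler_wpM2r (ltW c10)) /le_trans; apply; rewrite le_eqVlt.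
  by apply/orP; left; apply/eqP; field; rewrite lt0r_neq0.
move=> he.
have he' : normc c * e1 <= e * m ^+ 3 / 24.
  by apply: le_trans he; rewrite mulrC ler_wpM2l ?(ltW e10)//; lra.
have -> : normc c * u * (5 / 2 * m * e1) = (normc c * e1) * (5 / 2 * (m * u)) by ring.
have mu : 0 <= 5 / 2 * (m * u) by rewrite !mulr_ge0// ltW.
apply: (le_trans (ler_wpM2r mu he')).
have : e / 2 * u * (m ^+ 2 / 4 * m ^+ 2) <= e / 2 * u * (p * q * m ^+ 2).
  rewrite ler_wpM2l ?mulr_ge0//; first lra.
  by rewrite ler_wpM2r ?sqr_ge0.
apply: le_trans.
have -> : e / 2 * u * (m ^+ 2 / 4 * m ^+ 2) = (e * m ^+ 3) * (m * u) * (1 / 8) by field.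
have -> : e * m ^+ 3 / 24 * (5 / 2 * (m * u)) =
   (e * m ^+ 3) * (m * u) * (5 / 48) by field.
rewrite ler_wpM2l//; last lra.
by rewrite !mulr_ge0 ?exprn_ge0// ltW.
Qed.

End StrictDerivative.


(** * Discrete Cauchy and Poisson formulas *)

Section DiscreteCauchy.
Context {R : realType}.
Local Notation C := R[i].
Implicit Types (X : C -> C) (x y z w : C).

(** Strictness is what allows compactness here: the derivative [c] found at one point controls all
    pairs of points nearby, so the same [c] serves every base point of a small neighbourhood. The
    slope may thus be chosen separately at each point while the radius is common to all. *)
Lemma sder_uniform X : (forall z, normc z <= 1 -> exists c, sder X z c) ->
  forall e : R, 0 < e -> exists2 d : R, 0 < d &
  forall x, normc x <= 1 -> exists c, forall y, normc (y - x) < d ->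
  normc (X y - X x - c * (y - x)) <= e * normc (y - x).
Proof.
move=> dX e e0.
(* The covering argument runs over a square that contains the disc. Points outside the closed disc
   have a neighbourhood where [P] holds vacuously. *)
pose K : set (R * R) := `[-1, 1]%classic `*` `[-1, 1]%classic.
have cK : compact K by apply: compact_setX; exact: segment_compact.
pose P (d : R) (p : R * R) := 0 < d /\ (normc (p.1 +i* p.2)%C <= 1 ->
  exists c, forall y, normc (y - (p.1 +i* p.2)%C) < d ->
  normc (X y - X (p.1 +i* p.2)%C - c * (y - (p.1 +i* p.2)%C))
    <= e * normc (y - (p.1 +i* p.2)%C)).
have nearC (p : R * R) (r : R) : 0 < r ->
    \forall q \near p, normc ((q.1 +i* q.2)%C - (p.1 +i* p.2)%C) < r.
  move=> r0; have r20 : 0 < r / 2 by rewrite divr_gt0.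
  have := nbhsx_ballx p _ r20; apply: filterS => q [h1 h2].
  apply: (le_lt_trans (normc_le_ReIm _)) => /=.
  rewrite distrC [X in _ + X]distrC [X in _ < X]splitr; exact: ltrD h1 h2.
have H : forall x : R * R, K x -> \forall x' \near x & i \near 0^'+, P i x'.
  move=> p _; set x := (p.1 +i* p.2)%C.
  have [x1|x1] := leP (normc x) 1.
    have [c dc] := dX _ x1; have [d d0 Hd] := dc _ e0.
    have d20 : 0 < d / 2 by rewrite divr_gt0.
    have h1 := nearC p _ d20.
    have h2 : \forall i \near (0 : R)^'+, 0 < i < d / 2.
      near=> i; apply/andP; split; near: i; first exact: nbhs_right_gt.
      exact: nbhs_right_lt.
    exists ([set q : R * R | normc ((q.1 +i* q.2)%C - x) < d / 2],
            [set i : R | 0 < i < d / 2]) => //.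
    move=> [q i] /= [hq /andP[i0 id]]; split=> // _; exists c => y hy.
    apply: Hd; last by rewrite (lt_trans hq)//; lra.
    rewrite (le_lt_trans (normc_triangle y (q.1 +i* q.2)%C x))// [X in _ < X]splitr.
    by rewrite ltrD// (lt_trans hy).
  have x10 : 0 < normc x - 1 by rewrite subr_gt0.
  have h1 := nearC p _ x10.
  exists ([set q : R * R | normc ((q.1 +i* q.2)%C - x) < normc x - 1],
            [set i : R | 0 < i]).
    by split => //=; exact: nbhs_right_gt.
  move=> [q i] /= [hq i0]; split=> // q1.
  have := normcD (x - (q.1 +i* q.2)%C) (q.1 +i* q.2)%C.
  rewrite subrK leNgt => /negP; case; rewrite -[ltRHS](subrK 1) ltr_leD//.
  by rewrite normc_distC.
have F0 : ProperFilter (0 : R)^'+ by typeclasses eauto.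
have nP := (iffLR (compact_near_coveringP K)) cK R (0^'+) P (@filter_filter _ _ F0) H.
have [d /= Pd] : exists d, K `<=` P d.
  exact: filter_ex nP.
have K0 : K (0, 0) by split; rewrite /= in_itv/=; lra.
exists d; first by case: (Pd _ K0).
move=> x x1; have := Pd (Re x, Im x); rewrite /P/=; case: x x1 => a b x1 /=.
have := normc_ge_Re (a +i* b)%C; have := normc_ge_Im (a +i* b)%C => /= hb ha.
case=> [|_ /(_ x1)//].
split; rewrite /= in_itv/= -ler_norml.
  exact: le_trans x1.
exact: le_trans x1.
Unshelve. all: by end_near. Qed.

Definition cmean (N : nat) w (F : C -> C) := N%:R^-1 * \sum_(k < N) F (w ^+ k).

Lemma normc_nat N : normc (N%:R : C) = N%:R.
Proof. by rewrite -(rmorph_nat (real_complex R)) normc_real ger0_norm. Qed.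

Lemma normc_unity_root N w : (0 < N)%N -> w ^+ N = 1 -> normc w = 1.
Proof.
move=> N0 /(congr1 (@normc R)); rewrite normcX normc1 => /eqP.
by rewrite pexpr_eq1 ?normc_ge0// => /eqP.
Qed.

Lemma cmeanB N w F G :
  cmean N w (fun z => F z - G z) = cmean N w F - cmean N w G.
Proof. by rewrite /cmean sumrB mulrBr. Qed.

Lemma cmeanZ N w a F : cmean N w (fun z => a * F z) = a * cmean N w F.
Proof. by rewrite /cmean -mulr_sumr mulrCA. Qed.

Lemma eq_cmean N w F G : (0 < N)%N -> w ^+ N = 1 ->
  (forall z, normc z = 1 -> F z = G z) -> cmean N w F = cmean N w G.
Proof.
move=> N0 wN FG; rewrite /cmean; congr (_ * _); apply: eq_bigr => k _.
by apply: FG; rewrite normcX (normc_unity_root _ _ N0 wN) expr1n.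
Qed.

(* Homotopy z_s = al + s (z - al) from the circle to the point al: the
   s-derivative of the mean is a mean of X'(z_s) z, which is a telescoping sum
   up to uniformly small errors. *)
Lemma discrete_cauchy X (al : R) : 0 <= al < 1 ->
  (forall z, normc z <= 1 -> exists c, sder X z c) ->
  forall e : R, 0 < e -> exists2 d : R, 0 < d &
  forall N w, (0 < N)%N -> w ^+ N = 1 -> w != 1 -> normc (w - 1) < d ->
  normc (cmean N w (fun z => X z * (z / (z - al%:C%C)))
         - X al%:C%C * cmean N w (fun z => z / (z - al%:C%C))) <= e.
Proof.
move=> /andP[al0 al1] dX e e0; have e20 : 0 < e / 2 by rewrite divr_gt0.
have [d d0 Ud] := sder_uniform _ dX _ e20; exists d => // N w N0 wN w1 wd.
have wn := normc_unity_root _ _ N0 wN.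
have wkn k : normc (w ^+ k) = 1 by rewrite normcX wn expr1n.
set a := al%:C%C; have an : normc a = al by rewrite normc_real ger0_norm.
have wa0 k : w ^+ k - a != 0.
  rewrite -normc_gt0; have := normc_triangle (w ^+ k) a 0.
  by rewrite !subr0 wkn an; lra.
have wa2 k : normc (w ^+ k - a) <= 2.
  by rewrite (le_trans (normcB _ _))// wkn an; lra.
(* Since [w ^+ k - a] has modulus at most 2, consecutive points of the homotopy are at distance at
   most [2 / M], within the uniform radius. *)
pose M := (Num.truncn (2 / d)).+1.
have M0 : 0 < M%:R :> R by rewrite ltr0n.
have Md : 2 / M%:R < d.
  by rewrite ltr_pdivrMr// mulrC -ltr_pdivrMr// truncnS_gt.
pose s j : C := (j%:R / M%:R : R)%:C%C.
pose p j k := a + s j * (w ^+ k - a).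
have p_disc j k : (j <= M)%N -> normc (p j k) <= 1.
  move=> jM; set r : R := j%:R / M%:R.
  have /andP[r0 r1] : 0 <= r <= 1.
    by rewrite /r divr_ge0//= ler_pdivrMr// mul1r ler_nat.
  have -> : p j k = (1 - r)%:C%C * a + r%:C%C * w ^+ k.
    by rewrite /p /s -/r rmorphB/= rmorph1; ring.
  rewrite (le_trans (normcD _ _))// !normcM !normc_real wkn -/a.
  rewrite !ger0_norm ?subr_ge0//.
  nra.
pose m j := cmean N w (fun z => X (a + s j * (z - a)) * (z / (z - a))).
have step j : (j < M)%N -> normc (m j.+1 - m j) <= e / M%:R.
  move=> jM.
  have /choice[c Hc] : forall k, exists c, forall y, normc (y - p j.+1 k) < d ->
      normc (X y - X (p j.+1 k) - c * (y - p j.+1 k))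
      <= e / 2 * normc (y - p j.+1 k).
    by move=> k; apply: Ud; apply: p_disc.
  have sj0 : 0 < (j.+1%:R / M%:R : R) by rewrite divr_gt0 ?ltr0n.
  have sj1 : (j.+1%:R / M%:R : R) <= 1.
    by rewrite ler_pdivrMr// mul1r ler_nat.
  have snorm : normc (s j.+1) = j.+1%:R / M%:R by rewrite normc_real gtr0_norm.
  have sjj : s j.+1 - s j = (M%:R^-1 : R)%:C%C.
    by rewrite /s -rmorphB/= -mulrBl -natrB// subSnn mul1r.
  have w10 : 0 < normc (w - 1) by rewrite normc_gt0 subr_eq0.
  (* The increments of [X] around the closed polygon [p j.+1] add up to 0 as [w ^+ N = 1], and each
     is close to [c k * w ^+ k * (s j.+1 * (w - 1))]. Dividing by the common factor is possible
     because [s j.+1] is positive. This is why the slopes are taken at the end of the step and not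
     at its start, where [s 0] vanishes. *)
  have rot : normc (N%:R^-1 * \sum_(k < N) c k * w ^+ k) <= e / 2.
    have tele : \sum_(k < N) (X (p j.+1 k.+1) - X (p j.+1 k)) = 0.
      rewrite -(big_mkord xpredT (fun k => X (p j.+1 k.+1) - X (p j.+1 k))).
      by rewrite telescope_sumr// /p wN expr0 subrr.
    have ub : normc (\sum_(k < N) c k * w ^+ k) * ((j.+1%:R / M%:R) * normc (w - 1))
        <= (N%:R * (e / 2)) * ((j.+1%:R / M%:R) * normc (w - 1)).
      rewrite -snorm -!normcM.
      have -> : (\sum_(k < N) c k * w ^+ k) * (s j.+1 * (w - 1)) =
         - \sum_(k < N) (X (p j.+1 k.+1) - X (p j.+1 k)
                 - c k * (p j.+1 k.+1 - p j.+1 k)).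
        rewrite sumrB tele sub0r opprK mulr_suml; apply: eq_bigr => k _.
        by rewrite /p exprSr; ring.
      rewrite normcN (le_trans (normc_sum _ _ _ _))//.
      rewrite -mulrA mulr_natl -[X in _ *+ X]card_ord -sumr_const.
      apply: ler_sum => k _.
      have E : normc (p j.+1 k.+1 - p j.+1 k) = normc (s j.+1 * (w - 1)).
        have -> : p j.+1 k.+1 - p j.+1 k = w ^+ k * (s j.+1 * (w - 1)).
          by rewrite /p exprSr; ring.
        by rewrite normcM wkn mul1r.
      rewrite -E; apply: Hc; rewrite E normcM snorm.
      by rewrite (le_lt_trans _ wd)// ler_piMl// normc_ge0.
    rewrite normcM normcV normc_nat ler_pdivrMl ?ltr0n//.
    by rewrite -(ler_pM2r (mulr_gt0 sj0 w10)).
  (* The weight [z / (z - a)] cancels the factor [w ^+ k - a] of the radial increment. What remains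
     of the linear part is the sum bounded in [rot]. *)
  have -> : m j.+1 - m j = (M%:R^-1 : R)%:C%C * (N%:R^-1 * \sum_(k < N) c k * w ^+ k)
    - N%:R^-1 * \sum_(k < N) (X (p j k) - X (p j.+1 k)
        - c k * (p j k - p j.+1 k)) * (w ^+ k / (w ^+ k - a)).
    rewrite mulrCA -mulrBr /m /cmean -mulrBr; congr (_ * _).
    rewrite mulr_sumr -!sumrB; apply: eq_bigr => k _.
    have -> : p j k - p j.+1 k = - ((M%:R^-1 : R)%:C%C * (w ^+ k - a)).
      by rewrite -sjj /p; ring.
    rewrite -/(p j k) -/(p j.+1 k).
    by field; rewrite ?wa0 ?pnatr_eq0 ?fmorph_eq0.
  rewrite (le_trans (normcB _ _))//.
  have h1 : normc ((M%:R^-1 : R)%:C%C * (N%:R^-1 * \sum_(k < N) c k * w ^+ k))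
      <= M%:R^-1 * (e / 2).
    by rewrite normcM normc_real ger0_norm ?invr_ge0// ler_wpM2l ?invr_ge0.
  have h2 : normc (N%:R^-1 * \sum_(k < N) (X (p j k) - X (p j.+1 k)
        - c k * (p j k - p j.+1 k)) * (w ^+ k / (w ^+ k - a))) <= M%:R^-1 * (e / 2).
    rewrite normcM normcV normc_nat ler_pdivrMl ?ltr0n//.
    rewrite (le_trans (normc_sum _ _ _ _))//.
    rewrite mulr_natl -[X in _ *+ X]card_ord -sumr_const.
    apply: ler_sum => k _.
    have E : normc (p j k - p j.+1 k) = M%:R^-1 * normc (w ^+ k - a).
      have -> : p j k - p j.+1 k = - ((M%:R^-1 : R)%:C%C * (w ^+ k - a)).
        by rewrite -sjj /p; ring.
      by rewrite normcN normcM normc_real ger0_norm ?invr_ge0.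
    have Ed : normc (p j k - p j.+1 k) < d.
      rewrite E (le_lt_trans _ Md)// mulrC ler_wpM2r ?invr_ge0//.
    have := Hc k _ Ed; rewrite normcM normcM normcV wkn mul1r E => h.
    rewrite ler_pdivrMr ?normc_gt0// (le_trans h)//.
    by rewrite le_eqVlt; apply/orP; left; apply/eqP; ring.
  by rewrite (le_trans (lerD h1 h2))// -mulrDr -splitr mulrC.
have all_steps j : (j <= M)%N -> normc (m j - m 0%N) <= j%:R * (e / M%:R).
  elim: j => [_|j IH jM]; first by rewrite subrr normc0 mul0r.
  rewrite (le_trans (normc_triangle _ (m j) _))// -natr1 mulrDl mul1r addrC.
  by rewrite lerD ?IH ?step// ltnW.
have := all_steps M (leqnn M); rewrite mulrCA divff ?lt0r_neq0// mulr1.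
rewrite /m.
have -> : cmean N w (fun z => X (a + s M * (z - a)) * (z / (z - a))) =
  cmean N w (fun z => X z * (z / (z - a))).
  rewrite /cmean; congr (_ * _); apply: eq_bigr => k _.
  by rewrite /s divff ?lt0r_neq0// rmorph1 mul1r addrC subrK.
suff -> : cmean N w (fun z => X (a + s 0%N * (z - a)) * (z / (z - a))) =
  X a * cmean N w (fun z => z / (z - a)) by [].
rewrite -cmeanZ /cmean; congr (_ * _); apply: eq_bigr => k _.
by rewrite /s mul0r rmorph0 mul0r addr0.
Qed.

Lemma small_unity_root (d : R) : 0 < d ->
  exists N w, [/\ (0 < N)%N, w ^+ N = 1, w != 1 & normc (w - 1) < d].
Proof.
move=> d0; have d20 : 0 < d / 2 by rewrite divr_gt0.
have n1 : \forall t \near (0 : R), `|cos t - 1| < d / 2.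
  have := @continuous_cos R 0; rewrite /continuous_at cos0.
  by move=> /cvgr_distC_lt/(_ _ d20); apply: filterS => t; rewrite distrC.
have n2 : \forall t \near (0 : R), `|sin t| < d / 2.
  have := @continuous_sin R 0; rewrite /continuous_at sin0.
  by move=> /cvgr_distC_lt/(_ _ d20); apply: filterS => t; rewrite subr0.
have [r /= r0 Hr] : \forall t \near (0 : R), `|cos t - 1| < d / 2 /\ `|sin t| < d / 2.
  by near=> t; split; near: t.
have pi0 := @pi_gt0 R.
(* Three is added to make [N] at least 3: then the angle [2 * pi / N] is below [pi], its sine is
   positive, and the root differs from 1. *)
pose N := (Num.truncn (2 * pi / r)).+3.
have N3 : 3 <= N%:R :> R by rewrite ler_nat.
have N0 : 0 < N%:R :> R by rewrite ltr0n.
pose t : R := 2 * pi / N%:R.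
have t0 : 0 < t by rewrite divr_gt0// mulr_gt0.
have tr : t < r.
  rewrite /t ltr_pdivrMr// [ltRHS]mulrC -ltr_pdivrMr//.
  by apply: (lt_le_trans (truncnS_gt _)); rewrite ler_nat /N leqW.
have tpi : t < pi.
  rewrite /t ltr_pdivrMr//; nra.
have pw k : (cos t +i* sin t)%C ^+ k = (cos (k%:R * t) +i* sin (k%:R * t))%C.
  elim: k => [|k IH]; first by rewrite expr0 mul0r cos0 sin0.
  rewrite exprSr IH -natr1 mulrDl mul1r cosD sinD; apply: complex_ext => /=; ring.
exists N, (cos t +i* sin t)%C; split => //.
- rewrite pw /t mulrC divfK ?lt0r_neq0//.
  by rewrite mulr_natl cos2pi sin2pi.
- apply/eqP => /(congr1 (@complex.Im R)) /= s0.
  by have := @sin_gt0_pi R t; rewrite s0 ltxx t0 tpi => /(_ isT).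
- have [h1 h2] : `|cos t - 1| < d / 2 /\ `|sin t| < d / 2.
    by apply: Hr; rewrite /= sub0r normrN gtr0_norm.
  apply: (le_lt_trans (normc_le_ReIm _)) => /=.
  by rewrite oppr0 addr0; lra.
Unshelve. all: by end_near. Qed.

End DiscreteCauchy.


(** * The Poisson kernel and Harnack's inequality *)

Section Harnack.
Context {R : realType}.
Local Notation C := R[i].
Implicit Types (X chi phi : C -> C) (x y z w c d : C) (a b e : R).

Lemma sder_comp (f g : C -> C) x c d :
  sder f (g x) c -> sder g x d -> sder (f \o g) x (c * d).
Proof.
move=> df dg e e0.
have c0 := normc_ge0 c; have d0 := normc_ge0 d.
have L0 : 0 < normc d + 1 by lra.
have c10 : 0 < normc c + 1 by lra.
have e1 : 0 < e / 2 / (normc d + 1) by rewrite !divr_gt0.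
have e2 : 0 < e / 2 / (normc c + 1) by rewrite !divr_gt0.
have [r1 r10 H1] := df _ e1; have [r2 r20 H2] := dg _ e2.
have [r3 r30 H3] := sder_cont _ _ _ dg _ r10.
have [r4 r40 H4] := sder_lip _ _ _ dg.
exists (Num.min r2 (Num.min r3 r4)); first by rewrite !lt_min r20 r30.
move=> y z; rewrite !lt_min => /and3P[y2 y3 y4] /and3P[z2 z3 z4] /=.
have -> : f (g y) - f (g z) - c * d * (y - z) =
  (f (g y) - f (g z) - c * (g y - g z)) + c * (g y - g z - d * (y - z)) by ring.
rewrite (le_trans (normcD _ _))// normcM [in leRHS](splitr e) mulrDl lerD//.
  rewrite (le_trans (H1 _ _ (H3 _ y3) (H3 _ z3)))//.
  rewrite (le_trans (ler_wpM2l (ltW e1) (H4 _ _ y4 z4)))//.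
  by rewrite mulrA divfK// gt_eqF.
rewrite (le_trans (ler_wpM2l c0 (H2 _ _ y2 z2)))// mulrA.
rewrite ler_wpM2r ?normc_ge0// mulrCA ler_piMr ?divr_ge0//; first by lra.
by rewrite ler_pdivrMr//; lra.
Qed.

Lemma circle_inv z : normc z = 1 -> (z^*)%C = z^-1.
Proof.
move=> z1; have z0 : z != 0 by rewrite -normc_gt0 z1.
by apply: (mulfI z0); rewrite mulc_conj z1 expr1n divff// rmorph1.
Qed.

Lemma conjcB_real a z : normc z = 1 -> ((z - a%:C%C)^*)%C = z^-1 - a%:C%C.
Proof. by move=> z1; rewrite -circle_inv//; rewrite rmorphB/= oppr0. Qed.

Lemma sder_cauchy_kernel a z : 0 <= a < 1 -> normc z <= 1 ->
  exists c, sder (fun y => (1 - a%:C%C * y)^-1) z c.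
Proof.
move=> /andP[a0 a1] z1; exists (- (- a%:C%C) / (1 - a%:C%C * z) ^+ 2).
apply: (sderV (fun y => 1 - a%:C%C * y)).
  have := sder_affine (- a%:C%C) 1 z.
  by congr (sder _ _ _); apply/funext => y; rewrite mulNr addrC.
rewrite -normc_gt0; have := normc_triangle 1 (a%:C%C * z) 0.
rewrite !subr0 normc1 normcM normc_real ger0_norm// => h.
have := ler_piMr a0 z1; lra.
Qed.

Lemma cmean_conj N w (F : C -> C) :
  cmean N w (fun z => (F z)^*%C) = ((cmean N w F)^*)%C.
Proof.
by rewrite /cmean rmorphM/= fmorphV rmorph_nat rmorph_sum.
Qed.

(** On the unit circle the conjugate of [z / (z - a)] is [(1 - a z)^-1], which is analytic on the
    closed disc and equals 1 at 0. The discrete Cauchy formula with base point 0 applies to it. *)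
Lemma mean_cauchy_kernel a : 0 <= a < 1 -> forall e, 0 < e ->
  exists2 d : R, 0 < d &
  forall N w, (0 < N)%N -> w ^+ N = 1 -> w != 1 -> normc (w - 1) < d ->
  normc (cmean N w (fun z => z / (z - a%:C%C)) - 1) <= e.
Proof.
move=> a01 e e0; pose X (z : C) := (1 - a%:C%C * z)^-1.
have z01 : 0 <= (0 : R) < 1 by rewrite lexx ltr01.
have [d d0 H] := discrete_cauchy X _ z01
  (fun z h => sder_cauchy_kernel a z a01 h) _ e0.
exists d => // N w N0 wN w1 wd; have := H _ _ N0 wN w1 wd.
rewrite rmorph0 (eq_cmean N w _ X N0 wN); last first.
  move=> z z1; rewrite subr0 divff ?mulr1//.
  by rewrite -normc_gt0 z1.
rewrite (eq_cmean N w (fun z => z / (z - 0)) (fun=> 1) N0 wN); last first.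
  move=> z z1; rewrite subr0 divff//.
  by rewrite -normc_gt0 z1.
have -> : cmean N w (fun=> 1) = 1 :> C.
  rewrite /cmean sumr_const card_ord mulVf// -(rmorph_nat (real_complex R)).
  by rewrite fmorph_eq0 pnatr_eq0 -lt0n.
rewrite /X mulr0 subr0 invr1 mulr1.
rewrite -normc_conj rmorphB rmorph1 /= -cmean_conj.
rewrite (eq_cmean N w _ (fun z => z / (z - a%:C%C)) N0 wN)// => z z1.
have z0 : z != 0 by rewrite -normc_gt0 z1.
rewrite fmorphV rmorphB rmorph1 rmorphM/= circle_inv// oppr0.
have az : z - a%:C%C != 0.
  rewrite -normc_gt0; have := normc_triangle z a%:C%C 0.
  move/andP: a01 => [a0 a1].
  by rewrite !subr0 z1 normc_real ger0_norm//; lra.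
by rewrite complexr0; field; rewrite z0 az.
Qed.

Definition poisson a z : R := (1 - a ^+ 2) / normc (z - a%:C%C) ^+ 2.

Lemma poisson_bounds a z : 0 < a < 1 -> normc z = 1 ->
  (1 - a) / (1 + a) <= poisson a z <= (1 + a) / (1 - a).
Proof.
move=> /andP[a0 a1] z1; rewrite /poisson.
have an : normc a%:C%C = a by rewrite normc_real gtr0_norm.
have h1 : 1 - a <= normc (z - a%:C%C).
  by have := normc_triangle z a%:C%C 0; rewrite !subr0 z1 an; lra.
have h2 : normc (z - a%:C%C) <= 1 + a by rewrite (le_trans (normcB _ _))// z1 an.
set n := normc _ in h1 h2 *; have n0 : 0 < n by lra.
rewrite !ler_pdivrMr ?ler_pdivlMr ?exprn_gt0//; try lra.
apply/andP; split.
  rewrite mulrAC ler_pdivlMr ?exprn_gt0//.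
  have : n ^+ 2 <= (1 + a) ^+ 2 by rewrite ler_pXn2r ?nnegrE//; lra.
  have : 0 < 1 - a by lra.
  nra.
rewrite mulrAC ler_pdivlMr; last by lra.
have : (1 - a) ^+ 2 <= n ^+ 2 by rewrite ler_pXn2r ?nnegrE//; lra.
have : 0 < 1 + a by lra.
nra.
Qed.

(** With [X z = chi z (1 - a^2) / (1 - a z)], partial fractions on the circle turn the integrand
    into [a^-1 (X z (z / (z - a)) - X z)]. The Cauchy formula at [a] and at 0 gives
    [a^-1 (X a - X 0)], where [X a = chi a] and [X 0 = 0]. Multiplying by the conjugate of [z]
    replaces division by [z] on the circle, so that no singularity at 0 appears. *)
Lemma poisson_mean chi a : 0 < a < 1 -> chi 0 = 0 ->
  (forall z, normc z <= 1 -> exists c, sder chi z c) ->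
  forall e, 0 < e -> exists2 d : R, 0 < d &
  forall N w, (0 < N)%N -> w ^+ N = 1 -> w != 1 -> normc (w - 1) < d ->
  normc (cmean N w (fun z => chi z * (z^*)%C * (poisson a z)%:C%C)
         - chi a%:C%C / a%:C%C) <= e.
Proof.
move=> a01 chi0 dchi e e0; have /andP[a0 a1] := a01.
have a01' : 0 <= a < 1 by rewrite ltW.
have ac0 : a%:C%C != 0 :> C by rewrite fmorph_eq0 gt_eqF.
pose X z := chi z * ((1 - a ^+ 2)%:C%C * (1 - a%:C%C * z)^-1).
have dX z : normc z <= 1 -> exists c, sder X z c.
  move=> z1; have [c hc] := dchi _ z1.
  have [d hd] := sder_cauchy_kernel a z a01' z1.
  eexists; apply: (sderM _ _ _ _ _ hc).
  exact: (sderM _ _ _ _ _ (sder_cst _ _) hd).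
have kz z : normc z = 1 -> z - a%:C%C != 0.
  move=> z1; rewrite -normc_gt0; have := normc_triangle z a%:C%C 0.
  by rewrite !subr0 z1 normc_real ger0_norm ?(ltW a0)//; lra.
have XE z : normc z = 1 -> chi z * (z^*)%C * (poisson a z)%:C%C =
    a%:C%C^-1 * (X z * (z / (z - a%:C%C)) - X z * (z / (z - 0%:C%C))).
  move=> z1; have z0 : z != 0 by rewrite -normc_gt0 z1.
  rewrite /poisson rmorphM fmorphV/= -mulc_conj (conjcB_real a _ z1) (circle_inv _ z1).
  rewrite /X; have zi : z^-1 - a%:C%C != 0.
    by rewrite -conjcB_real// -normc_gt0 normc_conj normc_gt0 kz.
  have za : 1 - a%:C%C * z != 0.
    by apply: contraNneq zi => h; apply/eqP/(mulfI z0); rewrite mulrBr divff// mulrC h mulr0.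
  have -> : 0%:C%C = 0 :> C by [].
  by field; rewrite za z0 ac0 kz// zi.
have e3 : 0 < a * e / 3 by rewrite divr_gt0// mulr_gt0.
have [d1 d10 H1] := discrete_cauchy _ _ a01' dX _ e3.
have z01 : 0 <= (0 : R) < 1 by rewrite lexx ltr01.
have [d2 d20 H2] := discrete_cauchy _ _ z01 dX _ e3.
have n0 : 0 < normc (X a%:C%C) + 1 by rewrite ltr_wpDl// normc_ge0.
have e4 : 0 < a * e / 3 / (normc (X a%:C%C) + 1) by rewrite divr_gt0.
have [d3 d30 H3] := mean_cauchy_kernel _ a01' _ e4.
exists (Num.min d1 (Num.min d2 d3)); first by rewrite !lt_min d10 d20.
move=> N w N0 wN w1; rewrite !lt_min => /and3P[wd1 wd2 wd3].
have := H3 _ _ N0 wN w1 wd3; have := H2 _ _ N0 wN w1 wd2.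
have := H1 _ _ N0 wN w1 wd1.
have X0 : X 0%:C%C = 0 by rewrite /X chi0 mul0r.
rewrite X0 mul0r subr0 (eq_cmean _ _ _ _ N0 wN XE) cmeanZ cmeanB.
set A := cmean _ _ _; set T := cmean _ _ _; set B := cmean _ _ _ => h1 h2 h3.
have Xa : X a%:C%C = chi a%:C%C.
  rewrite /X -rmorphM rmorphB/= rmorph1 -expr2 rmorphXn/= divff ?mulr1//.
  rewrite -rmorphXn -(rmorph1 (real_complex R)) -rmorphB fmorph_eq0 gt_eqF//.
  by rewrite subr_gt0 expr_lt1// ltW.
have -> : a%:C%C^-1 * (A - B) - chi a%:C%C / a%:C%C =
   a%:C%C^-1 * ((A - X a%:C%C * T) - B + X a%:C%C * (T - 1)).
  by rewrite Xa; field.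
rewrite normcM normcV normc_real gtr0_norm// ler_pdivrMl//.
rewrite (le_trans (normcD _ _))// normcM.
have h4 : normc (X a%:C%C) * normc (T - 1) <= a * e / 3.
  rewrite (le_trans (ler_wpM2l (normc_ge0 _) h3))// mulrCA ler_piMr ?(ltW e3)//.
  by rewrite ler_pdivrMr//; lra.
have := normcB (A - X a%:C%C * T) B; lra.
Qed.

(** Both values are means of the same nonnegative boundary function, against the Poisson kernels of
    [a] and of [b]. The kernel of [a] is at most [(1 + a) / (1 - a)] and that of [b] is at least
    [(1 - b) / (1 + b)], so the first is dominated pointwise by a multiple of the second. *)
Lemma harnack chi a b : 0 < a < 1 -> 0 < b < 1 -> chi 0 = 0 ->
  (forall z, normc z <= 1 -> exists c, sder chi z c) ->
  (forall z, normc z = 1 -> 0 <= Re (chi z * (z^*)%C)) ->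
  Re (chi a%:C%C) / a <=
  (1 + a) / (1 - a) * ((1 + b) / (1 - b)) * (Re (chi b%:C%C) / b).
Proof.
move=> a01 b01 chi0 dchi chiP.
have /andP[a0 a1] := a01; have /andP[b0 b1] := b01.
pose K := (1 + a) / (1 - a) * ((1 + b) / (1 - b)); rewrite -/K.
have K0 : 0 < K by apply: mulr_gt0; apply: divr_gt0; lra.
apply/ler_addgt0Pl => e e0; pose e1 := e / (1 + K).
have e10 : 0 < e1 by rewrite divr_gt0//; lra.
have [d1 d10 H1] := poisson_mean _ _ a01 chi0 dchi _ e10.
have [d2 d20 H2] := poisson_mean _ _ b01 chi0 dchi _ e10.
have d0 : 0 < Num.min d1 d2 by rewrite lt_min d10.
have [N [w [N0 wN w1]]] := small_unity_root _ d0.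
rewrite lt_min => /andP[wd1 wd2].
have N0' : 0 < N%:R :> R by rewrite ltr0n.
have wn k : normc (w ^+ k) = 1.
  by rewrite normcX (normc_unity_root _ _ N0 wN) expr1n.
have ReE (c : R) : Re (cmean N w (fun z => chi z * (z^*)%C * (poisson c z)%:C%C)) =
  N%:R^-1 * \sum_(k < N) Re (chi (w ^+ k) * ((w ^+ k)^*)%C) * poisson c (w ^+ k).
  have NE : N%:R^-1 = (N%:R^-1 : R)%:C%C :> C by rewrite fmorphV rmorph_nat.
  rewrite /cmean NE cReMr cRe_sum.
  by congr (_ * _); apply: eq_bigr => k _; rewrite mulrC cReMr mulrC.
have Rediv (c : R) : Re (chi c%:C%C / c%:C%C) = Re (chi c%:C%C) / c.
  by rewrite -(fmorphV (real_complex R)) mulrC cReMr mulrC.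
have := H1 _ _ N0 wN w1 wd1; have := H2 _ _ N0 wN w1 wd2.
move=> /(le_trans (normc_ge_Re _)); rewrite cReB ReE Rediv ler_norml => /andP[_ h2].
move=> /(le_trans (normc_ge_Re _)); rewrite cReB ReE Rediv ler_norml => /andP[h1 _].
move: h1 h2; set A := N%:R^-1 * _; set B := N%:R^-1 * _ => h1 h2.
have AB : A <= K * B.
  rewrite /A /B [leRHS]mulrCA ler_wpM2l ?invr_ge0 ?(ltW N0')// mulr_sumr.
  apply: ler_sum => k _; rewrite [leRHS]mulrCA ler_wpM2l ?chiP//.
  have /andP[_ ha] := poisson_bounds _ _ a01 (wn k).
  have /andP[hb _] := poisson_bounds _ _ b01 (wn k).
  apply: (le_trans ha).
  have -> : K * poisson b (w ^+ k) =
    (1 + a) / (1 - a) * ((1 + b) / (1 - b) * poisson b (w ^+ k)) by rewrite mulrA.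
  apply: ler_peMr; first by apply: divr_ge0; lra.
  rewrite -ler_pdivrMl; last by apply: divr_gt0; lra.
  by rewrite mulr1 invf_div.
have KB : K * B <= K * (Re (chi b%:C%C) / b + e1) by rewrite ler_pM2l//; lra.
have : e1 * (1 + K) = e by rewrite divfK// gt_eqF//; lra.
move: KB; rewrite mulrDr; lra.
Qed.

(** As [phi] is controlled only on the open disc, [harnack] is applied to [chi z = z - phi (r z)] at
    [a / r] and [b / r], and then [r] tends to 1 from below. On the circle, positivity of [chi] is
    the hypothesis on [phi] at [r z], of modulus [r]. *)
Lemma harnack_disc phi a b : 0 < a < 1 -> 0 < b < 1 -> phi 0 = 0 ->
  (forall z, normc z < 1 -> exists c, sder phi z c) ->
  (forall z, normc z < 1 -> Re (phi z * (z^*)%C) <= normc z) ->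
  1 - Re (phi a%:C%C) / a <=
  (1 + a) / (1 - a) * ((1 + b) / (1 - b)) * (1 - Re (phi b%:C%C) / b).
Proof.
move=> /andP[a0 a1] /andP[b0 b1] phi0 dphi phiP.
set x := _ / a; set y := Re (phi b%:C%C) / b.
(* This is the inequality for the dilated function cleared of denominators. As a polynomial in [r]
   it passes to the limit at 1. *)
pose F (r : R) := (r + a) * (r + b) * (1 - r * y) - (1 - r * x) * ((r - a) * (r - b)).
suff F1 : 0 <= F 1.
  rewrite mulf_div mulrAC ler_pdivlMr; last by rewrite mulr_gt0//; lra.
  by move: F1; rewrite /F !mul1r; lra.
have cF : F r @[r --> (1 : R)^'-] --> F 1.
  apply: cvg_at_left_filter; rewrite /F.
  have cst (u : R) : (fun=> u) x0 @[x0 --> (1 : R)] --> u by exact: cvg_cst.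
  apply: cvgB; apply: cvgM; rewrite ?mul1r.
  - by apply: cvgM; apply: cvgD => //; exact: cvg_id.
  - apply: cvgB => //; rewrite -[X in _ --> X]mul1r.
    by apply: cvgM => //; exact: cvg_id.
  - apply: cvgB => //; rewrite -[X in _ --> X]mul1r.
    by apply: cvgM => //; exact: cvg_id.
  - by apply: cvgM; apply: cvgB => //; exact: cvg_id.
apply: (cvgr_to_ge cF).
near=> r.
have r1 : r < 1 by near: r; exact: nbhs_left_lt.
have ra : a < r by near: r; exact: nbhs_left_gt.
have rb : b < r by near: r; exact: nbhs_left_gt.
have r0 : 0 < r by lra.
have rz z : normc (r%:C%C * z) = r * normc z.
  by rewrite normcM normc_real gtr0_norm.
pose chi z := z - phi (r%:C%C * z).
have ab (c : R) : 0 < c < r -> 0 < c / r < 1.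
  by move=> /andP[? ?]; rewrite divr_gt0//= ltr_pdivrMr// mul1r.
have ar : 0 < a / r < 1 by rewrite ab// a0.
have br : 0 < b / r < 1 by rewrite ab// b0.
have chi0 : chi 0 = 0 by rewrite /chi mulr0 phi0 subr0.
have dchi z : normc z <= 1 -> exists c, sder chi z c.
  move=> z1; have h : normc (r%:C%C * z) < 1.
    by rewrite rz (le_lt_trans _ r1)// ler_piMr// ltW.
  have [c hc] := dphi _ h; exists (1 + (-1 * (c * r%:C%C))).
  have hs : sder (fun z => r%:C%C * z) z r%:C%C.
    by have := sder_affine r%:C%C 0 z; under eq_fun do rewrite addr0.
  have hN : sder (fun z => -1 * z) (phi (r%:C%C * z)) (-1).
    by have := sder_affine (-1) 0 (phi (r%:C%C * z)); under eq_fun do rewrite addr0.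
  have := sderD _ _ _ _ _ (sder_id z) (sder_comp _ _ _ _ _ hN (sder_comp _ _ _ _ _ hc hs)).
  by congr (sder _ _ _); apply/funext => u /=; rewrite mulN1r.
have chiP z : normc z = 1 -> 0 <= Re (chi z * (z^*)%C).
  move=> z1; rewrite /chi mulrBl cReB mulc_conj z1 expr1n subr_ge0/=.
  have := phiP (r%:C%C * z); rewrite rz z1 mulr1 => /(_ r1).
  rewrite rmorphM/= oppr0 mulrCA cReMr ger_pMr//.
have := harnack _ _ _ ar br chi0 dchi chiP.
have E (c : R) (r0' : r != 0) (c0 : 0 < c) : Re (chi (c / r)%:C%C) / (c / r) = 1 - r * (Re (phi c%:C%C) / c).
  have -> : chi (c / r)%:C%C = (c / r)%:C%C - phi c%:C%C.
    by rewrite /chi -rmorphM [r * _]mulrC divfK.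
  rewrite cReB/=.
  by field; rewrite r0' gt_eqF.
rewrite !E ?gt_eqF// -/x -/y /F subr_ge0.
have -> : (1 + a / r) / (1 - a / r) = (r + a) / (r - a).
  by field; rewrite !gt_eqF// subr_gt0.
have -> : (1 + b / r) / (1 - b / r) = (r + b) / (r - b).
  by field; rewrite !gt_eqF// subr_gt0.
rewrite mulf_div mulrAC ler_pdivlMr//; first by rewrite mulr_gt0//; lra.
Unshelve. all: by end_near. Qed.

End Harnack.


(** * Several complex variables *)

Section IsDerive.
Context {R : realType} {V W : normedModType R}.
Implicit Types (f : V -> W) (x v : V).

Lemma is_deriveP f x v (l : W) : is_derive x v f l <->
  h^-1 *: (f (h *: v + x) - f x) @[h --> (0 : R)^'] --> l.
Proof.
split=> [[df <-]|fl]; first exact: df.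
by split; [apply/cvg_ex; exists l|apply/cvg_lim].
Qed.

Lemma is_derive_line f x v (s : R) l :
  is_derive (s *: v + x) v f l -> is_derive s 1 (fun t : R => f (t *: v + x)) l.
Proof.
move=> /is_deriveP fl; apply/(DeriveDef (V := R)); last first.
- apply/cvg_lim => //; move: fl; apply: cvg_trans; apply: near_eq_cvg.
  by near=> h; rewrite /= [h *: 1]mulr1 scalerDl addrA.
- apply/cvg_ex; exists l; move: fl; apply: cvg_trans; apply: near_eq_cvg.
  by near=> h; rewrite /= [h *: 1]mulr1 scalerDl addrA.
Unshelve. all: by end_near. Qed.

End IsDerive.

Section IsDerivePair.
Context {R : realType} {V W1 W2 : normedModType R}.

Lemma is_derive_fst (f : V -> W1 * W2) x v l :
  is_derive x v f l -> is_derive x v (fst \o f) l.1.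
Proof.
move=> /is_deriveP fl; apply/is_deriveP.
have cl : fst w @[w --> l] --> l.1.
  by case: (l) => l1 l2; exact: (@cvg_fst _ _ (nbhs l1) (nbhs l2)).
exact: cvg_comp fl cl.
Qed.

Lemma is_derive_snd (f : V -> W1 * W2) x v l :
  is_derive x v f l -> is_derive x v (snd \o f) l.2.
Proof.
move=> /is_deriveP fl; apply/is_deriveP.
have cl : snd w @[w --> l] --> l.2.
  by case: (l) => l1 l2; exact: (@cvg_snd _ _ (nbhs l1) (nbhs l2)).
exact: cvg_comp fl cl.
Qed.

Lemma is_derive_pair (f : V -> W1 * W2) x v l :
  is_derive x v (fst \o f) l.1 -> is_derive x v (snd \o f) l.2 ->
  is_derive x v f l.
Proof.
move=> /is_deriveP f1 /is_deriveP f2; apply/is_deriveP.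
have h := cvg_pair f1 f2; case: l f1 f2 h => l1 l2 _ _ h; exact: h.
Qed.

End IsDerivePair.

Section MeanValue.
Context {R : realType} {V : normedModType R}.
Implicit Types (H : V -> R) (x z e : V).

Lemma directional_MVT H x e (a D r : R) :
  (forall s : R, `|s| <= `|a| ->
    exists2 l : R, is_derive (s *: e + x) e H l & `|l - D| <= r) ->
  `|H (a *: e + x) - H x - a * D| <= r * `|a|.
Proof.
move=> Hd.
have /choice[l Hl] : forall s : R, exists l : R, `|s| <= `|a| ->
    is_derive (s *: e + x) e H l /\ `|l - D| <= r.
  move=> s; have [/Hd[l h1 h2]|_] := leP `|s| `|a|; first by exists l.
  by exists 0.
pose phi (s : R) := H (s *: e + x).
have dphi (s : R) : `|s| <= `|a| -> is_derive s 1 phi (l s).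
  by move=> /Hl[h _]; exact: is_derive_line.
have [a0|a0] := leP 0 a.
  have sa s : s \in `[0, a] -> `|s| <= `|a|.
    by rewrite in_itv/= => /andP[s0 sa]; rewrite !ger0_norm.
  have [||c ca] := @MVT_segment R phi l 0 a a0.
  - by move=> s; rewrite in_itv/= => /andP[? ?]; apply/dphi/sa; rewrite in_itv/= !ltW.
  - apply: derivable_within_continuous => s /sa/dphi h; exact: ex_derive.
  rewrite /phi scale0r add0r subr0 => ->.
  rewrite [_ * a]mulrC -mulrBr normrM mulrC ler_wpM2r//.
  by case: (Hl _ (sa _ ca)).
have sa s : s \in `[a, 0] -> `|s| <= `|a|.
  by rewrite in_itv/= => /andP[s0 sa]; rewrite !ler0_norm ?lerN2// ltW.
have [||c ca] := @MVT_segment R phi l a 0 (ltW a0).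
- by move=> s; rewrite in_itv/= => /andP[? ?]; apply/dphi/sa; rewrite in_itv/= !ltW.
- apply: derivable_within_continuous => s /sa/dphi h; exact: ex_derive.
rewrite /phi scale0r add0r sub0r => /(congr1 -%R); rewrite opprB => ->.
rewrite mulrN opprK [_ * a]mulrC -mulrBr normrM mulrC ler_wpM2r//.
by case: (Hl _ (sa _ ca)).
Qed.

(** The segment is replaced by a path that follows one direction [E i] at a time, with a
    one-variable mean value estimate on each edge. The bound on [x] and on the sum of the [|a i|]
    keeps the whole path in the ball where the derivatives are controlled. *)
Lemma multidirectional_MVT (I : Type) (E : I -> V) H z (D : I -> R) (d r : R) :
  (forall i, `|E i| <= 1) ->
  (forall i y, `|y - z| < d -> exists2 l : R, is_derive y (E i) H l & `|l - D i| <= r) ->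
  forall (s : seq I) (a : I -> R) x, `|x - z| + \sum_(i <- s) `|a i| < d ->
  `|H (x + \sum_(i <- s) a i *: E i) - H x - \sum_(i <- s) a i * D i|
    <= r * \sum_(i <- s) `|a i|.
Proof.
move=> E1 Hd; elim=> [|i s IH] a x xd.
  by rewrite !big_nil addr0 subrr subr0 normr0 mulr0.
move: xd; rewrite !big_cons => xd.
have aE j (c : R) : `|c *: E j| <= `|c| by rewrite normrZ ler_piMr.
have xd' : `|x + a i *: E i - z| + \sum_(j <- s) `|a j| < d.
  apply: le_lt_trans xd; rewrite addrA lerD2r addrAC.
  by rewrite (le_trans (ler_normD _ _))// lerD2l.
have h1 := IH _ _ xd'.
have h2 : `|H (a i *: E i + x) - H x - a i * D i| <= r * `|a i|.
  apply: directional_MVT => s0 sa; apply: Hd; apply: le_lt_trans xd.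
  have -> : s0 *: E i + x - z = (x - z) + s0 *: E i by rewrite [RHS]addrC addrA.
  rewrite (le_trans (ler_normD _ _))// lerD2l.
  rewrite (le_trans (aE _ _))// (le_trans sa)// lerDl.
  by apply: sumr_ge0.
have -> : H (x + (a i *: E i + \sum_(j <- s) a j *: E j)) - H x
    - (a i * D i + \sum_(j <- s) a j * D j) =
  (H (x + a i *: E i + \sum_(j <- s) a j *: E j) - H (x + a i *: E i)
     - \sum_(j <- s) a j * D j) + (H (a i *: E i + x) - H x - a i * D i).
  by rewrite addrA [x + a i *: _]addrC; ring.
by rewrite mulrDr addrC (le_trans (ler_normD _ _))// lerD.
Qed.

End MeanValue.


Lemma common_radius {R : realType} {I : finType} (d : I -> R) :
  (forall i, 0 < d i) -> exists2 r : R, 0 < r & forall i, r <= d i.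
Proof.
move=> d0; exists (\big[Num.min/1]_i d i) => [|i]; last exact: bigmin_le.
by apply/bigmin_gtP; split.
Qed.

(** * Complex coordinates and strict differentiability in several variables *)

Section ComplexCoordinates.
Context {R : realType} {n : nat}.
Local Notation C := R[i].
Local Notation Cn := (Cx 'rV[R]_n).
Implicit Types (u y z : Cn) (h : Cn -> C) (A : 'I_n -> C).

Definition tocplx (p : Cx R) : C := (p.1 +i* p.2)%C.

Definition coord z t : C := (z.1 ord0 t +i* z.2 ord0 t)%C.

Arguments coord : simpl never.

Definition of_coord (c : 'I_n -> C) : Cn := (\row_t Re (c t), \row_t Im (c t)).

Lemma coordK c t : coord (of_coord c) t = c t.
Proof. by rewrite /coord !mxE; case: (c t). Qed.

Lemma coord_inj y z : (forall t, coord y t = coord z t) -> y = z.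
Proof.
case: y z => [a b] [c d] yz; congr (_, _); apply/rowP => t;
  by have := yz t; rewrite /coord => -[].
Qed.

Lemma coordB y z t : coord (y - z) t = coord y t - coord z t.
Proof. by rewrite /coord !mxE. Qed.

Lemma coord0 t : coord 0 t = 0.
Proof. by rewrite /coord !mxE. Qed.

Lemma coordZ (a : R) z t : coord (a *: z) t = a%:C%C * coord z t.
Proof. by rewrite /coord !mxE; apply: complex_ext => /=; ring. Qed.

Lemma coord_conj z t : coord (cxconj z) t = ((coord z t)^*)%C.
Proof. by rewrite /coord !mxE. Qed.

Definition norm1 z : R := \sum_t normc (coord z t).

Lemma norm1_ge0 z : 0 <= norm1 z.
Proof. by apply: sumr_ge0 => t _; exact: normc_ge0. Qed.

Lemma coord_le_norm1 z t : normc (coord z t) <= norm1 z.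
Proof.
rewrite /norm1 (bigD1 t)// lerDl; apply: sumr_ge0 => i _; exact: normc_ge0.
Qed.

Lemma near_norm1P z (P : set Cn) :
  (\forall y \near z, P y) <->
  exists2 d : R, 0 < d & forall y, norm1 (y - z) < d -> P y.
Proof.
split.
  move=> /nbhs_ballP[d /= d0 dP]; exists d => // y yd; apply: dP.
  have yt t : normc (coord y t - coord z t) < d.
    by rewrite -coordB (le_lt_trans (coord_le_norm1 _ _)).
  split; split=> // i j; rewrite (ord1 i) /ball/= distrC.
    by apply: le_lt_trans (yt j); have := normc_ge_Re (coord y j - coord z j).
  by apply: le_lt_trans (yt j); have := normc_ge_Im (coord y j - coord z j).
(* Each complex coordinate contributes at most twice the radius in the sup norm. The extra 1 in the
   denominator makes the sum strictly smaller than [d] and covers [n = 0]. *)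
move=> [d d0 dP]; apply/nbhs_ballP; exists (d / (2 * n).+1%:R) => /=.
  by rewrite divr_gt0.
move=> y [[_ h1] [_ h2]]; apply: dP.
have h t : normc (coord (y - z) t) <= 2 * (d / (2 * n).+1%:R).
  rewrite coordB (le_trans (normc_le_ReIm _))//= mulr_natl mulr2n lerD// ltW//.
    by have := h1 ord0 t; rewrite /ball/= distrC.
  by have := h2 ord0 t; rewrite /ball/= distrC.
rewrite /norm1 (le_lt_trans (ler_sum _ (fun t _ => h t)))//.
rewrite sumr_const card_ord -[_ *+ n]mulr_natl !mulrA ltr_pdivrMr// mulrC.
by rewrite ltr_pM2l// -natrM ltr_nat mulnC.
Qed.

(** The differential [A] is complex linear by construction, so the Cauchy-Riemann equations are
    built into this notion. *)
Definition msder h z A := forall e : R, 0 < e -> exists2 d : R, 0 < d &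
  forall u y, norm1 (u - z) < d -> norm1 (y - z) < d ->
  normc (h u - h y - \sum_t A t * (coord u t - coord y t)) <= e * norm1 (u - y).

Lemma msder_comp h (g : C -> Cn) x A B :
  msder h (g x) A -> (forall t, sder (fun w : C => coord (g w) t) x (B t)) ->
  sder (h \o g) x (\sum_t A t * B t).
Proof.
move=> dh dg e e0.
pose SA := \sum_t normc (A t); pose SB := \sum_t normc (B t).
have SA0 : 0 <= SA by apply: sumr_ge0 => t _; exact: normc_ge0.
have SB0 : 0 <= SB by apply: sumr_ge0 => t _; exact: normc_ge0.
have m0 : 0 < SB + n%:R + 1 by rewrite ltr_wpDl// addr_ge0.
have e1 : 0 < e / 2 / (SB + n%:R + 1) by rewrite !divr_gt0.
have e2 : 0 < e / 2 / (SA + 1) by rewrite !divr_gt0// ltr_wpDl.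
have [d d0 Hd] := dh _ e1.
have dn : 0 < d / n.+1%:R by rewrite divr_gt0.
have /choice[r Hr] : forall t, exists r : R, 0 < r /\ forall y z : C,
    normc (y - x) < r -> normc (z - x) < r ->
    [/\ normc (coord (g y) t - coord (g z) t - B t * (y - z))
      <= e / 2 / (SA + 1) * normc (y - z),
      normc (coord (g y) t - coord (g z) t) <= (normc (B t) + 1) * normc (y - z) &
      normc (coord (g y) t - coord (g x) t) < d / n.+1%:R].
  move=> t; have [r1 r10 H1] := dg t _ e2; have [r2 r20 H2] := sder_lip _ _ _ (dg t).
  have [r3 r30 H3] := sder_cont _ _ _ (dg t) _ dn.
  exists (Num.min r1 (Num.min r2 r3)); split; first by rewrite !lt_min r10 r20.
  move=> y z; rewrite !lt_min => /and3P[y1 y2 y3] /and3P[z1 z2 z3].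
  by split; [exact: H1|exact: H2|exact: H3].
have [r0 r00 Hr0] := common_radius r (fun t => (Hr t).1).
exists r0 => // y z yr zr.
have H t := (Hr t).2 y z (lt_le_trans yr (Hr0 t)) (lt_le_trans zr (Hr0 t)).
have H' t := (Hr t).2 z y (lt_le_trans zr (Hr0 t)) (lt_le_trans yr (Hr0 t)).
have nd (u : Cn) : (forall t, normc (coord u t) < d / n.+1%:R) -> norm1 u < d.
  move=> ud; rewrite /norm1 (le_lt_trans (ler_sum _ (fun t _ => ltW (ud t))))//.
  rewrite sumr_const card_ord -[_ *+ n]mulr_natl mulrCA gtr_pMr// ltr_pdivrMr//.
  by rewrite mul1r ltr_nat.
have yd : norm1 (g y - g x) < d by apply: nd => t; rewrite coordB; case: (H t).
have zd : norm1 (g z - g x) < d by apply: nd => t; rewrite coordB; case: (H' t).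
have := Hd _ _ yd zd => h1.
have -> : (h \o g) y - (h \o g) z - (\sum_t A t * B t) * (y - z) =
   (h (g y) - h (g z) - \sum_t A t * (coord (g y) t - coord (g z) t)) +
   \sum_t A t * (coord (g y) t - coord (g z) t - B t * (y - z)).
  have -> : \sum_t A t * (coord (g y) t - coord (g z) t - B t * (y - z)) =
      \sum_t A t * (coord (g y) t - coord (g z) t) -
      (\sum_t A t * B t) * (y - z).
    by rewrite mulr_suml -sumrB; apply: eq_bigr => t _; ring.
  by rewrite /=; ring.
rewrite (le_trans (normcD _ _))// [in leRHS](splitr e) mulrDl lerD//.
  apply: (le_trans h1).
  have h2 : norm1 (g y - g z) <= (SB + n%:R + 1) * normc (y - z).
    rewrite mulrDl ler_wpDr ?mul1r ?normc_ge0//.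
    have -> : n%:R = \sum_(t < n) 1 :> R by rewrite sumr_const card_ord.
    rewrite -big_split mulr_suml; apply: ler_sum => t _.
    by rewrite coordB; case: (H t).
  by rewrite (le_trans (ler_wpM2l (ltW e1) h2))// mulrA divfK// gt_eqF.
rewrite (le_trans (normc_sum _ _ _ _))//.
have h2 t : normc (A t * (coord (g y) t - coord (g z) t - B t * (y - z)))
    <= normc (A t) * (e / 2 / (SA + 1) * normc (y - z)).
  by rewrite normcM ler_wpM2l ?normc_ge0//; case: (H t).
rewrite (le_trans (ler_sum _ (fun t _ => h2 t)))// -mulr_suml mulrA.
rewrite ler_wpM2r ?normc_ge0// mulrCA ler_piMr ?divr_ge0// ?(ltW e0)//.
by rewrite ler_pdivrMr ?ltr_wpDl// mul1r lerDl.
Qed.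

End ComplexCoordinates.
Arguments coord {R n} z t : simpl never.
Arguments normc {R} x : simpl never.


(** * From continuous partial derivatives to strict differentiability *)

Section Holomorphy.
Context {R : realType} {n : nat}.
Local Notation C := R[i].
Local Notation Cn := (Cx 'rV[R]_n).
Implicit Types (u y z : Cn) (h : Cn -> C) (A : 'I_n -> C).

Lemma normrV_le (v : 'rV[R]_n) (b : R) :
  0 <= b -> (forall j, `|v ord0 j| <= b) -> `|v| <= b.
Proof.
move=> b0 vb; rewrite [`|v|]mx_normrE; apply: bigmax_le => //= -[i j] _ /=.
by rewrite (ord1 i).
Qed.

Lemma norm_le_norm1 z : `|z| <= norm1 z.
Proof.
rewrite prod_normE ge_max; apply/andP; split.
  apply: normrV_le => [|t]; first exact: norm1_ge0.
  by apply: le_trans (coord_le_norm1 z t); exact: (normc_ge_Re (coord z t)).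
apply: normrV_le => [|t]; first exact: norm1_ge0.
by apply: le_trans (coord_le_norm1 z t); exact: (normc_ge_Im (coord z t)).
Qed.

Definition cdir (i : 'I_n * bool) : Cn :=
  if i.2 then (0, delta_mx ord0 i.1) else (delta_mx ord0 i.1, 0).

Lemma cdir_norm i : `|cdir i| <= 1.
Proof.
have d1 t : `|delta_mx ord0 t : 'rV[R]_n| <= 1.
  by apply: normrV_le => // j; rewrite mxE; case: (_ && _); rewrite ?normr1 ?normr0.
by rewrite prod_normE /cdir; case: i => t [] /=; rewrite ge_max normr0 ler01 d1.
Qed.

Definition cdir_coef z (i : 'I_n * bool) : R :=
  if i.2 then z.2 ord0 i.1 else z.1 ord0 i.1.

Lemma sum_cdir (W : zmodType) (F : 'I_n * bool -> W) :
  \sum_i F i = \sum_t (F (t, false) + F (t, true)).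
Proof.
have -> : \sum_i F i = \sum_i F (i.1, i.2) by apply: eq_bigr => -[].
rewrite -(pair_bigA _ (fun t b => F (t, b)))/=; apply: eq_bigr => t _.
by rewrite big_bool addrC.
Qed.

Lemma cdir_sum z : z = \sum_i cdir_coef z i *: cdir i.
Proof.
rewrite sum_cdir big_split /= /cdir_coef /cdir/=.
case: z => a b; rewrite {1}(row_sum_delta a) {1}(row_sum_delta b) /=.
have -> : \sum_t a ord0 t *: ((delta_mx ord0 t, 0) : Cn) =
    (\sum_t a ord0 t *: delta_mx ord0 t, 0).
  rewrite (big_morph (fun v => (v, 0) : Cn) (id1 := 0) (op1 := +%R)) => [||//].
    by apply: eq_bigr => t _; congr (_, _); rewrite /= scaler0.
  by move=> v w; congr (_, _); rewrite /= addr0.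
have -> : \sum_t b ord0 t *: ((0, delta_mx ord0 t) : Cn) =
    (0, \sum_t b ord0 t *: delta_mx ord0 t).
  rewrite (big_morph (fun v => (0, v) : Cn) (id1 := 0) (op1 := +%R)) => [||//].
    by apply: eq_bigr => t _; congr (_, _); rewrite /= scaler0.
  by move=> v w; congr (_, _); rewrite /= addr0.
by congr (_, _); rewrite /= ?addr0 ?add0r.
Qed.

Lemma cdir_coef_sum z : \sum_i `|cdir_coef z i| <= 2 * norm1 z.
Proof.
rewrite sum_cdir mulr_sumr; apply: ler_sum => t _; rewrite mulr_natl mulr2n lerD//.
  exact: (normc_ge_Re (coord z t)).
exact: (normc_ge_Im (coord z t)).
Qed.

(** Each directional derivative stays near its value at [z] on a common neighbourhood, and the mean
    value estimate along the real basis [cdir] sums these errors. *)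
Lemma C1_strict (H : Cn -> R) z (D : 'I_n * bool -> R) (e : R) : 0 < e ->
  (forall e : R, 0 < e -> forall i, \forall y \near z,
     exists2 l : R, is_derive y (cdir i) H l & `|l - D i| <= e) ->
  exists2 d : R, 0 < d & forall u y, norm1 (u - z) < d -> norm1 (y - z) < d ->
  `|H u - H y - \sum_i cdir_coef (u - y) i * D i| <= e * norm1 (u - y).
Proof.
move=> e0 HD; have e20 : 0 < e / 2 by rewrite divr_gt0.
have : \forall y \near z, forall i,
    exists2 l : R, is_derive y (cdir i) H l & `|l - D i| <= e / 2.
  exact: (filter_forall _ (HD _ e20)).
rewrite nbhs_normP => -[d /= d0 Hd].
(* The path starts within [d / 5] of [z], and its length is at most [2 * norm1 (u - y)], less than
   [4 * (d / 5)]. It therefore stays in the ball of radius [d]. *)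
exists (d / 5); first by rewrite divr_gt0.
move=> u y ud yd.
have uy : norm1 (u - y) < 2 * (d / 5).
  apply: (@le_lt_trans _ _ (norm1 (u - z) + norm1 (y - z))); last lra.
  rewrite /norm1 -big_split; apply: ler_sum => t _.
  rewrite !coordB [X in _ <= _ + X]normc_distC; exact: normc_triangle.
have := @multidirectional_MVT R Cn _ cdir H z D d (e / 2) cdir_norm _
  (index_enum _) (cdir_coef (u - y)) y.
rewrite -cdir_sum [y + (u - y)]addrC subrK => HM.
apply: (le_trans (HM _ _)).
- by move=> i w wz; apply: Hd; rewrite /= distrC.
- have := cdir_coef_sum (u - y); have := norm_le_norm1 (y - z); lra.
- rewrite -mulrA ler_wpM2l ?(ltW e0)// mulrC ler_pdivrMr// mulrC.
  exact: cdir_coef_sum.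
Qed.

(** The real and imaginary parts are handled separately by [C1_strict]. The Cauchy-Riemann equations
    express the [dbeta] coefficients through those of [dalpha], and the two real-linear forms
    combine into the complex-linear one. *)
Lemma holomorphic_strict (U : set Cn) (f : Cn -> Cx R) z : open U -> U z ->
  @holomorphic_on R n R^o U f ->
  msder (tocplx \o f) z (fun t => tocplx (@dalpha R n R^o t f z)).
Proof.
move=> oU Uz [fC1 fCR] e e0; have e20 : 0 < e / 2 by rewrite divr_gt0.
have nU : \forall y \near z, U y by exact: open_nbhs_nbhs.
pose Dv (i : 'I_n * bool) y : Cx R :=
  if i.2 then @dbeta R n R^o i.1 f y else @dalpha R n R^o i.1 f y.
have dD i y : U y -> is_derive y (cdir i) (f : Cn -> R^o * R^o) (Dv i y).
  case: i => t b Uy; have [h1 h2 _ _] := fC1 y t Uy.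
  by case: b; rewrite /cdir /Dv /=; [exact: DeriveDef h2 erefl|exact: DeriveDef h1 erefl].
have cD i : Dv i y @[y --> z] --> (Dv i z : R^o * R^o).
  case: i => t b; have [_ _ h1 h2] := fC1 z t Uz.
  by case: b; [exact: h2|exact: h1].
have nD (r : R) : 0 < r -> forall i, \forall y \near z,
    `|(Dv i y).1 - (Dv i z).1| <= r /\ `|(Dv i y).2 - (Dv i z).2| <= r.
  move=> r0 i; have /cvgrPdist_le /(_ r r0) := cD i.
  apply: filterS => y; rewrite prod_normE ge_max => /andP[/= h1 h2].
  by rewrite distrC h1 distrC h2.
have e40 : 0 < e / 2 by rewrite divr_gt0.
have [|d1 d10 H1] := @C1_strict (fst \o f) z (fun i => (Dv i z).1) _ e20.
  move=> r r0 i; near=> y; exists (Dv i y).1.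
    by apply: (is_derive_fst f); apply: dD; near: y.
  by have : `|(Dv i y).1 - (Dv i z).1| <= r /\ `|(Dv i y).2 - (Dv i z).2| <= r;
    [near: y; exact: nD|case].
have [|d2 d20 H2] := @C1_strict (snd \o f) z (fun i => (Dv i z).2) _ e20.
  move=> r r0 i; near=> y; exists (Dv i y).2.
    by apply: (is_derive_snd f); apply: dD; near: y.
  by have : `|(Dv i y).1 - (Dv i z).1| <= r /\ `|(Dv i y).2 - (Dv i z).2| <= r;
    [near: y; exact: nD|case].
exists (Num.min d1 d2); first by rewrite lt_min d10.
move=> u y; rewrite !lt_min => /andP[u1 u2] /andP[y1 y2].
have CR t : (Dv (t, true) z).1 = - (Dv (t, false) z).2 /\
            (Dv (t, true) z).2 = (Dv (t, false) z).1.
  have := fCR z t Uz; rewrite /dzbar /muli => /eqP.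
  rewrite scaler_eq0 invr_eq0 (negPf (_ : 2 != 0))//= => /eqP[h1 h2].
  split.
    by apply/eqP; rewrite -addr_eq0 addrC; apply/eqP.
  by apply/eqP; rewrite eq_sym -subr_eq0; apply/eqP.
have DvE t : tocplx (@dalpha R n R^o t f z) = tocplx (Dv (t, false) z) by [].
clearbody Dv; under eq_bigr do rewrite DvE -coordB.
rewrite (le_trans (normc_le_ReIm _))// [in leRHS](splitr e) mulrDl lerD//.
  apply: le_trans (H1 _ _ u1 y1); rewrite le_eqVlt; apply/orP; left.
  apply/eqP; congr `| _ |; rewrite cReB cReB; congr (_ - _).
  rewrite cRe_sum sum_cdir; apply: eq_bigr => t _.
  have [c1 c2] := CR t.
  rewrite c1.
  by move: (Dv (t, false) z) => p; rewrite cReM /= mulrN ![p.1 * _]mulrC ![p.2 * _]mulrC.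
apply: le_trans (H2 _ _ u2 y2); rewrite le_eqVlt; apply/orP; left.
apply/eqP; congr `| _ |; rewrite cImB cImB; congr (_ - _).
rewrite cIm_sum sum_cdir; apply: eq_bigr => t _.
have [c1 c2] := CR t.
rewrite c2.
by move: (Dv (t, false) z) => p; rewrite cImM /= addrC ![p.1 * _]mulrC ![p.2 * _]mulrC.
Unshelve. all: by end_near. Qed.

End Holomorphy.


(** * The Euclidean norm and the real inner product *)

Section Euclidean.
Context {R : realType} {n : nat}.
Local Notation C := R[i].
Local Notation Cn := (Cx 'rV[R]_n).
Implicit Types (u v p x y z : Cn).

Definition enorm z : R := Num.sqrt (\sum_t (z.1 ord0 t ^+ 2 + z.2 ord0 t ^+ 2)).

Definition rdot x y : R :=
  \sum_t (x.1 ord0 t * y.1 ord0 t + x.2 ord0 t * y.2 ord0 t).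

Lemma enorm_ge0 z : 0 <= enorm z. Proof. exact: sqrtr_ge0. Qed.

Lemma enorm_sqr z : enorm z ^+ 2 = rdot z z.
Proof.
rewrite /enorm sqr_sqrtr//; apply: sumr_ge0 => t _.
by rewrite addr_ge0 ?sqr_ge0.
Qed.

Lemma enorm_sqrE z : enorm z ^+ 2 = \sum_t normc (coord z t) ^+ 2.
Proof. by rewrite enorm_sqr; apply: eq_bigr => t _; rewrite normc_sqr. Qed.

Lemma rdotE x y : rdot x y = Re (\sum_t coord x t * ((coord y t)^*)%C).
Proof.
by rewrite cRe_sum; apply: eq_bigr => t _; rewrite /coord /=; ring.
Qed.

Lemma rdotDl x y z : rdot (x + y) z = rdot x z + rdot y z.
Proof.
by rewrite /rdot -big_split; apply: eq_bigr => t _ /=; rewrite !mxE; ring.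
Qed.

Lemma rdotC x y : rdot x y = rdot y x.
Proof. by apply: eq_bigr => t _; ring. Qed.

Lemma rdotZl (a : R) x y : rdot (a *: x) y = a * rdot x y.
Proof.
by rewrite /rdot mulr_sumr; apply: eq_bigr => t _ /=; rewrite !mxE; ring.
Qed.

Lemma rdotBl x y z : rdot (x - y) z = rdot x z - rdot y z.
Proof. by rewrite rdotDl -scaleN1r rdotZl mulN1r. Qed.

Lemma rdotZr (a : R) x y : rdot x (a *: y) = a * rdot x y.
Proof. by rewrite rdotC rdotZl rdotC. Qed.

Lemma enormZ (a : R) z : enorm (a *: z) = `|a| * enorm z.
Proof.
rewrite /enorm -sqrtr_sqr -sqrtrM ?sqr_ge0// mulr_sumr; congr Num.sqrt.
by apply: eq_bigr => t _; rewrite !mxE; ring.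
Qed.

Lemma enorm0 : enorm 0 = 0.
Proof. by rewrite -(scale0r (0 : Cn)) enormZ normr0 mul0r. Qed.

Lemma enormN z : enorm (- z) = enorm z.
Proof. by rewrite -scaleN1r enormZ normrN1 mul1r. Qed.

Lemma coord_le_enorm z t : normc (coord z t) <= enorm z.
Proof.
rewrite -(@ler_pXn2r _ 2)// ?nnegrE ?normc_ge0 ?enorm_ge0// enorm_sqrE.
by rewrite (bigD1 t)// lerDl; apply: sumr_ge0 => i _; rewrite sqr_ge0.
Qed.

Lemma enorm0_eq0 z : enorm z = 0 -> z = 0.
Proof.
move=> z0; apply: coord_inj => t; rewrite coord0; apply/eqP.
by rewrite -normc_eq0 eq_le normc_ge0 -z0 coord_le_enorm.
Qed.

Lemma rdot_le x y : rdot x y <= enorm x * enorm y.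
Proof.
have [->|x0] := eqVneq x 0.
  by rewrite enorm0 mul0r -(scale0r (0 : Cn)) rdotZl mul0r.
have [->|y0] := eqVneq y 0.
  by rewrite enorm0 mulr0 -(scale0r (0 : Cn)) rdotZr mul0r.
have ex0 : 0 < enorm x.
  by rewrite lt_def enorm_ge0 andbT; apply: contra_neq x0 => /enorm0_eq0.
have ey0 : 0 < enorm y.
  by rewrite lt_def enorm_ge0 andbT; apply: contra_neq y0 => /enorm0_eq0.
have := sqr_ge0 (enorm (enorm y *: x - enorm x *: y)).
rewrite enorm_sqr rdotBl [rdot _ (_ - _)]rdotC [rdot (_ *: y) _]rdotC !rdotBl.
rewrite !rdotZl !rdotZr [rdot y x]rdotC -!enorm_sqr => h.
have : 0 <= 2 * (enorm x * enorm y) * (enorm x * enorm y - rdot x y) by lra.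
by rewrite pmulr_rge0 ?subr_ge0// !mulr_gt0.
Qed.

Lemma enormD x y : enorm (x + y) <= enorm x + enorm y.
Proof.
rewrite -(@ler_pXn2r _ 2)// ?nnegrE ?addr_ge0 ?enorm_ge0//.
rewrite enorm_sqr rdotDl [rdot x _]rdotC [rdot y _]rdotC !rdotDl.
rewrite [rdot y x]rdotC -!enorm_sqr.
have := rdot_le x y; nra.
Qed.

Lemma enorm_le_norm1 z : enorm z <= norm1 z.
Proof.
rewrite -(@ler_pXn2r _ 2)// ?nnegrE ?norm1_ge0 ?enorm_ge0// enorm_sqrE.
rewrite [norm1 z ^+ 2]expr2 {1}/norm1 mulr_suml; apply: ler_sum => t _.
by rewrite expr2 ler_wpM2l ?normc_ge0// coord_le_norm1.
Qed.

Lemma norm1_le_enorm z : norm1 z <= n%:R * enorm z.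
Proof.
rewrite /norm1 (le_trans (ler_sum _ (fun t _ => coord_le_enorm z t)))//.
by rewrite sumr_const card_ord mulr_natl.
Qed.

Lemma norm1D x y : norm1 (x + y) <= norm1 x + norm1 y.
Proof.
rewrite /norm1 -big_split; apply: ler_sum => t _.
have -> : coord (x + y) t = coord x t + coord y t by rewrite /coord !mxE.
exact: normcD.
Qed.

Lemma norm1Z (a : R) z : norm1 (a *: z) = `|a| * norm1 z.
Proof.
rewrite /norm1 mulr_sumr; apply: eq_bigr => t _.
by rewrite coordZ normcM normc_real.
Qed.

Lemma norm1N z : norm1 (- z) = norm1 z.
Proof. by rewrite -scaleN1r norm1Z normrN1 mul1r. Qed.

Lemma unit_ballE z : unit_ball z = (enorm z < 1). Proof. by []. Qed.

Lemma open_unit_ball : open (@unit_ball R n).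
Proof.
rewrite openE => z; rewrite unit_ballE => z1; apply/near_norm1P.
exists (1 - enorm z); first by rewrite subr_gt0.
move=> y yz; rewrite unit_ballE; have := enormD z (y - z).
rewrite addrC subrK; have := enorm_le_norm1 (y - z); lra.
Qed.

Definition cscale (c : C) z : Cn := of_coord (fun t => c * coord z t).

Lemma coord_cscale c z t : coord (cscale c z) t = c * coord z t.
Proof. by rewrite coordK. Qed.

Lemma enorm_cscale c z : enorm (cscale c z) = normc c * enorm z.
Proof.
apply/eqP; rewrite -(@eqrXn2 _ 2)// ?mulr_ge0 ?normc_ge0 ?enorm_ge0//.
rewrite exprMn !enorm_sqrE mulr_sumr; apply/eqP; apply: eq_bigr => t _.
by rewrite coord_cscale normcM exprMn.
Qed.

Lemma cscale_real (a : R) z : cscale a%:C%C z = a *: z.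
Proof. by apply: coord_inj => t; rewrite coord_cscale coordZ. Qed.

Lemma rdot_cscale c x y :
  rdot x (cscale c y) = Re ((\sum_t coord x t * ((coord y t)^*)%C) * (c^*)%C).
Proof.
rewrite rdotE mulr_suml; congr complex.Re; apply: eq_bigr => t _.
by rewrite coord_cscale rmorphM/= mulrAC mulrA mulrAC.
Qed.

End Euclidean.


(** * Growth of starlike mappings of the ball *)

Section StarlikeStep.
Context {R : realType} {n : nat}.
Local Notation C := R[i].
Local Notation Cn := (Cx 'rV[R]_n).
Local Notation D := (@unit_ball R n).
Implicit Types (u v p x y z : Cn) (g k : Cn -> Cn).

Lemma holomorphic_map_strict (U : set Cn) g z s :
  holomorphic_map U g -> open U -> U z ->
  msder (fun y => coord (g y) s) z
    (fun t => tocplx (@dalpha R n R^o t (cxentry g ord0 s) z)).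
Proof. by move=> hg oU Uz; apply: holomorphic_strict oU Uz (hg _ _). Qed.

Lemma sder_sum (I : Type) (r : seq I) (F : I -> C -> C) (c : I -> C) (x : C) :
  (forall i, sder (F i) x (c i)) ->
  sder (fun w : C => \sum_(i <- r) F i w) x (\sum_(i <- r) c i).
Proof.
move=> dF; elim: r => [|i r IH].
  by rewrite big_nil; under eq_fun do rewrite big_nil; exact: sder_cst.
by rewrite big_cons; under eq_fun do rewrite big_cons; exact: sderD.
Qed.

(** For a holomorphic map the derivatives along the real directions determine the whole complex
    differential, so the hypothesis makes it the identity at 0. *)
Lemma tangent_to_id g : holomorphic_map D g -> g 0 = 0 ->
  (forall s t, @dalpha R n R^o t (cxentry g ord0 s) 0 = ((s == t)%:R, 0)) ->
  forall e : R, 0 < e -> exists2 d : R, 0 < d &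
  forall y, norm1 y < d -> norm1 (g y - y) <= e * norm1 y.
Proof.
move=> hg g0 dg e e0.
have D0 : D 0 by rewrite unit_ballE enorm0 ltr01.
have e1 : 0 < e / n.+1%:R by rewrite divr_gt0.
have /choice[d Hd] : forall s, exists d : R, 0 < d /\ forall y, norm1 y < d ->
    normc (coord (g y) s - coord y s) <= e / n.+1%:R * norm1 y.
  move=> s; have [d d0 H] := holomorphic_map_strict _ _ _ s hg open_unit_ball D0 _ e1.
  exists d; split=> // y yd; have := H y 0; rewrite !subr0 => /(_ yd).
  have -> : norm1 (0 : Cn) = 0 by rewrite -(scale0r (0 : Cn)) norm1Z normr0 mul0r.
  move=> /(_ d0); rewrite g0 coord0 subr0.
  rewrite (bigD1 s)// big1 ?addr0 => [|t ts]; last first.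
    by rewrite dg eq_sym (negPf ts) mul0r.
  have -> : tocplx (@dalpha R n R^o s (cxentry g ord0 s) 0) = 1 by rewrite dg eqxx.
  by rewrite coord0 subr0 mul1r /= addr0.
have [d1 d10 Hd1] := common_radius d (fun s => (Hd s).1).
exists d1 => // y yd.
have h s : normc (coord (g y - y) s) <= e / n.+1%:R * norm1 y.
  by rewrite coordB; apply: (Hd s).2; apply: lt_le_trans yd (Hd1 s).
rewrite {1}/norm1 (le_trans (ler_sum _ (fun s _ => h s)))//.
rewrite sumr_const card_ord -[_ *+ n]mulr_natl mulrA ler_wpM2r ?norm1_ge0//.
rewrite mulrCA ler_piMr ?(ltW e0)// ler_pdivrMr// mul1r ler_nat; exact: leqnSn.
Qed.

(** The point is [V z = g^-1 (t g z)], and [phi p] is the pairing of [V] on the complex line through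
    [z] with a unit vector [p]. [harnack_disc] is used in both directions between [enorm z] and a
    point [b] that tends to 0, which gives [K1] and [K2]. Taking [p] along [z] in [K1] bounds
    [enorm (V z)] from below; taking [p] along [V z] in [K2] bounds it from above. *)
Lemma starlike_step g (z : Cn) (t : R) :
  starlike_mapping D g ->
  (forall s t, @dalpha R n R^o t (cxentry g ord0 s) 0 = ((s == t)%:R, 0)) ->
  D z -> 0 <= t <= 1 ->
  exists v, [/\ D v, g v = t *: g z,
    enorm v <= enorm z * (1 - (1 - t) * ((1 - enorm z) / (1 + enorm z))) &
    enorm z * (1 - (1 - t) * ((1 + enorm z) / (1 - enorm z))) <= enorm v].
Proof.
move=> [[hg ogD [k hk kg]] g0 sg] dg Dz t01; have /andP[t0 t1] := t01.
have D0 : D 0 by rewrite unit_ballE enorm0 ltr01.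
pose V w := k (t *: g w).
have VD w : D w -> D (V w) /\ g (V w) = t *: g w.
  move=> Dw; have [y Dy yE] : (g @` D) (t *: g w) by apply: sg => //; exists w.
  by rewrite /V -yE kg.
have [z0|z0] := eqVneq z 0.
  by exists 0; rewrite z0 enorm0 !mul0r g0 scaler0.
exists (V z); have [DVz gVz] := VD _ Dz.
set r := enorm z.
have r0 : 0 < r.
  by rewrite lt_def enorm_ge0 andbT; apply: contra_neq z0 => /enorm0_eq0.
have r1 : r < 1 by [].
pose u := r^-1 *: z.
have u1 : enorm u = 1 by rewrite enormZ gtr0_norm ?invr_gt0// mulVf// gt_eqF.
have Du c : normc c < 1 -> D (cscale c u).
  by rewrite unit_ballE enorm_cscale u1 mulr1.
have dV c s : normc c < 1 -> exists l, sder (fun c => coord (V (cscale c u)) s) c l.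
  move=> c1; have Dc := Du _ c1.
  have gDc : (g @` D) (t *: g (cscale c u)) by apply: sg => //; exists (cscale c u).
  have dk := holomorphic_map_strict _ _ _ s hk ogD gDc.
  have dgl i : exists l, sder (fun c => coord (t *: g (cscale c u)) i) c l.
    have dgi := holomorphic_map_strict _ _ _ i hg open_unit_ball Dc.
    have dl j : sder (fun c => coord (cscale c u) j) c (coord u j).
      have := sder_affine (coord u j) 0 c; congr (sder _ _ _).
      by apply/funext => w; rewrite coord_cscale addr0 mulrC.
    have := msder_comp _ (fun c => cscale c u) _ _ _ dgi dl => dgu.
    have tt : sder (fun w : C => t%:C%C * w) (coord (g (cscale c u)) i) t%:C%C.
      by have := sder_affine t%:C%C 0 (coord (g (cscale c u)) i);
        under eq_fun do rewrite addr0.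
    have := sder_comp _ _ _ _ _ tt dgu => h; eexists.
    by move: h; congr (sder _ _ _); apply/funext => w; rewrite coordZ.
  have /choice[l hl] := dgl; eexists.
  exact: (msder_comp _ (fun c => t *: g (cscale c u)) _ _ _ dk hl).
pose phi p c := \sum_s coord (V (cscale c u)) s * ((coord p s)^*)%C.
have dphi p c : normc c < 1 -> exists l, sder (phi p) c l.
  move=> c1; have /choice[l hl] : forall s, exists l,
      sder (fun c => coord (V (cscale c u)) s) c l by move=> s; exact: dV.
  eexists; apply: sder_sum => s.
  exact: (sderM _ _ _ _ _ (hl s) (sder_cst _ _)).
have cu0 : cscale 0 u = 0 by apply: coord_inj => s; rewrite coord_cscale mul0r coord0.
have V0 : V 0 = 0 by rewrite /V g0 scaler0 -{1}g0 kg.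
have phi0 p : phi p 0 = 0.
  by rewrite /phi cu0 V0 big1// => s _; rewrite coord0 mul0r.
have phiP p : enorm p = 1 ->
    forall c, normc c < 1 -> Re (phi p c * (c^*)%C) <= normc c.
  move=> p1 c c1; rewrite -rdot_cscale (le_trans (rdot_le _ _))//.
  rewrite enorm_cscale p1 mulr1 ler_piMl ?normc_ge0//.
  by have [] := VD _ (Du _ c1); rewrite unit_ballE => /ltW.
have phiR p (a : R) : Re (phi p a%:C%C) = rdot (V (a *: u)) p.
  by rewrite rdotE /phi cscale_real.
(* This limit plays the role of the derivative of [V] at 0, namely [t] times the identity. It is
   obtained from [g (V w) = t *: g w], since both [w] and [V w] lie where [g] is close to the
   identity. *)
have lim_phi p : enorm p = 1 ->
    rdot (V (b *: u)) p / b @[b --> (0 : R)^'+] --> t * rdot u p.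
  move=> p1; apply/cvgrPdist_le => e e0.
  pose c1 := norm1 u + 1.
  have c10 : 0 < c1 by rewrite ltr_wpDl// norm1_ge0.
  pose e1 := Num.min (1 / 2) (e / (4 * c1)).
  have e10 : 0 < e1 by rewrite lt_min !divr_gt0// mulr_gt0.
  have [d d0 Hd] := tangent_to_id g hg g0 dg _ e10.
  have nV : exists2 d1 : R, 0 < d1 & forall b : R, 0 < b < d1 -> norm1 (V (b *: u)) < d.
    have dn : 0 < d / n.+1%:R by rewrite divr_gt0.
    have /choice[d2 Hd2] : forall s, exists d2 : R, 0 < d2 /\ forall b : R, 0 < b < d2 ->
        normc (coord (V (b *: u)) s) < d / n.+1%:R.
      move=> s; have [|l hl] := dV 0 s; first by rewrite normc0.
      have [d2 d20 H] := sder_cont _ _ _ hl _ dn; exists d2; split=> // b /andP[b0 bd].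
      have := H b%:C%C; rewrite cu0 V0 coord0 !subr0 cscale_real; apply.
      by rewrite normc_real gtr0_norm.
    have [d1 d10 Hd1] := common_radius d2 (fun s => (Hd2 s).1).
    exists d1 => // b /andP[b0 bd].
    have h s : normc (coord (V (b *: u)) s) <= d / n.+1%:R.
      by apply/ltW/(Hd2 s).2; rewrite b0 (lt_le_trans bd).
    rewrite /norm1 (le_lt_trans (ler_sum _ (fun s _ => h s)))//.
    rewrite sumr_const card_ord -[_ *+ n]mulr_natl mulrCA gtr_pMr// ltr_pdivrMr//.
    by rewrite mul1r ltr_nat.
  have [d1 d10 Hd1] := nV.
  near=> b.
  have b0 : 0 < b by near: b; exact: nbhs_right_gt.
  have b1 : b < 1 by near: b; exact: nbhs_right_lt.
  have bd1 : b < d1 by near: b; exact: nbhs_right_lt.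
  have bd2 : b < d / c1 by near: b; apply: nbhs_right_lt; rewrite divr_gt0.
  have Vb : norm1 (V (b *: u)) < d by apply: Hd1; rewrite b0.
  have ub : norm1 (b *: u) < d.
    rewrite norm1Z gtr0_norm//; apply: (@le_lt_trans _ _ (b * c1)).
      by rewrite ler_pM2l// lerDl.
    by rewrite -ltr_pdivlMr.
  have Db : D (b *: u) by rewrite unit_ballE enormZ u1 mulr1 gtr0_norm.
  have := Hd _ ub; have := Hd _ Vb; rewrite (VD _ Db).2.
  set w := b *: u; set v := V w => h1 h2.
  (* Write [v - t w = - (g v - v) + t (g w - w)]. The error [e1 |v|] is at most
     [e1 |v - t w| + e1 |w|], and as [e1 <= 1 / 2] its first part is absorbed in the left-hand side,
     which yields the factor 4. *)
  have h3 : norm1 (v - t *: w) <= 4 * e1 * norm1 w.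
    have e1h : e1 <= 1 / 2 by rewrite /e1 ge_min lexx.
    have h4 : norm1 (v - t *: w) <= norm1 (t *: g w - v) + norm1 (t *: (g w - w)).
      have -> : v - t *: w = - (t *: g w - v) + t *: (g w - w).
        by rewrite scalerBr opprB addrA subrK.
      by rewrite (le_trans (norm1D _ _))// norm1N.
    have h5 : norm1 (t *: (g w - w)) <= e1 * norm1 w.
      by rewrite norm1Z ger0_norm// (le_trans _ h2)// ler_piMl ?norm1_ge0.
    have h6 : norm1 v <= norm1 (v - t *: w) + norm1 w.
      have := norm1D (v - t *: w) (t *: w); rewrite subrK => /le_trans; apply.
      by rewrite lerD2l norm1Z ger0_norm// ler_piMl ?norm1_ge0.
    have := norm1_ge0 w; have := norm1_ge0 (v - t *: w); have := norm1_ge0 v.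
    have : e1 * norm1 v <= e1 * (norm1 (v - t *: w) + norm1 w) by rewrite ler_pM2l.
    have : e1 * norm1 (v - t *: w) <= 1 / 2 * norm1 (v - t *: w).
      by rewrite ler_wpM2r ?norm1_ge0.
    rewrite mulrDr -mulrA; lra.
  have dE : t * rdot u p - rdot v p / b = - (rdot (v - t *: w) p / b).
    rewrite rdotBl (rdotZl t w) /w (rdotZl b u); move: (rdot v p) (rdot u p) => A B.
    by field; rewrite gt_eqF.
  have abs_rdot y : `|rdot y p| <= norm1 y.
    rewrite ler_norml; apply/andP; split.
      rewrite lerNl -[- rdot y p]mulN1r -rdotZl scaleN1r.
      by rewrite (le_trans (rdot_le _ _))// p1 mulr1 -norm1N enorm_le_norm1.
    by rewrite (le_trans (rdot_le _ _))// p1 mulr1 enorm_le_norm1.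
  rewrite dE normrN normrM normfV (gtr0_norm b0) ler_pdivrMr//.
  rewrite (le_trans (abs_rdot _))// (le_trans h3)// /w norm1Z (gtr0_norm b0).
  rewrite mulrCA [leRHS]mulrC ler_pM2l//.
  have : e1 * (4 * c1) <= e.
    by rewrite -ler_pdivlMr ?mulr_gt0// /e1 ge_min lexx orbT.
  have : norm1 u <= c1 by rewrite lerDl.
  have := norm1_ge0 u; nra.
have fac_lim : (1 + b) / (1 - b) @[b --> (0 : R)^'+] --> (1 : R).
  apply: cvg_at_right_filter; rewrite -[X in _ --> X](@divr1 R).
  apply: cvgM; first by rewrite -[X in _ --> X]addr0; apply: cvgD; [exact: cvg_cst|exact: cvg_id].
  apply: cvgV; first exact: oner_neq0.
  by rewrite -[X in _ --> X]subr0; apply: cvgB; [exact: cvg_cst|exact: cvg_id].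
have rr : 0 < r < 1 by rewrite r0.
have zE : r *: u = z by rewrite scalerA divff ?gt_eqF// scale1r.
have h01 (b : R) : 0 < b < 1 -> forall p, enorm p = 1 ->
    1 - rdot (V z) p / r <= (1 + r) / (1 - r) * ((1 + b) / (1 - b) *
      (1 - rdot (V (b *: u)) p / b)) /\
    1 - rdot (V (b *: u)) p / b <= (1 + r) / (1 - r) * ((1 + b) / (1 - b) *
      (1 - rdot (V z) p / r)).
  move=> b01 p p1.
  have := harnack_disc (phi p) _ _ rr b01 (phi0 p) (dphi p) (phiP p p1).
  have := harnack_disc (phi p) _ _ b01 rr (phi0 p) (dphi p) (phiP p p1).
  by rewrite !phiR zE [_ * ((1 + r) / _)]mulrC -!mulrA.
have K1 p : enorm p = 1 -> 1 - rdot (V z) p / r <= (1 + r) / (1 - r) * (1 - t * rdot u p).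
  move=> p1; rewrite -[1 - t * _]mul1r.
  have cl : (1 + r) / (1 - r) * ((1 + b) / (1 - b) * (1 - rdot (V (b *: u)) p / b))
      @[b --> (0 : R)^'+] --> (1 + r) / (1 - r) * (1 * (1 - t * rdot u p)).
    apply: cvgM; first exact: cvg_cst.
    by apply: cvgM => //; apply: cvgB; [exact: cvg_cst|exact: lim_phi].
  apply: (cvgr_to_ge cl); near=> b; apply: (h01 b _ p p1).1.
  by apply/andP; split; near: b; [exact: nbhs_right_gt|exact: nbhs_right_lt].
have K2 p : enorm p = 1 -> 1 - t * rdot u p <= (1 + r) / (1 - r) * (1 - rdot (V z) p / r).
  move=> p1; rewrite -[1 - rdot _ _ / _]mul1r.
  have cl : 1 - rdot (V (b *: u)) p / b @[b --> (0 : R)^'+] --> 1 - t * rdot u p.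
    by apply: cvgB; [exact: cvg_cst|exact: lim_phi].
  have cr : (1 + r) / (1 - r) * ((1 + b) / (1 - b) * (1 - rdot (V z) p / r))
      @[b --> (0 : R)^'+] --> (1 + r) / (1 - r) * (1 * (1 - rdot (V z) p / r)).
    by apply: cvgM; [exact: cvg_cst|apply: cvgM => //; exact: cvg_cst].
  apply: (ler_cvg_to cl cr); near=> b; apply: (h01 b _ p p1).2.
  by apply/andP; split; near: b; [exact: nbhs_right_gt|exact: nbhs_right_lt].
split=> //.
(* A zero [V z] has no direction to serve as [p]; the upper bound is then its own nonnegativity. *)
- have [v0|v0] := eqVneq (enorm (V z)) 0.
    rewrite v0; apply: mulr_ge0; first exact: ltW.
    rewrite subr_ge0; apply: mulr_ile1; [lra|by apply: divr_ge0; lra|lra|].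
    by rewrite ler_pdivrMr; lra.
  have v0' : 0 < enorm (V z) by rewrite lt_def v0 enorm_ge0.
  pose p := (enorm (V z))^-1 *: V z.
  have p1 : enorm p = 1 by rewrite enormZ gtr0_norm ?invr_gt0// mulVf.
  have pv : rdot (V z) p = enorm (V z).
    by rewrite rdotZr -enorm_sqr expr2 mulrA mulVf// mul1r.
  have := K2 _ p1; rewrite pv.
  have := rdot_le u p; rewrite u1 p1 mulr1 => up h.
  have h' : 1 - t <= (1 + r) / (1 - r) * (1 - enorm (V z) / r) by nra.
  rewrite -ler_pdivrMl// mulrC lerBrDl -lerBrDr.
  rewrite mulrA ler_pdivrMr; last lra.
  move: h'; rewrite mulrAC ler_pdivlMr; lra.
- have := K1 _ u1; rewrite -enorm_sqr u1 expr1n mulr1.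
  have := rdot_le (V z) u; rewrite u1 mulr1 => vu h.
  rewrite mulrBr mulr1 lerBlDr -lerBlDl.
  have : 1 - enorm (V z) / r <= (1 - t) * ((1 + r) / (1 - r)).
    rewrite [leRHS]mulrC (le_trans _ h)// lerD2l lerN2 ler_wpM2r// invr_ge0 ltW//.
  move=> /(ler_wpM2l (ltW r0)); rewrite mulrBr mulr1 [r * (_ / r)]mulrCA.
  by rewrite divff ?gt_eqF// mulr1.
Unshelve. all: by end_near. Qed.

End StarlikeStep.


(** * Koebe estimates along a chain and the growth theorem *)

Section Growth.
Context {R : realType} {n : nat}.
Local Notation Cn := (Cx 'rV[R]_n).
Local Notation D := (@unit_ball R n).
Implicit Types (v w z : Cn) (g : Cn -> Cn).

(** For [tau = 1 / (j + 1)] the gain [1 + tau] is [(j + 2) / (j + 1)], so that the factors of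
    successive steps telescope. *)
Lemma koebe_upper_step (r rho tau : R) : 0 <= r < 1 -> 0 <= tau <= 1 ->
  0 <= rho -> rho <= r * (1 - tau * ((1 - r) / (1 + r))) ->
  rho / (1 - rho) ^+ 2 * (1 + tau) <= r / (1 - r) ^+ 2.
Proof.
move=> /andP[r0 r1] /andP[tau0 tau1] rhoge rhor.
set a := tau * ((1 - r) / (1 + r)) in rhor.
have a0 : 0 <= a by rewrite mulr_ge0// divr_ge0//; lra.
have aE : a * (1 + r) = tau * (1 - r) by rewrite /a -mulrA divfK// gt_eqF//; lra.
have a1 : a <= 1.
  rewrite /a mulr_ile1 ?divr_ge0 ?ler_pdivrMr//; lra.
have rhor' : rho <= r by rewrite (le_trans rhor)// ler_piMr//; lra.
rewrite mulrAC ler_pdivrMr ?exprn_gt0//; last lra.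
rewrite mulrAC ler_pdivlMr ?exprn_gt0//; last lra.
pose rho0 := r * (1 - a).
have h0 : rho0 * (1 + tau) * (1 - r) ^+ 2 <= r * (1 - rho0) ^+ 2.
  have s2 : 0 < (1 + r) ^+ 2 by rewrite exprn_gt0//; lra.
  rewrite -(ler_pM2r s2).
  have -> : rho0 * (1 + tau) * (1 - r) ^+ 2 * (1 + r) ^+ 2 =
    r * (1 - r) ^+ 2 * ((1 + r) * ((1 + r) - tau * (1 - r)) * (1 + tau)).
    by rewrite -aE /rho0; ring.
  have -> : r * (1 - rho0) ^+ 2 * (1 + r) ^+ 2 =
     r * (1 - r) ^+ 2 * (1 + r + r * tau) ^+ 2.
    have -> : r * (1 - rho0) ^+ 2 * (1 + r) ^+ 2 =
      r * ((1 + r) - r * (1 + r) + r * (a * (1 + r))) ^+ 2 by rewrite /rho0; ring.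
    by rewrite aE; ring.
  rewrite ler_wpM2l ?(mulr_ge0 r0 (sqr_ge0 _))//.
  (* The right-hand side exceeds the left-hand side by exactly [tau ^+ 2]: the terms of order 0 and
     1 in [tau] agree. *)
  have := sqr_ge0 tau; nra.
have h1 : rho * (1 + tau) * (1 - r) ^+ 2 <= rho0 * (1 + tau) * (1 - r) ^+ 2.
  by rewrite ler_wpM2r ?sqr_ge0// ler_wpM2r//; lra.
apply: (le_trans h1); apply: (le_trans h0); rewrite ler_wpM2l//.
have rr : rho <= rho0 by [].
have rr1 : rho0 <= r by rewrite ler_piMr//; lra.
by rewrite ler_pXn2r ?nnegrE//; lra.
Qed.

(** A plain factor [1 - tau] would suffer a loss of second order. The shift [c] compensates for it:
    it adds [c * (1 - r) ^+ 2] to the coefficient of [tau ^+ 2], and [1 <= c * (1 - r) ^+ 2] makes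
    that coefficient nonnegative. For [tau = 1 / (j + 1)] the ratio of the two factors is
    [(j - c) / (j + 1 - c)], which still telescopes. *)
Lemma koebe_lower_step (r rho tau c : R) : 0 <= r < 1 -> 0 <= tau ->
  1 <= c * (1 - r) ^+ 2 -> (c + 1) * tau <= 1 ->
  rho < 1 -> r * (1 - tau * ((1 + r) / (1 - r))) <= rho ->
  r / (1 + r) ^+ 2 * (1 - (c + 1) * tau) <= rho / (1 + rho) ^+ 2 * (1 - c * tau).
Proof.
move=> /andP[r0 r1] tau0 c1 ctau rho1 rhor.
have s0 : 0 < 1 - r by lra.
have s21 : (1 - r) ^+ 2 <= 1 by rewrite expr_le1//; lra.
have c0 : 1 <= c.
  rewrite leNgt; apply/negP => c'; have : 0 < (1 - r) ^+ 2 by rewrite exprn_gt0.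
  nra.
set a := tau * ((1 + r) / (1 - r)) in rhor.
have aE : a * (1 - r) = tau * (1 + r) by rewrite /a -mulrA divfK// gt_eqF.
have a0 : 0 <= a by rewrite mulr_ge0// divr_ge0//; lra.
have a1 : a <= 1.
  rewrite -(ler_pM2r s0) aE mul1r.
  have h : tau <= (1 - r) ^+ 2.
    have : c * tau <= c * (1 - r) ^+ 2 by lra.
    by rewrite ler_pM2l//; lra.
  have h2 : tau * (1 + r) <= (1 - r) ^+ 2 * (1 + r) by rewrite ler_wpM2r//; lra.
  apply: (le_trans h2); rewrite expr2 -mulrA ler_piMr//; first lra.
  have := sqr_ge0 r; lra.
pose rho0 := r * (1 - a).
have rho00 : 0 <= rho0 by rewrite mulr_ge0//; lra.
have rho0r : rho0 <= rho by [].
have rho01 : rho0 <= r by rewrite ler_piMr//; lra.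
have q0 : 0 <= 1 - (c + 1) * tau by lra.
have q1 : 0 <= 1 - c * tau by lra.
apply: (@le_trans _ _ (rho0 / (1 + rho0) ^+ 2 * (1 - c * tau))); last first.
  rewrite ler_wpM2r// ler_pdivrMr ?exprn_gt0//; last lra.
  rewrite mulrAC ler_pdivlMr ?exprn_gt0//; last lra.
  have : 0 <= (rho - rho0) * (1 - rho * rho0).
    by rewrite mulr_ge0 ?subr_ge0// mulr_ile1//; lra.
  lra.
rewrite mulrAC ler_pdivrMr ?exprn_gt0//; last lra.
rewrite [X in _ <= X * _]mulrAC [leRHS]mulrAC ler_pdivlMr ?exprn_gt0//; last lra.
have s2 : 0 < (1 - r) ^+ 2 by rewrite exprn_gt0.
rewrite -(ler_pM2r s2).
have -> : r * (1 - (c + 1) * tau) * (1 + rho0) ^+ 2 * (1 - r) ^+ 2 =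
  r * (1 + r) ^+ 2 * ((1 - (c + 1) * tau) * (1 - r - r * tau) ^+ 2).
  have -> : r * (1 - (c + 1) * tau) * (1 + rho0) ^+ 2 * (1 - r) ^+ 2 =
    r * (1 - (c + 1) * tau) * ((1 - r) + r * (1 - r) - r * (a * (1 - r))) ^+ 2.
    by rewrite /rho0; ring.
  by rewrite aE; ring.
have -> : rho0 * (1 - c * tau) * (1 + r) ^+ 2 * (1 - r) ^+ 2 =
  r * (1 + r) ^+ 2 * ((1 - r) * ((1 - r) - tau * (1 + r)) * (1 - c * tau)).
  by rewrite -aE /rho0; ring.
rewrite ler_wpM2l ?(mulr_ge0 r0 (sqr_ge0 _))//.
rewrite -subr_ge0.
have -> : (1 - r) * (1 - r - tau * (1 + r)) * (1 - c * tau) -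
   (1 - (c + 1) * tau) * (1 - r - r * tau) ^+ 2 =
   tau ^+ 2 * ((c * (1 - r) ^+ 2 - 1) + (1 - r) ^+ 2 + (c + 1) * r ^+ 2 * tau) by ring.
have h3 : 0 <= (c + 1) * r ^+ 2 * tau.
  by rewrite mulr_ge0// mulr_ge0 ?sqr_ge0//; lra.
apply: mulr_ge0; first exact: sqr_ge0.
by have := sqr_ge0 (1 - r); lra.
Qed.

(** After [i] steps [w] is the preimage of [(j / b) g z]; the step from [j + 1] to [j] applies
    [starlike_step] with [t = j / (j + 1)]. The constant [c] is fixed by the initial radius and
    remains admissible because norms decrease along the chain. The lower bound asks for [c <= j],
    which keeps its factors nonnegative. *)
Lemma starlike_chain g z (b i : nat) : starlike_mapping D g ->
  (forall s t, @dalpha R n R^o t (cxentry g ord0 s) 0 = ((s == t)%:R, 0)) ->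
  D z -> (i <= b)%N -> let j := (b - i)%N in let r := enorm z in
  let c := ((1 - r) ^+ 2)^-1 in
  exists w, [/\ D w, enorm w <= r, b%:R *: g w = j%:R *: g z,
    enorm w / (1 - enorm w) ^+ 2 * (b%:R + 1) <= r / (1 - r) ^+ 2 * (j%:R + 1) &
    c <= j%:R -> r / (1 + r) ^+ 2 * (j%:R - c) <=
      enorm w / (1 + enorm w) ^+ 2 * (b%:R - c)].
Proof.
move=> sg dg Dz; elim: i => [_|i IH ib] j r c.
  by exists z; split=> //; rewrite /j subn0.
have [w [Dw wr gw Uw Lw]] := IH (ltnW ib).
have jS : (b - i)%N = j.+1 by rewrite /j subnSK.
move: gw Uw Lw; rewrite jS -/r -/c => gw Uw Lw.
have j0 : 0 < j.+1%:R :> R by rewrite ltr0n.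
have jN : j.+1%:R = j%:R + 1 :> R by rewrite natr1.
have t01 : 0 <= (j%:R / j.+1%:R : R) <= 1.
  by rewrite divr_ge0//= ler_pdivrMr// mul1r ler_nat.
have [v [Dv gv Uv Lv]] := starlike_step g w _ sg dg Dw t01.
have w01 : 0 <= enorm w < 1 by rewrite enorm_ge0.
have /andP[w0 w1] := w01.
have tauE : 1 - j%:R / j.+1%:R = j.+1%:R^-1 :> R.
  by rewrite -[X in X - _](@divff _ (j.+1%:R : R)) ?gt_eqF// -mulrBl jN addrAC subrr add0r mul1r.
move: Uv Lv; rewrite tauE => Uv Lv.
have vw : enorm v <= enorm w.
  apply: (le_trans Uv); rewrite ler_piMr// gerBl mulr_ge0 ?invr_ge0//.
  by rewrite divr_ge0//; lra.
exists v; split=> //.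
- exact: le_trans vw wr.
- by rewrite gv scalerA mulrC -scalerA gw scalerA divfK// gt_eqF.
- have tau01 : 0 <= (j.+1%:R^-1 : R) <= 1.
    by rewrite invr_ge0 ler0n invf_le1// ler1n.
  have h := koebe_upper_step _ _ _ w01 tau01 (enorm_ge0 v) Uv.
  move: h Uw; rewrite jN; set X := enorm v / _; set W := enorm w / _; set Y := r / _.
  set J : R := j%:R + 1 => h Uw.
  have J0 : 0 < J by rewrite /J -jN.
  have h1 : X * (J + 1) <= W * J.
    have := ler_wpM2r (ltW J0) h; by rewrite -mulrA [(1 + _) * J]mulrDl mul1r mulVf ?gt_eqF.
  have b0 : 0 <= b%:R + 1 :> R by rewrite addr_ge0.
  have h2 := ler_wpM2r b0 h1.
  have h3 := ler_wpM2l (ltW J0) Uw.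
  have J1 : 0 < J + 1 by lra.
  rewrite -(ler_pM2r J1); lra.
- move=> cj.
  have cj1 : c <= j.+1%:R by rewrite (le_trans cj)// ler_nat.
  have r01 : r < 1 by [].
  have c0 : 0 < c by rewrite invr_gt0 exprn_gt0// subr_gt0.
  have cw : 1 <= c * (1 - enorm w) ^+ 2.
    rewrite mulrC ler_pdivlMr ?exprn_gt0 ?subr_gt0// mul1r.
    by rewrite ler_pXn2r ?nnegrE ?subr_ge0 ?lerD2l ?lerN2// ltW.
  have ct : (c + 1) * j.+1%:R^-1 <= 1 by rewrite ler_pdivrMr// mul1r jN lerD2r.
  have t0 : 0 <= (j.+1%:R^-1 : R) by rewrite invr_ge0.
  have h := koebe_lower_step _ _ _ _ w01 t0 cw ct (le_lt_trans vw w1) Lv.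
  have {}Lw := Lw cj1.
  have bc : 0 <= b%:R - c.
    by rewrite subr_ge0 (le_trans cj)// ler_nat /j leq_subr.
  move: h Lw; rewrite jN; set X := enorm v / _; set W := enorm w / _; set Y := r / _.
  set J : R := j%:R + 1 => h Lw.
  have J0 : 0 < J by rewrite /J -jN.
  have h1 : W * (j%:R - c) <= X * (J - c).
    have := ler_wpM2r (ltW J0) h; rewrite -!mulrA ![(1 - _) * J]mulrBl.
    rewrite -!mulrA mulVf ?gt_eqF// !mulr1 mul1r /J opprD addrA.
    by rewrite addrAC addrK.
  have Jc : 0 < J - c by rewrite /J; lra.
  have jc0 : 0 <= j%:R - c by lra.
  have h2 := ler_wpM2r bc h1.
  have h3 := ler_wpM2l jc0 Lw.
  rewrite -(ler_pM2r Jc); lra.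
Qed.

Theorem starlike_growth g z : starlike_mapping D g ->
  (forall s t, @dalpha R n R^o t (cxentry g ord0 s) 0 = ((s == t)%:R, 0)) ->
  D z ->
  enorm z / (1 + enorm z) ^+ 2 <= enorm (g z) <= enorm z / (1 - enorm z) ^+ 2.
Proof.
move=> sg dg Dz; set r := enorm z.
have r0 : 0 <= r := enorm_ge0 z.
have r1 : r < 1 by [].
pose c := ((1 - r) ^+ 2)^-1.
have c0 : 0 < c by rewrite invr_gt0 exprn_gt0// subr_gt0.
pose Ku := r / (1 - r) ^+ 2; pose Kl := r / (1 + r) ^+ 2.
have Ku0 : 0 <= Ku by rewrite divr_ge0 ?sqr_ge0.
have Kl0 : 0 <= Kl by rewrite divr_ge0 ?sqr_ge0.
have main (e : R) : 0 < e < 1 ->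
    enorm (g z) <= (1 + e) * (1 + e) * Ku /\ (1 - e) * (1 - e) * Kl <= enorm (g z).
  move=> /andP[e0 e1].
  have [[hg _ _] g0 _] := sg.
  have en : 0 < e / n.+1%:R by rewrite divr_gt0.
  have [d d0 Hd] := tangent_to_id g hg g0 dg _ en.
  have near_id w : norm1 w < d ->
      (1 - e) * enorm w <= enorm (g w) <= (1 + e) * enorm w.
    move=> wd; have := Hd _ wd => h.
    have h1 : enorm (g w - w) <= e * enorm w.
      rewrite (le_trans (enorm_le_norm1 _))// (le_trans h)//.
      rewrite (le_trans (ler_wpM2l (ltW en) (norm1_le_enorm w)))// mulrA.
      rewrite ler_wpM2r ?enorm_ge0// -mulrA ler_piMr ?(ltW e0)//.
      by rewrite mulrC ler_pdivrMr// mul1r ler_nat leqnSn.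
    have h2 := enormD (g w - w) w; rewrite subrK in h2.
    have h3 := enormD (w - g w) (g w); rewrite subrK -[enorm (w - g w)]enormN opprB in h3.
    by apply/andP; split; lra.
  (* The end index [j] is so large that both [(j + 1) / j] and [(j - c) / j] are within [e] of 1.
     Only then is the start [b] of the chain chosen, large enough to bring [w] into the region where
     [g] is close to the identity; [b * enorm (g w) = j * enorm (g z)] transports the estimate back
     to [z]. *)
  pose j := (Num.truncn ((c + 1) / e)).+1.
  have j0 : 0 < j%:R :> R by rewrite ltr0n.
  have jc : c + 1 < e * j%:R.
    by rewrite mulrC -ltr_pdivrMr// truncnS_gt.
  have ej : e * j%:R <= j%:R by rewrite ler_piMl ?ltW.
  pose M := (n%:R * Ku + 1) * (j%:R + 1) / d.
  pose b := (j + (Num.truncn M).+1)%N.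
  have jb : (j <= b)%N by rewrite leq_addr.
  have Mb : M < b%:R.
    rewrite (lt_le_trans (truncnS_gt _))// ler_nat leq_addl//.
  have b0 : 0 < b%:R :> R by rewrite ltr0n.
  have [w [Dw wr gw Uw Lw]] := starlike_chain _ _ _ _ sg dg Dz (leq_subr j b).
  move: gw Uw Lw; rewrite subKn// -/r -/c -/Ku -/Kl => gw Uw Lw.
  have w0 := enorm_ge0 w; have w1 : enorm w < 1 by [].
  have wU : enorm w * (b%:R + 1) <= Ku * (j%:R + 1).
    apply: le_trans Uw; rewrite ler_wpM2r ?addr_ge0//.
    rewrite ler_pdivlMr ?exprn_gt0 ?subr_gt0// ler_piMr// expr_le1//; lra.
  have wd : norm1 w < d.
    apply: (le_lt_trans (norm1_le_enorm w)).
    have : (n%:R * Ku + 1) * (j%:R + 1) < b%:R * d by rewrite -ltr_pdivrMr.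
    have : n%:R * (enorm w * (b%:R + 1)) <= n%:R * (Ku * (j%:R + 1)).
      by rewrite ler_wpM2l.
    move=> h1 h2; have b1 : 0 < b%:R + 1 :> R by lra.
    rewrite -(ltr_pM2r b1); lra.
  have /andP[n1 n2] := near_id _ wd.
  have gE : b%:R * enorm (g w) = j%:R * enorm (g z).
    have := congr1 enorm gw; rewrite !enormZ !ger0_norm ?ler0n//.
  split.
    rewrite -(ler_pM2l j0) -gE.
    have h1 : b%:R * enorm (g w) <= b%:R * ((1 + e) * enorm w) by rewrite ler_pM2l.
    have h2 : b%:R * enorm w <= Ku * (j%:R + 1) by lra.
    have h3 : (1 + e) * (b%:R * enorm w) <= (1 + e) * (Ku * (j%:R + 1)).
      by rewrite ler_pM2l//; lra.
    have h4 : Ku * (j%:R + 1) <= Ku * (j%:R * (1 + e)) by rewrite ler_wpM2l//; lra.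
    have h5 : (1 + e) * (Ku * (j%:R + 1)) <= (1 + e) * (Ku * (j%:R * (1 + e))).
      by rewrite ler_pM2l//; lra.
    lra.
  have cj : c <= j%:R by lra.
  have {}Lw := Lw cj.
  have jb' : j%:R <= b%:R :> R by rewrite ler_nat.
  have lw : enorm w / (1 + enorm w) ^+ 2 <= enorm w.
    rewrite ler_pdivrMr ?exprn_gt0//; last lra.
    by rewrite ler_peMr// expr_ge1//; lra.
  have h1 : Kl * (j%:R - c) <= enorm w * (b%:R - c).
    by apply: (le_trans Lw); rewrite ler_wpM2r//; lra.
  have h2 : enorm w * (b%:R - c) <= enorm w * b%:R by rewrite ler_wpM2l//; lra.
  rewrite -(ler_pM2l j0) -gE.
  have h3 : b%:R * ((1 - e) * enorm w) <= b%:R * enorm (g w) by rewrite ler_pM2l.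
  have h4 : (1 - e) * (Kl * (j%:R - c)) <= (1 - e) * (enorm w * b%:R).
    by rewrite ler_pM2l; lra.
  have h5 : Kl * (j%:R * (1 - e)) <= Kl * (j%:R - c) by rewrite ler_wpM2l//; lra.
  have h6 : (1 - e) * (Kl * (j%:R * (1 - e))) <= (1 - e) * (Kl * (j%:R - c)).
    by rewrite ler_pM2l; lra.
  lra.
have small (K e : R) : 0 <= K -> 0 < e -> exists e1, 0 < e1 < 1 /\ 3 * e1 * K <= e.
  move=> K0 e0; exists (Num.min (1 / 2) (e / (3 * (K + 1)))).
  have K1 : 0 < 3 * (K + 1) by rewrite mulr_gt0//; lra.
  split.
    rewrite lt_min divr_gt0// divr_gt0//=.
    by rewrite (@le_lt_trans _ _ (1 / 2))// ?ge_min ?lexx//; lra.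
  have : Num.min (1 / 2) (e / (3 * (K + 1))) <= e / (3 * (K + 1)).
    by rewrite ge_min lexx orbT.
  set m := Num.min _ _ => h.
  have : m * (3 * (K + 1)) <= e by rewrite -ler_pdivlMr.
  have : 0 <= m by rewrite le_min !divr_ge0// ltW.
  lra.
apply/andP; split.
  rewrite -/Kl; apply/ler_addgt0Pl => e e0.
  have [e1 [e01 he]] := small _ _ Kl0 e0; have /andP[e10 e11] := e01.
  have [_ h] := main _ e01.
  have : 0 <= e1 ^+ 2 * Kl by rewrite mulr_ge0 ?sqr_ge0.
  have : 0 <= e1 * Kl by rewrite mulr_ge0// ltW.
  lra.
rewrite -/Ku; apply/ler_addgt0Pl => e e0.
have [e1 [e01 he]] := small _ _ Ku0 e0; have /andP[e10 e11] := e01.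
have [h _] := main _ e01.
have : e1 ^+ 2 * Ku <= e1 * Ku.
  by rewrite ler_wpM2r// expr2 ler_piMl ?ltW.
lra.
Qed.

End Growth.


(** * Slices of the Clifford algebra *)

Section CliffordInner.
Context {R : realType} {m : nat}.
Local Notation Cl := (clifford R m).
Implicit Types (x y z I J : Cl) (a b : R).

Definition cdot x y : R := \sum_A x A * y A.

Lemma cdotC x y : cdot x y = cdot y x.
Proof. by apply: eq_bigr => A _; rewrite mulrC. Qed.

Lemma cdotDr x y z : cdot x (y + z) = cdot x y + cdot x z.
Proof.
by rewrite /cdot -big_split; apply: eq_bigr => A _ /=; rewrite claddE mulrDr.
Qed.

Lemma cdotZr a x y : cdot x (a *: y) = a * cdot x y.
Proof.
by rewrite /cdot mulr_sumr; apply: eq_bigr => A _; rewrite clscaleE mulrCA.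
Qed.

Lemma cdotDl x y z : cdot (x + y) z = cdot x z + cdot y z.
Proof. by rewrite cdotC cdotDr !(cdotC z). Qed.

Lemma cdotZl a x y : cdot (a *: x) y = a * cdot x y.
Proof. by rewrite cdotC cdotZr cdotC. Qed.

Lemma cdotNr x y : cdot x (- y) = - cdot x y.
Proof. by rewrite -scaleN1r cdotZr mulN1r. Qed.

Lemma cdotNl x y : cdot (- x) y = - cdot x y.
Proof. by rewrite cdotC cdotNr cdotC. Qed.

(** The Euclidean inner product is the scalar part of [x^c y], because each blade is inverted by
    conjugation. This links it to multiplication and makes left multiplication by an imaginary unit
    an isometry. *)
Lemma cdotE x y : cdot x y = (clconj x * y) finset.set0.
Proof.
rewrite clmulrE; apply: eq_bigr => A _; rewrite symds0 ffunE mulrA.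
have -> : bsign R A A * bsign R A A = 1.
  by rewrite -bsign_symdl symdss bsign0l.
by rewrite mul1r.
Qed.

Lemma coef0_mulC x y : (x * y) finset.set0 = (y * x) finset.set0.
Proof.
by rewrite !clmulrE; apply: eq_bigr => A _; rewrite symds0 -!mulrA [x A * _]mulrC.
Qed.

Lemma coefN x A : (- x) A = - x A.
Proof. by rewrite ffunE. Qed.

Lemma clnorm_cdot x : `|x| ^+ 2 = cdot x x.
Proof. by rewrite (clnorm_sqr x). Qed.

Lemma cdot_le x y : cdot x y <= `|x| * `|y|.
Proof. exact: cl_CauchySchwarz. Qed.

Lemma imag_unit_conj J : imag_units J -> clconj J = - J.
Proof.
by move=> /imag_unitsP[tJ _]; apply/eqP; rewrite -addr_eq0 addrC; apply/eqP.
Qed.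

Lemma imag_unit_sqr J : imag_units J -> J * J = -1.
Proof. by case. Qed.

Lemma cdot_mull J x y : imag_units J -> cdot (J * x) (J * y) = cdot x y.
Proof.
move=> iJ; rewrite !cdotE clconjM (imag_unit_conj _ iJ) !mulrA -(mulrA _ (- J)).
by rewrite mulNr (imag_unit_sqr _ iJ) opprK mulr1.
Qed.

Lemma imag_unit_norm_mul J x : imag_units J -> `|J * x| = `|x|.
Proof.
move=> iJ; apply/eqP; rewrite -(@eqrXn2 _ 2)//; apply/eqP.
by rewrite !clnorm_cdot cdot_mull.
Qed.

Lemma cdot11 : cdot 1 1 = 1.
Proof.
rewrite /cdot (bigD1 finset.set0)//= big1 ?addr0 => [|A /negPf A0].
  by rewrite ffunE eqxx mulr1.
by rewrite ffunE A0 mul0r.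
Qed.

Lemma clconj1 : clconj 1 = 1 :> Cl.
Proof.
apply/ffunP => A; rewrite !ffunE; case: eqP => [->|_]; last by rewrite mulr0.
by rewrite bsign0l mulr1.
Qed.

Lemma cdot1_imag J : imag_units J -> cdot 1 J = 0.
Proof.
move=> iJ; have := cdotE J 1; rewrite (imag_unit_conj _ iJ) mulr1 cdotC.
have := cdotE 1 J; rewrite clconj1 mul1r => -> /eqP.
rewrite coefN -addr_eq0 -mulr2n mulrn_eq0 => /orP[//|/eqP].
exact.
Qed.

Lemma cdot_imag J : imag_units J -> cdot J J = 1.
Proof. by move=> iJ; rewrite -{1 2}(mulr1 J) cdot_mull// cdot11. Qed.

Lemma cdot_imag_le I J : imag_units I -> imag_units J -> -1 <= cdot I J <= 1.
Proof.
have n1 (K : Cl) : imag_units K -> `|K| = 1.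
  move=> iK; apply/eqP; rewrite -(@eqrXn2 _ 2)//; apply/eqP.
  by rewrite clnorm_cdot cdot_imag// expr1n.
move=> iI iJ; apply/andP; split.
  by rewrite lerNl -cdotNl (le_trans (cdot_le _ _))// normrN !n1// mulr1.
by rewrite (le_trans (cdot_le _ _))// !n1// mulr1.
Qed.

Lemma imag_unit_affine I a b : imag_units I ->
  cdot (a%:A + I * b%:A) (a%:A + I * b%:A) = a ^+ 2 + b ^+ 2.
Proof.
move=> iI; rewrite -scalerAr mulr1 !cdotDl !cdotDr !cdotZl !cdotZr.
by rewrite (cdotC I 1) (cdot1_imag _ iI) cdot11 (cdot_imag _ iI); ring.
Qed.

Lemma imag_unit_affine_inj I a b c d : imag_units I ->
  a%:A + I * b%:A = c%:A + I * d%:A -> a = c /\ b = d.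
Proof.
move=> iI; rewrite -!scalerAr !mulr1 => E; split.
  have := congr1 (cdot 1) E.
  by rewrite !cdotDr !cdotZr (cdot1_imag _ iI) cdot11 !mulr0 !addr0 !mulr1.
have := congr1 (cdot I) E.
by rewrite !cdotDr !cdotZr (cdotC I 1) (cdot1_imag _ iI) (cdot_imag _ iI) !mulr0 !add0r !mulr1.
Qed.

(** Expanding in the basis 1, [I], the terms <1, J> and <I, J I> vanish and <1, J I> = - <I, J>, by
    cyclicity of the scalar part. What remains is [<I, J> (b c - a d)], and <I, I> = 1. *)
Lemma cdot_rotate I J a b c d : imag_units I -> imag_units J ->
  let x := a%:A + I * b%:A in let y := c%:A + I * d%:A in
  cdot x (J * y) = cdot I J * cdot x (I * y).
Proof.
move=> iI iJ x y.
have E K : imag_units K -> cdot x (K * y) =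
    b * c * cdot I K + a * d * cdot 1 (K * I) + b * d * cdot I (K * I).
  move=> iK; rewrite /x /y -!scalerAr !mulr1 mulrDr -!scalerAr mulr1.
  rewrite !cdotDl !cdotDr !cdotZl !cdotZr (cdot1_imag _ iK); ring.
have F K : imag_units K -> cdot 1 (K * I) = - cdot I K.
  move=> iK; rewrite !cdotE clconj1 mul1r (imag_unit_conj _ iI) coef0_mulC.
  by rewrite mulNr coefN opprK.
have G K : imag_units K -> cdot I (K * I) = 0.
  move=> iK; rewrite cdotE (imag_unit_conj _ iI) coef0_mulC mulrN -mulrA.
  rewrite (imag_unit_sqr _ iI) mulrN1 opprK.
  by have := cdot1_imag _ iK; rewrite cdotE clconj1 mul1r.
by rewrite !E// !F// !G// (cdot_imag _ iI); ring.
Qed.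

End CliffordInner.

(** * Norms on different slices *)

Section SliceNorm.
Context {R : realType} {m n : nat}.
Local Notation Cl := (clifford R m).
Local Notation Cn := (Cx 'rV[R]_n).
Implicit Types (I J : Cl) (z w : Cn) (x y : 'rV[Cl]_n).

Lemma vnorm_ge0 x : 0 <= vnorm x. Proof. exact: sqrtr_ge0. Qed.

Lemma vnorm_sqr x : vnorm x ^+ 2 = \sum_t cdot (x ord0 t) (x ord0 t).
Proof.
rewrite sqr_sqrtr; last by apply: sumr_ge0 => t _; exact: sqr_ge0.
by apply: eq_bigr => t _; rewrite clnorm_cdot.
Qed.

Lemma slice_ptE J z t :
  slice_pt J z ord0 t = (z.1 ord0 t)%:A + J * (z.2 ord0 t)%:A.
Proof. by rewrite !mxE. Qed.

Lemma vnorm_slice_pt J z : imag_units J -> vnorm (slice_pt J z) = enorm z.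
Proof.
move=> iJ; apply/eqP; rewrite -(@eqrXn2 _ 2) ?vnorm_ge0 ?enorm_ge0//; apply/eqP.
rewrite vnorm_sqr enorm_sqr; apply: eq_bigr => t _.
by rewrite slice_ptE imag_unit_affine// !expr2.
Qed.

Lemma slice_pt_inj J : imag_units J -> injective (@slice_pt R m n J).
Proof.
move=> iJ [a b] [c d] E.
have H t : a ord0 t = c ord0 t /\ b ord0 t = d ord0 t.
  apply: (imag_unit_affine_inj J _ _ _ _ iJ).
  by have := congr1 (fun x : 'rV_n => x ord0 t) E; rewrite !slice_ptE.
by congr (_, _); apply/rowP => t; have [] := H t.
Qed.

(** The squared norm is |F1|^2 + |F2|^2 + 2 <F1, J F2>, and by [cdot_rotate] its last term is <I, J>
    times the one for [I]. It is thus affine in <I, J>, with the two given slice values at 1 and -1.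
    The rotation rule needs [F1] and [F2] to have components in the plane of [I], which holds
    because both F1 + I F2 and F1 - I F2 do. *)
Lemma slice_norm_interpolation I J (F1 F2 : 'rV[Cl]_n) w w' :
  imag_units I -> imag_units J ->
  slice_pt I w = F1 + I *: F2 -> slice_pt I w' = F1 - I *: F2 ->
  vnorm (F1 + J *: F2) ^+ 2 =
    (1 + cdot I J) / 2 * enorm w ^+ 2 + (1 - cdot I J) / 2 * enorm w' ^+ 2.
Proof.
move=> iI iJ E E'.
have nw : enorm w ^+ 2 = \sum_t cdot ((F1 + I *: F2) ord0 t) ((F1 + I *: F2) ord0 t).
  by rewrite -vnorm_sqr -E vnorm_slice_pt.
have nw' : enorm w' ^+ 2 = \sum_t cdot ((F1 - I *: F2) ord0 t) ((F1 - I *: F2) ord0 t).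
  by rewrite -vnorm_sqr -E' vnorm_slice_pt.
have comb (p q : R) (F G : 'I_n -> R) :
    p * \sum_t F t + q * \sum_t G t = \sum_t (p * F t + q * G t).
  by rewrite big_split -!mulr_sumr.
rewrite nw nw' vnorm_sqr comb.
apply: eq_bigr => t _ /=; rewrite !mxE.
set x := F1 ord0 t; set y := F2 ord0 t.
have Et : (w.1 ord0 t)%:A + I * (w.2 ord0 t)%:A = x + I * y.
  by rewrite -slice_ptE E !mxE.
have Et' : (w'.1 ord0 t)%:A + I * (w'.2 ord0 t)%:A = x - I * y.
  by rewrite -slice_ptE E' !mxE.
(* These are the coordinates in the plane of [I] of the half sum of the two values, which is [x],
   and of [- I] times their half difference, which is [y]. *)
pose a := (w.1 ord0 t + w'.1 ord0 t) / 2; pose b := (w.2 ord0 t + w'.2 ord0 t) / 2.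
pose c := (w.2 ord0 t - w'.2 ord0 t) / 2; pose d := (w'.1 ord0 t - w.1 ord0 t) / 2.
have h2 (u v : Cl) : (2 : R) *: u = (2 : R) *: v -> u = v.
  by move=> /(congr1 (fun z : Cl => 2^-1 *: z)); rewrite !scalerA mulVf// !scale1r.
have xE : x = a%:A + I * b%:A.
  apply: h2.
  have -> : (2 : R) *: x = (x + I * y) + (x - I * y).
    by rewrite addrACA subrr addr0 scaler_nat mulr2n.
  rewrite -Et -Et' addrACA -mulrDr -!scalerDl scalerDr scalerAr !scalerA.
  by rewrite /a /b ![2 * _]mulrC !divfK.
have yE : y = c%:A + I * d%:A.
  apply: h2.
  have -> : (2 : R) *: y = - (I * ((x + I * y) - (x - I * y))).
    rewrite opprB addrC addrA subrK -mulr2n -mulrnAr mulrA.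
    by rewrite (imag_unit_sqr _ iI) mulN1r opprK scaler_nat.
  rewrite -Et -Et' opprD addrACA -mulrBr -!scalerBl mulrDr mulrA.
  rewrite (imag_unit_sqr _ iI) mulN1r opprD opprK addrC scalerDr scalerAr !scalerA.
  rewrite /c /d ![2 * _]mulrC !divfK//; congr (_ + _).
  by rewrite -mulrN -scaleNr opprB.
have rot := cdot_rotate I J a b c d iI iJ; rewrite /= -xE -yE in rot.
rewrite !cdotDl !cdotDr !cdotNl !cdotNr ![cdot (_ * y) x]cdotC !cdot_mull// rot.
by field.
Qed.

End SliceNorm.


Section DeriveMaps.
Context {R : realType} {V W1 W2 : normedModType R}.

(** The norm bound supplies the continuity of the linear map [L]. It is met by left multiplication
    by an imaginary unit, an isometry. *)
Lemma is_derive_contraction (L : W1 -> W2) (f : V -> W1) x v l :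
  (forall a b, L (a - b) = L a - L b) -> (forall (c : R) a, L (c *: a) = c *: L a) ->
  (forall a, `|L a| <= `|a|) ->
  is_derive x v f l -> is_derive x v (L \o f) (L l).
Proof.
move=> LB LZ Lc /is_deriveP fl; apply/is_deriveP/cvgrPdist_le => e e0.
have /cvgrPdist_le /(_ e e0) := fl; apply: filterS => h.
by rewrite /= -LB -LZ -LB; apply: le_trans.
Qed.

Lemma is_derive_scale_vec (f : V -> R) x v l (c : W1) :
  is_derive x v f l -> is_derive x v (fun y => f y *: c) (l *: c).
Proof.
move=> /is_deriveP fl; apply/is_deriveP.
under eq_fun do rewrite -scalerBl scalerA.
exact: cvgZr_tmp fl.
Qed.

End DeriveMaps.

(** * From one slice to the whole ball *)

Section SliceGrowth.
Context {R : realType} {m n : nat}.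
Local Notation Cl := (clifford R m).
Local Notation Cn := (Cx 'rV[R]_n).
Local Notation D := (@unit_ball R n).
Implicit Types (I J : Cl) (z w : Cn) (x y : 'rV[Cl]_n) (f : 'rV[Cl]_n -> 'rV[Cl]_n).

Lemma unit_ball_conj z : D z -> D (cxconj z).
Proof.
rewrite !unit_ballE /enorm => z1; apply: le_lt_trans z1.
by rewrite le_eqVlt; apply/orP; left; apply/eqP; congr Num.sqrt;
  apply: eq_bigr => t _; rewrite !mxE sqrrN.
Qed.

Lemma slice_restrE I f F z : imag_units I -> induces F f ->
  f @` ball_slice I `<=` cplane I -> D z ->
  slice_pt I (slice_restr I f z) = (F z).1 + I *: (F z).2.
Proof.
move=> iI Ff fI Dz; rewrite -Ff//.
have [|w _ wE] := fI (f (slice_pt I z)).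
  exists (slice_pt I z) => //; split; last by exists z.
  split; first by exists I => //; exists z.
  by rewrite /= vnorm_slice_pt.
(* The hypothesis that [f] preserves the slice provides a preimage [w], so the default value 0 of
   [xget] never occurs. *)
by apply: (xgetPex 0 (P := [set w | slice_pt I w = f (slice_pt I z)])); exists w.
Qed.

(** This translates the Clifford normalization [f' 0 = 1] into the one that [starlike_growth]
    expects. By the Cauchy-Riemann equations [dz] of the stem is its real-direction derivative.
    Differentiating [slice_pt I g = F1 + I F2] in that direction and comparing the components on 1
    and [I] isolates the derivative of [g]. *)
Lemma slice_restr_deriv I f F (f' : 'rV[Cl]_n -> 'M[Cl]_n) : imag_units I -> regular_stem F ->
  induces F f -> induces (stem_deriv F) f' -> f' 0 = 1%:M ->
  f @` ball_slice I `<=` cplane I -> holomorphic_map D (slice_restr I f) ->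
  forall s t, @dalpha R n R^o t (cxentry (slice_restr I f) ord0 s) 0 =
    ((s == t)%:R, 0).
Proof.
move=> iI [_ hF] Ff F'f' f'0 fI hg s t.
have D0 : D 0 by rewrite unit_ballE enorm0.
set g := slice_restr I f in hg *.
have pt0 : slice_pt I (0 : Cn) = 0.
  by apply/rowP => j; rewrite slice_ptE !mxE !scale0r mulr0 addr0.
have [FC1 FCR] := hF ord0 s; have [dF _ _ _] := FC1 0 t D0.
have [gC1 _] := hg ord0 s; have [dg _ _ _] := gC1 0 t D0.
pose e : Cn := (delta_mx ord0 t, 0).
pose dFv := dalpha t (cxentry F ord0 s) 0.
have dzE : dz t (cxentry F ord0 s) 0 = dFv.
  have := FCR 0 t D0; rewrite /dz /dzbar -/dFv.
  move=> /eqP; rewrite scaler_eq0 invr_eq0 (negPf (_ : 2 != 0))//= addrC addr_eq0 => /eqP ->.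
  by rewrite opprK -mulr2n -[dFv *+ 2]scaler_nat scalerA mulVf// scale1r.
have dFE : dFv.1 + I * dFv.2 = ((s == t)%:R : R)%:A.
  have := F'f' 0 I D0 iI; rewrite pt0 f'0 => /(congr1 (fun A : 'M[Cl]_n => A s t)).
  by rewrite !mxE dzE => <-; case: (s == t); rewrite ?scale1r ?scale0r.
have hF1 : is_derive (0 : Cn) e (fun z => (F z).1 ord0 s + I * (F z).2 ord0 s)
   (dFv.1 + I * dFv.2).
  have h : is_derive (0 : Cn) e (cxentry F ord0 s) dFv by exact: DeriveDef dF erefl.
  have h1 := is_derive_fst _ _ _ _ h; have h2 := is_derive_snd _ _ _ _ h.
  have h3 := @is_derive_contraction R Cn Cl Cl ( *%R I) _ _ _ _ (mulrBr I)
    (fun c a => esym (scalerAr c I a)) _ h2.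
  have h4 := is_deriveD h1 (h3 _); apply: h4 => a.
  by rewrite imag_unit_norm_mul.
have hg1 : is_derive (0 : Cn) e
    (fun z => ((g z).1 ord0 s) *: (1 : Cl) + ((g z).2 ord0 s) *: I)
    ((@dalpha R n R^o t (cxentry g ord0 s) 0).1 *: 1 +
     (@dalpha R n R^o t (cxentry g ord0 s) 0).2 *: I).
  have h : is_derive (0 : Cn) e (cxentry g ord0 s : Cn -> R^o * R^o)
    (@dalpha R n R^o t (cxentry g ord0 s) 0) by exact: DeriveDef dg erefl.
  have h1 := is_derive_fst _ _ _ _ h; have h2 := is_derive_snd _ _ _ _ h.
  have h3 := is_deriveD (is_derive_scale_vec _ _ _ _ (1 : Cl) h1)
    (is_derive_scale_vec _ _ _ _ I h2).
  exact: h3.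
have eqn : \forall z \near (0 : Cn),
    (F z).1 ord0 s + I * (F z).2 ord0 s =
    ((g z).1 ord0 s) *: (1 : Cl) + ((g z).2 ord0 s) *: I.
  have : \forall z \near (0 : Cn), D z by exact: open_nbhs_nbhs (conj open_unit_ball D0).
  apply: filterS => z Dz.
  have := slice_restrE _ _ _ _ iI Ff fI Dz => /(congr1 (fun v : 'rV_n => v ord0 s)).
  by rewrite slice_ptE -scalerAr mulr1 !mxE => ->.
have hF2 := near_eq_is_derive eqn hF1.
have E : dFv.1 + I * dFv.2 = ((@dalpha R n R^o t (cxentry g ord0 s) 0).1 *: 1 +
     (@dalpha R n R^o t (cxentry g ord0 s) 0).2 *: I).
  by rewrite -(derive_val (is_derive := hF2)) -(derive_val (is_derive := hg1)).
move: E; rewrite dFE; case: (@dalpha _ _ _ _ _ _) => p q /= E.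
have [|-> ->//] := imag_unit_affine_inj I (s == t)%:R 0 p q iI.
by rewrite -!scalerAr mulr1 scale0r addr0 E.
Qed.

Theorem slice_growth f x : normalized_slice_starlike f -> slice_ball x ->
  vnorm x / (1 + vnorm x) ^+ 2 <= vnorm (f x) /\
  vnorm (f x) <= vnorm x / (1 - vnorm x) ^+ 2.
Proof.
move=> [_ [I [iI fI sg]] _ [f' [F [rF Ff F'f']] f'0]] [[J iJ [z _ <-]]] /=.
rewrite (vnorm_slice_pt J z iJ) => z1.
have Dz : D z by [].
have [[hg _ _] _ _] := sg.
have dg := slice_restr_deriv _ _ _ _ iI rF Ff F'f' f'0 fI hg.
have G := starlike_growth _ _ sg dg Dz.
have Dz' := unit_ball_conj _ Dz.
have G' := starlike_growth _ _ sg dg Dz'.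
have zz : enorm (cxconj z) = enorm z.
  by congr Num.sqrt; apply: eq_bigr => t _; rewrite !mxE sqrrN.
rewrite zz in G'.
have E := slice_restrE _ _ _ _ iI Ff fI Dz.
have E' := slice_restrE _ _ _ _ iI Ff fI Dz'.
(* The parity of the stem turns the value at the conjugate point into F1 - I F2. That point has the
   same norm as [z], so both values obey the same growth bounds. *)
rewrite (rF.1 z Dz) /= scalerN in E'.
rewrite (Ff z J Dz iJ).
have := slice_norm_interpolation I J _ _ _ _ iI iJ E E'.
have /andP[l1 l2] := cdot_imag_le _ _ iI iJ.
move: G G' => /andP[a1 a2] /andP[b1 b2].
set N := vnorm _ => NE.
have N0 : 0 <= N := vnorm_ge0 _.
set r := enorm z in a1 a2 b1 b2 *.
have r0 : 0 <= r := enorm_ge0 z.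
set lo := r / (1 + r) ^+ 2 in a1 b1 *; set up := r / (1 - r) ^+ 2 in a2 b2 *.
have lo0 : 0 <= lo by rewrite divr_ge0 ?sqr_ge0.
have up0 : 0 <= up by rewrite divr_ge0 ?sqr_ge0.
set p := enorm (slice_restr I f z) in a1 a2 NE.
set q := enorm (slice_restr I f (cxconj z)) in b1 b2 NE.
set k := cdot I J in l1 l2 NE.
have sq (a b : R) : 0 <= a -> a <= b -> a ^+ 2 <= b ^+ 2.
  by move=> a0 ab; rewrite ler_pXn2r ?nnegrE// (le_trans a0).
have k1 : 0 <= (1 + k) / 2 by lra. have k2 : 0 <= (1 - k) / 2 by lra.
have p0 : 0 <= p := enorm_ge0 _. have q0 : 0 <= q := enorm_ge0 _.
split.
  rewrite -(@ler_pXn2r _ 2)// ?nnegrE// NE.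
  have h1 := ler_wpM2l k1 (sq _ _ lo0 a1). have h2 := ler_wpM2l k2 (sq _ _ lo0 b1).
  lra.
rewrite -(@ler_pXn2r _ 2)// ?nnegrE// NE.
have h1 := ler_wpM2l k1 (sq _ _ p0 a2). have h2 := ler_wpM2l k2 (sq _ _ q0 b2).
lra.
Qed.

End SliceGrowth.


(** * The extremal mapping *)

Section StrictToHolomorphic.
Context {R : realType} {n : nat} {V : normedModType R}.
Local Notation C := R[i].
Local Notation Cn := (Cx 'rV[R]_n).
Implicit Types (u y z : Cn) (h : Cn -> C) (A : 'I_n -> C) (e : V).

Definition unit_of (b : bool) : C := if b then 'i%C else 1.

Lemma coord_cdir i t :
  coord (cdir i : Cn) t = (t == i.1)%:R * unit_of i.2.
Proof.
by case: i => s [] /=; rewrite /coord /cdir /unit_of /= !mxE /= eq_sym;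
  case: eqVneq => _; apply: complex_ext => /=; ring.
Qed.

Lemma norm1_cdir i : norm1 (cdir i : Cn) = 1.
Proof.
rewrite /norm1 (bigD1 i.1)// big1 => [|t /negPf ti].
  rewrite coord_cdir eqxx mul1r /= addr0; case: (i.2); rewrite /unit_of ?normc1//.
  by rewrite normcE/= expr0n expr1n add0r sqrtr1.
by rewrite coord_cdir ti mul0r normc0.
Qed.

Lemma msder_dir h z A i (r : R) :
  \sum_t A t * (coord (r *: cdir i + z) t - coord z t) =
  r%:C%C * (A i.1 * unit_of i.2).
Proof.
rewrite (bigD1 i.1)// big1 => [|t /negPf ti]; rewrite -coordB addrK coordZ coord_cdir.
  by rewrite eqxx mul1r /= addr0; ring.
by rewrite ti !(mul0r, mulr0).
Qed.

Lemma msder_dir_lim h z A i : msder h z A -> forall r : R, 0 < r ->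
  exists2 d : R, 0 < d & forall c : R, 0 < `|c| < d ->
  normc ((c^-1)%:C%C * (h (c *: cdir i + z) - h z) - A i.1 * unit_of i.2) <= r.
Proof.
move=> dh r r0; have [d d0 H] := dh _ r0; exists d => // c /andP[c0 cd].
have zz : norm1 (z - z) < d.
  by rewrite subrr -(scale0r (0 : Cn)) norm1Z normr0 mul0r.
have cz : norm1 (c *: cdir i + z - z) = `|c|.
  by rewrite addrK norm1Z norm1_cdir mulr1.
have := H _ _ _ zz => /(_ (c *: cdir i + z)); rewrite cz => /(_ cd).
rewrite (msder_dir h) => h1.
have c0' : c%:C%C != 0 :> C by rewrite fmorph_eq0 -normr_gt0.
rewrite fmorphV -(ler_pM2l c0) -{1}(normc_real c) -normcM.
rewrite mulrBr mulrA divff// mul1r [leRHS]mulrC //.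
Qed.

Lemma msder_is_derive h z A i : msder h z A ->
  is_derive z (cdir i) (fun y => Re (h y)) (Re (A i.1 * unit_of i.2)) /\
  is_derive z (cdir i) (fun y => Im (h y)) (Im (A i.1 * unit_of i.2)).
Proof.
move=> dh; have H := msder_dir_lim _ _ _ i dh.
have near_c (d : R) : 0 < d -> \forall c \near (0 : R)^', 0 < `|c| < d.
  move=> d0; near=> c; apply/andP; split.
    by rewrite normr_gt0; near: c; exact: nbhs_dnbhs_neq.
  by near: c; exact: dnbhs0_lt.
split; apply/is_deriveP/cvgrPdist_le => r r0; have [d d0 Hd] := H _ r0.
  have := near_c _ d0; apply: filterS => c /Hd; rewrite distrC; apply: le_trans.
  apply: le_trans (normc_ge_Re _); rewrite cReB cReMr cReB.
  by [].
have := near_c _ d0; apply: filterS => c /Hd; rewrite distrC; apply: le_trans.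
apply: le_trans (normc_ge_Im _); rewrite cImB cImMr cImB.
by [].
Unshelve. all: by end_near. Qed.

(** One vector [e] covers two uses: [V = R^o] gives ordinary maps of C^n, and [V] the Clifford
    algebra with [e = 1] gives stem mappings. *)
Definition vec_along e (w : C) : Cx V := (Re w *: e, Im w *: e).

Lemma msder_is_derive_vec h z A i e : msder h z A ->
  is_derive z (cdir i) (fun y => vec_along e (h y)) (vec_along e (A i.1 * unit_of i.2)).
Proof.
move=> /(msder_is_derive _ _ _ i)[h1 h2]; apply: is_derive_pair.
  exact: is_derive_scale_vec h1.
exact: is_derive_scale_vec h2.
Qed.

Lemma msder_dalpha h z A t e : msder h z A ->
  dalpha t (fun y => vec_along e (h y)) z = vec_along e (A t).
Proof.
move=> dh; have := msder_is_derive_vec _ _ _ (t, false) e dh => H.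
by rewrite /dalpha; have := derive_val (is_derive := H); rewrite /= mulr1.
Qed.

Lemma msder_dbeta h z A t e : msder h z A ->
  dbeta t (fun y => vec_along e (h y)) z = vec_along e (A t * 'i%C).
Proof.
move=> dh; have := msder_is_derive_vec _ _ _ (t, true) e dh => H.
exact: (derive_val (is_derive := H)).
Qed.

Lemma muli_vec_along e w : muli (vec_along e (w * 'i%C)) = - vec_along e w.
Proof.
rewrite /muli /vec_along cReM cImM /= !(mulr0, mulr1, sub0r, addr0, add0r).
by congr (_, _); rewrite ?scaleNr.
Qed.

Lemma msder_dz h z A t e : msder h z A ->
  dz t (fun y => vec_along e (h y)) z = vec_along e (A t).
Proof.
move=> dh; rewrite /dz (msder_dalpha _ _ _ _ _ dh) (msder_dbeta _ _ _ _ _ dh).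
rewrite muli_vec_along opprK -mulr2n -[X in _ *: X]scaler_nat scalerA.
by rewrite mulVf// scale1r.
Qed.

(** A single difference quotient based at [y] approximates both derivatives: that at [y] because its
    step [c] is taken small depending on [y], and that at [z] because strict differentiability at
    [z] covers pairs of points near [z]. *)
Lemma msder_deriv_cont h (U : set Cn) (A : Cn -> 'I_n -> C) z t :
  open U -> (forall y, U y -> msder h y (A y)) -> U z ->
  forall r : R, 0 < r -> \forall y \near z, normc (A y t - A z t) <= r.
Proof.
move=> oU dh Uz r r0; have r20 : 0 < r / 2 by rewrite divr_gt0.
have [d d0 Hd] := dh _ Uz _ r20.
have nd : \forall y \near z, norm1 (y - z) < d / 2.
  by apply/near_norm1P; exists (d / 2); rewrite ?divr_gt0.
have nU : \forall y \near z, U y by exact: open_nbhs_nbhs.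
near=> y.
have Uy : U y by near: y.
have yd : norm1 (y - z) < d / 2 by near: y.
have [d' d'0 Hd'] := msder_dir_lim _ _ _ (t, false) (dh _ Uy) _ r20.
pose c := Num.min (d / 2) d' / 2.
have m0 : 0 < Num.min (d / 2) d' by rewrite lt_min d'0 divr_gt0.
have c0 : 0 < c by rewrite divr_gt0.
have cm : c < Num.min (d / 2) d' by rewrite /c; lra.
have cd' : c < d' by apply: lt_le_trans cm _; rewrite ge_min lexx orbT.
have cd : c < d / 2 by apply: lt_le_trans cm _; rewrite ge_min lexx.
have := Hd' c; rewrite gtr0_norm// c0 cd' => /(_ isT) /= h1.
have yd2 : norm1 (y - z) < d by lra.
have ud : norm1 (c *: cdir (t, false) + y - z) < d.
  rewrite -addrA (le_lt_trans (norm1D _ _))// norm1Z norm1_cdir gtr0_norm// mulr1.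
  by lra.
have := Hd _ _ ud yd2; rewrite (msder_dir h) addrK norm1Z norm1_cdir gtr0_norm//.
rewrite /= !mulr1 => h2; rewrite mulr1 in h1.
have cc0 : c%:C%C != 0 :> C by rewrite fmorph_eq0 gt_eqF.
set X := h _ - h _ in h1 h2.
have h3 : normc ((c^-1)%:C%C * X - A z t) <= r / 2.
  rewrite -(ler_pM2l c0) -{1}(gtr0_norm c0) -{1}(normc_real c) -normcM.
  by rewrite mulrBr mulrA fmorphV divff// mul1r [leRHS]mulrC.
have := normc_triangle (A y t) ((c^-1)%:C%C * X) (A z t).
rewrite normc_distC in h1 => /le_trans; apply.
by rewrite [leRHS](splitr r) lerD// normc_distC.
Unshelve. all: by end_near. Qed.

(** Partial derivatives are read off from the strict derivative, whose complex linearity is the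
    Cauchy-Riemann system and whose continuity is [msder_deriv_cont]. Holomorphy of the extremal
    maps then follows from the calculus rules for [sder]. *)
Lemma strict_holomorphic (U : set Cn) h e : open U ->
  (forall z, U z -> exists A, msder h z A) ->
  holomorphic_on U (fun z => vec_along e (h z)).
Proof.
move=> oU dh; pose A z := xget (fun=> 0) [set a | msder h z a].
have hA z : U z -> msder h z (A z) by move=> /dh[a ha]; exact: (xgetPex _ (ex_intro _ a ha)).
have along_le (v w : C) (r : R) : normc (w - v) <= r / (`|e| + 1) ->
    `|vec_along e v - vec_along e w| <= r.
  rewrite ler_pdivlMr ?ltr_wpDl// => vw.
  have e1 : normc (w - v) * `|e| <= r.
    by apply: le_trans vw; rewrite ler_wpM2l ?normc_ge0// lerDl.
  rewrite prod_normE ge_max /vec_along /= -!scalerBl !normrZ -cReB -cImB.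
  apply/andP; split; apply: le_trans e1; rewrite ler_wpM2r// normc_distC.
    exact: normc_ge_Re.
  exact: normc_ge_Im.
split=> [z t Uz|z t Uz]; last first.
  have dz := hA _ Uz; rewrite /dzbar (msder_dalpha _ _ _ _ _ dz).
  by rewrite (msder_dbeta _ _ _ _ _ dz) muli_vec_along subrr scaler0.
have dz := hA _ Uz.
have nU : \forall y \near z, U y by exact: open_nbhs_nbhs.
have e10 (r : R) : 0 < r -> 0 < r / (`|e| + 1) by move=> r0; rewrite divr_gt0// ltr_wpDl.
split.
- by have H := msder_is_derive_vec _ _ _ (t, false) e dz; exact: (ex_derive (is_derive := H)).
- by have H := msder_is_derive_vec _ _ _ (t, true) e dz; exact: (ex_derive (is_derive := H)).
- apply/cvgrPdist_le => r r0; near=> y.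
  have Uy : U y by near: y.
  rewrite (msder_dalpha _ _ _ _ _ dz) (msder_dalpha _ _ _ _ _ (hA _ Uy)).
  apply: along_le; near: y.
  exact: (msder_deriv_cont _ _ _ _ _ oU hA Uz _ (e10 _ r0)).
- apply/cvgrPdist_le => r r0; near=> y.
  have Uy : U y by near: y.
  rewrite (msder_dbeta _ _ _ _ _ dz) (msder_dbeta _ _ _ _ _ (hA _ Uy)).
  apply: along_le; rewrite -mulrBl normcM.
  have -> : normc ('i%C : C) = 1 by rewrite normcE/= expr0n expr1n add0r sqrtr1.
  rewrite mulr1; near: y.
  exact: (msder_deriv_cont _ _ _ _ _ oU hA Uz _ (e10 _ r0)).
Unshelve. all: by end_near. Qed.

End StrictToHolomorphic.


(** * The Koebe function and its inverse *)

Section Koebe.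
Context {R : realType}.
Local Notation C := R[i].
Implicit Types (w z q s : C) (t : R).

Definition koebe w : C := w / (1 - w) ^+ 2.
Definition koebe_deriv w : C := (1 + w) / (1 - w) ^+ 3.

Lemma normc_lt1_neq w : normc w < 1 -> 1 - w != 0.
Proof.
by move=> w1; rewrite subr_eq0; apply: contraTneq w1 => <-; rewrite normc1 ltxx.
Qed.

Lemma koebe_conj w : koebe (w^*)%C = ((koebe w)^*)%C.
Proof. by rewrite /koebe rmorphM fmorphV rmorphXn rmorphB rmorph1. Qed.

Lemma sder_koebe w : normc w < 1 -> sder koebe w (koebe_deriv w).
Proof.
move=> w1; have w0 := normc_lt1_neq _ w1.
have d1 : sder (fun w => 1 - w) w (-1).
  have := sder_affine (-1) 1 w.
  by congr (sder _ _ _); apply/funext => z; rewrite mulN1r addrC.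
have d2 := sderM _ _ _ _ _ d1 d1.
have w2 : (1 - w) * (1 - w) != 0 by rewrite mulf_neq0.
have := sderM _ _ _ _ _ (sder_id w) (sderV _ _ _ d2 w2).
by rewrite /koebe_deriv; congr (sder _ _ _); field.
Qed.

(** This is the square root in the closed right half-plane, with either imaginary root on the
    negative axis. Differentiability is established only where the real part of the root is
    positive. *)
Definition psqrt q : C := if 0 < Re (sqrtC q) then sqrtC q else - sqrtC q.

Lemma psqrtK q : psqrt q ^+ 2 = q.
Proof. by rewrite /psqrt; case: ifP => _; rewrite ?sqrrN sqrtCK. Qed.

Lemma Re_psqrt_ge0 q : 0 <= Re (psqrt q).
Proof.
rewrite /psqrt; case: ifP => [/ltW//|/negbT].
by rewrite -leNgt cReN oppr_ge0.
Qed.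

Lemma psqrt_sqr s : 0 < Re s -> psqrt (s ^+ 2) = s.
Proof.
move=> s0; have := psqrtK (s ^+ 2) => /eqP; rewrite eqf_sqr => /orP[/eqP//|/eqP E].
by have := Re_psqrt_ge0 (s ^+ 2); rewrite E cReN oppr_ge0 leNgt s0.
Qed.

Lemma psqrt_dist p q : normc (psqrt p - psqrt q) * Re (psqrt q) <= normc (p - q).
Proof.
have -> : p - q = (psqrt p - psqrt q) * (psqrt p + psqrt q).
  by rewrite -subr_sqr !psqrtK.
rewrite normcM ler_wpM2l ?normc_ge0// (le_trans _ (normc_ge_Re _))// cReD.
by rewrite ger0_norm ?addr_ge0 ?Re_psqrt_ge0// lerDr Re_psqrt_ge0.
Qed.

Lemma psqrt_cont q : 0 < Re (psqrt q) -> forall e : R, 0 < e ->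
  exists2 d : R, 0 < d & forall p, normc (p - q) < d ->
    normc (psqrt p - psqrt q) < e.
Proof.
move=> q0 e e0; exists (e * Re (psqrt q)); first by rewrite mulr_gt0.
move=> p pq; rewrite -(ltr_pM2r q0); exact: le_lt_trans (psqrt_dist _ _) pq.
Qed.

Lemma sder_psqrt q : 0 < Re (psqrt q) -> sder psqrt q ((2 * psqrt q)^-1).
Proof.
move=> q0 e e0; set s := psqrt q in q0 *; pose r := Re s.
have s0 : s != 0 by apply: contraTneq q0 => ->; rewrite ltxx.
have r0 : 0 < r by [].
pose e1 := Num.min (r / 2) (e * r ^+ 2 / 2).
have e10 : 0 < e1 by rewrite lt_min !divr_gt0// mulr_gt0// exprn_gt0.
have [d d0 Hd] := psqrt_cont _ q0 _ e10.
exists d => // y z yd zd.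
have hy := Hd _ yd; have hz := Hd _ zd.
set a := psqrt y in hy *; set b := psqrt z in hz *.
have e1r : e1 <= r / 2 by rewrite /e1 ge_min lexx.
have ra : r / 2 <= Re a.
  have := le_lt_trans (normc_ge_Re _) hy; rewrite cReB -/s -/r ltr_norml => /andP[h _]; lra.
have rb : r / 2 <= Re b.
  have := le_lt_trans (normc_ge_Re _) hz; rewrite cReB -/s -/r ltr_norml => /andP[h _]; lra.
have ab : r <= normc (a + b).
  apply: le_trans (normc_ge_Re _); rewrite cReD; apply: le_trans (ler_norm _); lra.
have ab0 : a + b != 0 by rewrite -normc_gt0 (lt_le_trans r0).
have -> : a - b - (2 * s)^-1 * (y - z) =
    (y - z) * ((s - a) + (s - b)) / ((a + b) * (2 * s)).
  by rewrite -[y]psqrtK -[z]psqrtK -/a -/b; field; rewrite s0 ab0.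
rewrite !normcM normcV !normcM.
have rs : r <= normc s by apply: le_trans (ler_norm _) (normc_ge_Re _).
have n2 : normc (2 : C) = 2 by rewrite -(rmorph_nat (real_complex R)) normc_real ger0_norm.
rewrite n2 -mulrA [leRHS]mulrC ler_wpM2l ?normc_ge0//.
rewrite ler_pdivrMr; last by rewrite !mulr_gt0//; lra.
have h1 : normc (s - a + (s - b)) <= 2 * e1.
  rewrite (le_trans (normcD _ _))// ![normc (s - _)]normc_distC; lra.
have h2 : 2 * e1 <= e * r ^+ 2.
  have : e1 <= e * r ^+ 2 / 2 by rewrite /e1 ge_min lexx orbT.
  lra.
apply: (le_trans h1); apply: (le_trans h2); rewrite ler_wpM2l ?(ltW e0)// expr2.
rewrite ler_pM ?(ltW r0)//; lra.
Qed.

(** The Cayley transform [s = (1 + w) / (1 - w)] satisfies [s^2 = 1 + 4 koebe w]; solving for [w]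
    gives this formula. Since [psqrt] never equals -1, it is a right inverse of [koebe] on the whole
    plane. *)
Definition koebe_inv q : C := (psqrt (1 + 4 * q) - 1) / (psqrt (1 + 4 * q) + 1).

Lemma psqrt1_neq0 q : psqrt q + 1 != 0.
Proof.
apply/eqP => /(congr1 (@complex.Re R)); rewrite cReD/=.
by have := Re_psqrt_ge0 q; lra.
Qed.

Lemma koebeE w : 1 - w != 0 -> 1 + 4 * koebe w = ((1 + w) / (1 - w)) ^+ 2.
Proof. by move=> w0; rewrite /koebe; field. Qed.

Lemma psqrt_koebe w : normc w < 1 ->
  psqrt (1 + 4 * koebe w) = (1 + w) / (1 - w) /\ 0 < Re ((1 + w) / (1 - w)).
Proof.
move=> w1; have w0 := normc_lt1_neq _ w1.
suff h : 0 < Re ((1 + w) / (1 - w)) by rewrite koebeE// psqrt_sqr.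
have n0 : 0 < normc (1 - w) ^+ 2 by rewrite exprn_gt0// normc_gt0.
(* After this normalization the sign of the real part is that of [1 - |w|^2]: the Cayley transform
   sends the disc to the right half-plane. *)
have -> : (1 + w) / (1 - w) =
    ((normc (1 - w) ^+ 2)^-1)%:C%C * ((1 + w) * ((1 - w)^*)%C).
  have cw0 : ((1 - w)^*)%C != 0 by rewrite -normc_gt0 normc_conj normc_gt0.
  rewrite fmorphV/= -mulc_conj; move: ((1 - w)^*)%C cw0 => v v0.
  by field; rewrite w0 v0.
rewrite cReMr pmulr_rgt0 ?invr_gt0//.
have := w1; rewrite -(@ltr_pXn2r _ 2)// ?nnegrE ?normc_ge0// expr1n normc_sqr.
case: w {w1 w0 n0} => a b /=; lra.
Qed.

Lemma koebeK w : normc w < 1 -> koebe_inv (koebe w) = w.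
Proof.
move=> w1; have w0 := normc_lt1_neq _ w1; rewrite /koebe_inv (psqrt_koebe _ w1).1.
have n2 : (2 : C) != 0 by rewrite pnatr_eq0.
by field; rewrite w0 /=; apply/eqP => h; move/eqP: n2; apply; rewrite -h; ring.
Qed.

Lemma koebe_invK q : koebe (koebe_inv q) = q.
Proof.
rewrite /koebe_inv /koebe; set s := psqrt _.
have s0 : s + 1 != 0 := psqrt1_neq0 _.
have n2 : (2 : C) != 0 by rewrite pnatr_eq0.
have -> : 1 - (s - 1) / (s + 1) = 2 / (s + 1) by field.
have -> : q = (s ^+ 2 - 1) / 4.
  by rewrite psqrtK addrC addKr mulrC mulKf// pnatr_eq0.
by field; rewrite s0 ?n2.
Qed.

Lemma sder_koebe_inv q : 0 < Re (psqrt (1 + 4 * q)) ->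
  exists c, sder koebe_inv q c.
Proof.
move=> q0; pose l := fun w : C => 4 * w + 1.
have dl : sder l q 4 by exact: sder_affine.
have dp : sder psqrt (l q) ((2 * psqrt (l q))^-1).
  by apply: sder_psqrt; rewrite /l addrC.
have dc := sder_comp _ _ _ _ _ dp dl.
have d1 := sderD _ _ _ _ _ dc (sder_cst (-1) q).
have d2 := sderD _ _ _ _ _ dc (sder_cst 1 q).
have nz : psqrt (l q) + 1 != 0 := psqrt1_neq0 _.
have := sderM _ _ _ _ _ d1 (sderV _ _ _ d2 nz) => h.
eexists; move: h; congr (sder _ _ _).
by apply/funext => z; rewrite /koebe_inv /l /= (addrC 1).
Qed.

(* |koebe_inv q| / (1 + |koebe_inv q| ^ 2) = |p - 1| / (2 (|p| + 1)) for
   p = 1 + 4 q, and the right-hand side increases along the rays from p = 1. *)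
Lemma koebe_inv_ray w t : normc w < 1 -> 0 <= t <= 1 ->
  0 < Re (psqrt (1 + 4 * (t%:C%C * koebe w))) /\
  normc (koebe_inv (t%:C%C * koebe w)) <= normc w.
Proof.
move=> w1 /andP[t0 t1]; have [sw sw0] := psqrt_koebe _ w1.
set s0 := (1 + w) / (1 - w) in sw sw0; clearbody s0.
have [->|tn0] := eqVneq t 0.
  have p1 : psqrt 1 = 1 by rewrite -{1}(expr1n C 2) psqrt_sqr//= ltr01.
  rewrite rmorph0 mul0r mulr0 addr0 p1 /koebe_inv mulr0 addr0 p1 subrr mul0r normc0.
  by rewrite ltr01 normc_ge0.
have tp : 0 < t by rewrite lt_def tn0.
set q := koebe w in sw *; set p := 1 + 4 * (t%:C%C * q).
have p0E : 1 + 4 * q = s0 ^+ 2 by rewrite -sw psqrtK.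
have pE : p = (1 - t)%:C%C + t%:C%C * s0 ^+ 2.
  by rewrite -p0E /p rmorphB rmorph1; ring.
set s := psqrt p.
have sE : s ^+ 2 = p by rewrite psqrtK.
have s_gt0 : 0 < Re s.
  (* If [s] were purely imaginary, [p] would be real and nonpositive. The imaginary part of [p]
     would force [s0] to be real, and then [p = 1 - t + t s0^2] is positive. *)
  rewrite lt_def Re_psqrt_ge0 andbT; apply/eqP => Rs0.
  have := congr1 (@complex.Im R) pE; have := congr1 (@complex.Re R) pE.
  rewrite -sE !expr2 cReD cImD cReMr cImMr !cReM !cImM Rs0/=.
  move: sw0; case: (s0) => a b /= a0.
  move=> h1 h2.
  have h3 : t * (a * b) = 0 by lra.
  have b0 : b = 0.
    by move/eqP: h3; rewrite !mulf_eq0 (negPf tn0) (gt_eqF a0)/= => /eqP.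
  have := sqr_ge0 (Im s); move: h1; rewrite b0 expr2.
  have : 0 < t * (a * a) by rewrite !mulr_gt0.
  lra.
split=> //; rewrite /koebe_inv -/p -/s; set v := (s - 1) / (s + 1).
have s10 : s + 1 != 0 := psqrt1_neq0 _.
(* This is the formula announced above the lemma, cleared of denominators; it comes from the
   parallelogram law for [x - 1] and [x + 1]. *)
have quad (x : C) : x + 1 != 0 ->
   2 * normc ((x - 1) / (x + 1)) * (normc (x ^+ 2) + 1) =
   normc (x ^+ 2 - 1) * (1 + normc ((x - 1) / (x + 1)) ^+ 2).
  move=> x0; have n0 : 0 < normc (x + 1) by rewrite normc_gt0.
  have -> : x ^+ 2 - 1 = (x - 1) * (x + 1) by ring.
  rewrite (normcX x) [normc (_ / _)]normcM normcV [normc ((x - 1) * (x + 1))]normcM.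
  have par : normc (x - 1) ^+ 2 + normc (x + 1) ^+ 2 = 2 * (normc x ^+ 2 + 1).
    by rewrite !normc_sqr; case: (x) => a b /=; ring.
  have -> : 1 + (normc (x - 1) / normc (x + 1)) ^+ 2 =
     (normc (x - 1) ^+ 2 + normc (x + 1) ^+ 2) / normc (x + 1) ^+ 2.
    by field; rewrite gt_eqF.
  by rewrite par; field; rewrite gt_eqF.
have wE : w = (s0 - 1) / (s0 + 1).
  by rewrite -[LHS]koebeK// /koebe_inv -/q sw.
have v1 : normc v <= 1.
  rewrite /v normcM normcV ler_pdivrMr ?normc_gt0// mul1r.
  rewrite -(@ler_pXn2r _ 2)// ?nnegrE ?normc_ge0// !normc_sqr.
  by move: s_gt0; case: (s) => a b /=; lra.
have s01 : s0 + 1 != 0.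
  by apply/eqP => /(congr1 (@complex.Re R)); rewrite cReD/=; lra.
have qv := quad _ s10; have qw := quad _ s01; rewrite -/v -wE in qv qw.
move: qv qw; rewrite sE.
have pt : p - 1 = t%:C%C * (s0 ^+ 2 - 1) by rewrite pE rmorphB rmorph1; ring.
have ptn : normc (p - 1) = t * normc (s0 ^+ 2 - 1).
  by rewrite pt normcM normc_real (gtr0_norm tp).
rewrite ptn.
(* Monotonicity along the ray: [p - 1] scales exactly by [t], whereas [|p| + 1] shrinks by no more
   than the factor [t]. *)
have tri : t * (normc (s0 ^+ 2) + 1) <= normc p + 1.
  have := normcB p (1 - t)%:C%C.
  rewrite pE addrC addKr -pE normcM !normc_real !ger0_norm ?subr_ge0//; lra.
have := normc_ge0 v; have := normc_ge0 w.
have := normc_ge0 (s0 ^+ 2 - 1); have := normc_ge0 (s0 ^+ 2); have := normc_ge0 p.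
move: v1 w1 tri {wE quad}.
set V := normc v; set W := normc w; set P := normc p; set P0 := normc (s0 ^+ 2).
set Q := normc (s0 ^+ 2 - 1) => V1 W1 tri P_ge0 P0_ge0 Q0 W0 V0 qv qw.
rewrite leNgt; apply/negP => WV.
have h : 0 < (V - W) * (1 - V * W).
  rewrite mulr_gt0 ?subr_gt0//; apply: (@le_lt_trans _ _ W) => //.
  by rewrite ler_piMl.
(* V (1 + W^2) > W (1 + V^2), while 2 V (P + 1) = t Q (1 + V^2), 2 W (P0 + 1) = Q (1 + W^2) *)
have h1 : 2 * V * (P + 1) * (1 + W ^+ 2) = t * Q * (1 + V ^+ 2) * (1 + W ^+ 2) by rewrite qv.
have h2 : 2 * W * (P0 + 1) * (t * (1 + V ^+ 2)) = Q * (1 + W ^+ 2) * (t * (1 + V ^+ 2)).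
  by rewrite qw.
have h3 : 2 * V * (P + 1) * (1 + W ^+ 2) = 2 * W * (t * (P0 + 1)) * (1 + V ^+ 2) by lra.
have h4 : 2 * W * (t * (P0 + 1)) * (1 + V ^+ 2) <= 2 * W * (P + 1) * (1 + V ^+ 2).
  rewrite ler_wpM2r ?addr_ge0 ?sqr_ge0// ler_wpM2l// mulr_ge0//.
have h5 : 0 < (P + 1) * ((V - W) * (1 - V * W)) by rewrite mulr_gt0//; lra.
lra.
Qed.

End Koebe.


(** * The Koebe function on the Clifford algebra *)

Section SliceKoebe.
Context {R : realType} {m : nat}.
Local Notation C := R[i].
Local Notation Cl := (clifford R m).
Implicit Types (J : Cl) (v w : C).

Definition slice_emb J w : Cl := (Re w)%:A + J * (Im w)%:A.

Lemma slice_embE J w : slice_emb J w = Re w *: 1 + Im w *: J.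
Proof. by rewrite /slice_emb -scalerAr mulr1. Qed.

Lemma slice_embM J v w : imag_units J ->
  slice_emb J (v * w) = slice_emb J v * slice_emb J w.
Proof.
move=> iJ; rewrite !slice_embE cReM cImM mulrDl !mulrDr.
rewrite -!scalerAl -!scalerAr !mul1r mulr1 (imag_unit_sqr _ iJ) !scalerA.
by rewrite scalerN scalerBl scalerDl addrACA [- _ + _]addrC.
Qed.

Lemma slice_embB J v w : slice_emb J (v - w) = slice_emb J v - slice_emb J w.
Proof. by rewrite !slice_embE cReB cImB !scalerBl opprD addrACA. Qed.

Lemma slice_embD J v w : slice_emb J (v + w) = slice_emb J v + slice_emb J w.
Proof. by rewrite !slice_embE cReD cImD !scalerDl addrACA. Qed.

Lemma slice_emb1 J : slice_emb J 1 = 1.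
Proof. by rewrite slice_embE /= scale1r scale0r addr0. Qed.

Lemma slice_embX J v k : imag_units J -> slice_emb J (v ^+ k) = slice_emb J v ^+ k.
Proof.
by move=> iJ; elim: k => [|k IH]; rewrite ?expr0 ?slice_emb1// !exprS slice_embM// IH.
Qed.

Lemma slice_embZ J (a : R) v : slice_emb J (a%:C%C * v) = a *: slice_emb J v.
Proof. by rewrite !slice_embE cReMr cImMr scalerDr !scalerA. Qed.

Lemma slice_emb_conj J v : imag_units J ->
  clconj (slice_emb J v) = slice_emb J (v^*)%C.
Proof.
move=> iJ; rewrite !slice_embE -[Im v *: J]addr0 !clconj_linear clconj1.
rewrite (imag_unit_conj _ iJ) scalerN.
have -> : clconj (0 : Cl) = 0 by apply/ffunP => A; rewrite !ffunE mulr0.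
by case: v => a b /=; rewrite addr0 scaleNr.
Qed.

Lemma slice_emb_cdot J v : imag_units J ->
  cdot (slice_emb J v) (slice_emb J v) = normc v ^+ 2.
Proof. by move=> iJ; rewrite /slice_emb imag_unit_affine// normc_sqr. Qed.

Lemma invc_conj v : v^-1 = ((normc v ^+ 2)^-1)%:C%C * (v^*)%C.
Proof.
have [->|v0] := eqVneq v 0; first by rewrite invr0 rmorph0 mulr0.
have c0 : (v^*)%C != 0 by rewrite -normc_gt0 normc_conj normc_gt0.
rewrite fmorphV/= -mulc_conj; move: (v^*)%C c0 => u u0.
by field; rewrite v0 u0.
Qed.

Lemma invc_conjX v k :
  (v ^+ k)^-1 = ((normc v ^+ 2)^-1 ^+ k)%:C%C * (v^*)%C ^+ k.
Proof. by rewrite -exprVn (invc_conj v) exprMn rmorphXn. Qed.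

(** This is [x (1 - x)^-2], with the inverse of [1 - x] written as its conjugate over its squared
    norm. That is the true inverse on each slice, and the formula is total on the algebra. *)
Definition cl_koebe (x : Cl) : Cl :=
  (cdot (1 - x) (1 - x))^-1 ^+ 2 *: (x * clconj (1 - x) ^+ 2).

Definition cl_koebe_deriv (x : Cl) : Cl :=
  (cdot (1 - x) (1 - x))^-1 ^+ 3 *: ((1 + x) * clconj (1 - x) ^+ 3).

Lemma cl_koebeE J w : imag_units J ->
  cl_koebe (slice_emb J w) = slice_emb J (koebe w).
Proof.
move=> iJ; rewrite /cl_koebe -(slice_emb1 J) -slice_embB slice_emb_cdot//.
rewrite slice_emb_conj// -slice_embX// -slice_embM// -slice_embZ.
by congr slice_emb; rewrite /koebe invc_conjX mulrCA.
Qed.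

Lemma cl_koebe_derivE J w : imag_units J ->
  cl_koebe_deriv (slice_emb J w) = slice_emb J (koebe_deriv w).
Proof.
move=> iJ; rewrite /cl_koebe_deriv -(slice_emb1 J) -slice_embB slice_emb_cdot//.
rewrite -slice_embD slice_emb_conj// -slice_embX// -slice_embM// -slice_embZ.
by congr slice_emb; rewrite /koebe_deriv invc_conjX mulrCA.
Qed.

Lemma cl_koebe0 : cl_koebe 0 = 0.
Proof. by rewrite /cl_koebe mul0r scaler0. Qed.

Lemma cl_koebe_deriv0 : cl_koebe_deriv 0 = 1.
Proof.
by rewrite /cl_koebe_deriv subr0 addr0 cdot11 clconj1 invr1 !expr1n scale1r mulr1.
Qed.

Lemma imag_units_exists : (0 < m)%N -> exists J : Cl, imag_units J.
Proof.
case: m => // m' _; exists (gen R ord0); apply/imag_unitsP.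
rewrite /cltrace /clsqnorm clconj_gen subrr; split=> //.
have := gen_rel R (ord0 : 'I_m'.+1) ord0; rewrite eqxx mulrN.
set g2 := gen R ord0 * gen R ord0 => E.
have two (v : clifford R m'.+1) : (2 : R) *: v = v + v by rewrite scaler_nat mulr2n.
have : (2 : R) *: g2 = (2 : R) *: -1 by rewrite !two E mulr2n scalerDl scaleN1r.
move=> /(congr1 (fun v : clifford R m'.+1 => 2^-1 *: v)).
by rewrite !scalerA mulVf// !scale1r => ->; rewrite opprK.
Qed.

End SliceKoebe.

(** * The componentwise Koebe map is starlike *)

Section ExtremalMap.
Context {R : realType} {n : nat}.
Local Notation C := R[i].
Local Notation Cn := (Cx 'rV[R]_n).
Local Notation D := (@unit_ball R n).
Implicit Types (u y z v : Cn).

Definition koebe_map z : Cn := of_coord (fun t => koebe (coord z t)).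

Lemma msder_on_coord (k : C -> C) (s : 'I_n) z c : sder k (coord z s) c ->
  msder (fun y => k (coord y s)) z (fun t => (t == s)%:R * c).
Proof.
move=> dk e e0; have [d d0 Hd] := dk _ e0; exists d => // u y ud yd.
rewrite (bigD1 s)// big1 => [|t /negPf ts]; last by rewrite ts !mul0r.
rewrite eqxx mul1r /= addr0.
have h w : norm1 (w - z) < d -> normc (coord w s - coord z s) < d.
  by rewrite -coordB; apply: le_lt_trans; exact: coord_le_norm1.
apply: (le_trans (Hd _ _ (h _ ud) (h _ yd))).
by rewrite ler_wpM2l ?(ltW e0)// -coordB coord_le_norm1.
Qed.

Lemma unit_ball_coord z t : D z -> normc (coord z t) < 1.
Proof. by rewrite unit_ballE; apply: le_lt_trans; exact: coord_le_enorm. Qed.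

Lemma koebe_map_holomorphic : holomorphic_map D koebe_map.
Proof.
move=> i s; rewrite (ord1 i).
have -> : cxentry koebe_map ord0 s =
    (fun z => vec_along (1 : R^o) (koebe (coord z s))).
  apply/funext => z; rewrite /cxentry /koebe_map /vec_along /= !mxE.
  by congr (_, _); rewrite [RHS]mulr1.
apply: strict_holomorphic; first exact: open_unit_ball.
move=> z Dz; eexists; apply: msder_on_coord; apply: sder_koebe.
exact: unit_ball_coord.
Qed.

Definition koebe_map_inv v : Cn := of_coord (fun t => koebe_inv (coord v t)).

Lemma koebe_mapK z : D z -> koebe_map_inv (koebe_map z) = z.
Proof.
move=> Dz; apply: coord_inj => t; rewrite !coordK koebeK//.
exact: unit_ball_coord.
Qed.

Lemma koebe_map_invK v : koebe_map (koebe_map_inv v) = v.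
Proof. by apply: coord_inj => t; rewrite !coordK koebe_invK. Qed.

Lemma koebe_image_slit v : (koebe_map @` D) v ->
  forall t, 0 < Re (psqrt (1 + 4 * coord v t)).
Proof.
move=> [z Dz <-] t; rewrite coordK.
by have [-> ?] := psqrt_koebe _ (unit_ball_coord z t Dz).
Qed.

(** [koebe_map_inv] is a right inverse everywhere and is continuous at image points, where the
    square roots have positive real part. Points close to [koebe_map z] thus have preimages close to
    [z], still inside the ball. *)
Lemma open_koebe_image : open (koebe_map @` D).
Proof.
rewrite openE => v Dv; have slit := koebe_image_slit _ Dv.
have [z Dz zv] := Dv.
have zE : koebe_map_inv v = z by rewrite -zv koebe_mapK.
have r0 : 0 < (1 - enorm z) / n.+1%:R by rewrite divr_gt0// subr_gt0.
have /choice[d Hd] : forall t, exists d : R, 0 < d /\ forall y, norm1 (y - v) < d ->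
    normc (coord (koebe_map_inv y) t - coord z t) < (1 - enorm z) / n.+1%:R.
  move=> t; have [c dc] := sder_koebe_inv _ (slit t).
  have [d d0 H] := sder_cont _ _ _ dc _ r0; exists d; split=> // y yd.
  rewrite -{1}zE !coordK; apply: H; rewrite -coordB.
  by apply: le_lt_trans yd; exact: coord_le_norm1.
have [d1 d10 Hd1] := common_radius d (fun t => (Hd t).1).
apply/near_norm1P; exists d1 => // y yd.
exists (koebe_map_inv y); last exact: koebe_map_invK.
have h t : normc (coord (koebe_map_inv y - z) t) <= (1 - enorm z) / n.+1%:R.
  by rewrite coordB; apply/ltW/(Hd t).2; apply: lt_le_trans yd (Hd1 t).
have h1 : norm1 (koebe_map_inv y - z) < 1 - enorm z.
  rewrite /norm1 (le_lt_trans (ler_sum _ (fun t _ => h t)))//.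
  rewrite sumr_const card_ord -[_ *+ n]mulr_natl mulrCA gtr_pMr ?subr_gt0//.
  by rewrite ltr_pdivrMr// mul1r ltr_nat.
rewrite unit_ballE.
have := enormD (koebe_map_inv y - z) z; rewrite subrK.
have := enorm_le_norm1 (koebe_map_inv y - z); lra.
Qed.

Lemma koebe_map_inv_holomorphic : holomorphic_map (koebe_map @` D) koebe_map_inv.
Proof.
move=> i s; rewrite (ord1 i).
have -> : cxentry koebe_map_inv ord0 s =
    (fun z => vec_along (1 : R^o) (koebe_inv (coord z s))).
  apply/funext => z; rewrite /cxentry /koebe_map_inv /vec_along /= !mxE.
  by congr (_, _); rewrite [RHS]mulr1.
apply: strict_holomorphic; first exact: open_koebe_image.
move=> v Dv; have [c dc] := sder_koebe_inv _ (koebe_image_slit _ Dv s).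
by eexists; apply: msder_on_coord dc.
Qed.

Lemma koebe_map0 : koebe_map 0 = 0.
Proof.
by apply: coord_inj => t; rewrite coordK coord0 /koebe mul0r.
Qed.

(** Starlikeness is checked one coordinate at a time: by [koebe_inv_ray], shrinking the image
    towards 0 decreases the modulus of every coordinate of the preimage, hence its Euclidean
    norm. *)
Lemma koebe_map_starlike : starlike_mapping D koebe_map.
Proof.
split; last 2 first.
- exact: koebe_map0.
- move=> v t [z Dz <-] t01; exists (koebe_map_inv (t *: koebe_map z)).
    rewrite unit_ballE; apply: le_lt_trans (Dz : enorm z < 1).
    rewrite -(@ler_pXn2r _ 2)// ?nnegrE ?enorm_ge0// !enorm_sqrE.
    apply: ler_sum => s _; rewrite !coordK coordZ coordK.
    have [_ h] := koebe_inv_ray _ _ (unit_ball_coord z s Dz) t01.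
    by rewrite ler_pXn2r ?nnegrE ?normc_ge0.
  exact: koebe_map_invK.
- split; [exact: koebe_map_holomorphic|exact: open_koebe_image|].
  by exists koebe_map_inv; [exact: koebe_map_inv_holomorphic|exact: koebe_mapK].
Qed.

End ExtremalMap.

Section ExtremalSlice.
Context {R : realType} {m n : nat}.
Local Notation C := R[i].
Local Notation Cl := (clifford R m).
Local Notation Cn := (Cx 'rV[R]_n).
Local Notation D := (@unit_ball R n).
Implicit Types (J : Cl) (z : Cn).

Definition cl_koebe_map (x : 'rV[Cl]_n) : 'rV[Cl]_n := map_mx cl_koebe x.

Definition cl_koebe_map_deriv (x : 'rV[Cl]_n) : 'M[Cl]_n :=
  \matrix_(s, t) if s == t then cl_koebe_deriv (x ord0 s) else 0.

(** Both components are real vectors, so the induced map preserves every slice and acts on each as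
    [koebe_map]. *)
Definition koebe_stem z : Cx 'rV[Cl]_n :=
  (real_vec m (koebe_map z).1, real_vec m (koebe_map z).2).

Lemma slice_pt_coord J z t : slice_pt J z ord0 t = slice_emb J (coord z t).
Proof. by rewrite slice_ptE. Qed.

Lemma cl_koebe_map_slice J z : imag_units J ->
  cl_koebe_map (slice_pt J z) = slice_pt J (koebe_map z).
Proof.
move=> iJ; apply/rowP => t.
by rewrite [LHS]mxE !slice_pt_coord cl_koebeE// coordK.
Qed.

Lemma cxentry_koebe_stem s :
  cxentry koebe_stem ord0 s = (fun z => vec_along (1 : Cl) (koebe (coord z s))).
Proof.
by apply/funext => z; rewrite /cxentry /koebe_stem /vec_along /= !mxE.
Qed.

Lemma koebe_stem_regular : regular_stem koebe_stem.
Proof.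
split=> [z Dz|i s].
  have E : koebe_map (cxconj z) = cxconj (koebe_map z).
    by apply: coord_inj => t; rewrite coordK !coord_conj koebe_conj coordK.
  rewrite /koebe_stem E /cxconj /=; congr (_, _); apply/rowP => t.
  by rewrite !mxE scaleNr.
rewrite (ord1 i) cxentry_koebe_stem.
apply: strict_holomorphic; first exact: open_unit_ball.
move=> z Dz; eexists; apply: msder_on_coord; apply: sder_koebe.
exact: unit_ball_coord.
Qed.

Lemma koebe_stem_deriv : induces (stem_deriv koebe_stem) cl_koebe_map_deriv.
Proof.
move=> z J Dz iJ; apply/matrixP => s t; rewrite [LHS]mxE ![in RHS]mxE cxentry_koebe_stem.
rewrite (msder_dz _ _ _ _ _ (msder_on_coord _ _ _ _ (sder_koebe _ (unit_ball_coord z s Dz)))).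
rewrite eq_sym; case: eqVneq => _; last first.
  by rewrite mul0r /vec_along/= !scale0r mulr0 addr0.
by rewrite mul1r slice_pt_coord cl_koebe_derivE.
Qed.

Lemma cl_koebe_map_normalized : (0 < m)%N ->
  normalized_slice_starlike (cl_koebe_map).
Proof.
move=> m0; have ind : induces koebe_stem cl_koebe_map.
  by move=> z J Dz iJ; rewrite cl_koebe_map_slice.
have [I iI] := @imag_units_exists R m m0.
split.
- by exists koebe_stem => //; exact: koebe_stem_regular.
- exists I; split=> //.
    move=> _ [x [_ [z _ <-]] <-]; rewrite cl_koebe_map_slice//.
    by exists (koebe_map z).
  suff -> : slice_restr I cl_koebe_map = koebe_map by exact: koebe_map_starlike.
  apply/funext => z; apply: (slice_pt_inj I iI).
  rewrite -(cl_koebe_map_slice I z iI).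
  apply: (xgetPex 0 (P := [set w | slice_pt I w = cl_koebe_map (slice_pt I z)])).
  by exists (koebe_map z); rewrite /= cl_koebe_map_slice.
- by apply/rowP => t; rewrite !mxE cl_koebe0.
- exists cl_koebe_map_deriv.
    exists koebe_stem; split=> //; first exact: koebe_stem_regular.
    exact: koebe_stem_deriv.
  apply/matrixP => s t; rewrite !mxE cl_koebe_deriv0.
  by case: eqVneq.
Qed.

Lemma koebe_map_axis (t0 : 'I_n) (a : R) :
  enorm ((a *: delta_mx ord0 t0, 0) : Cn) = `|a| /\
  enorm (koebe_map ((a *: delta_mx ord0 t0, 0) : Cn)) = `|a| / (1 - a) ^+ 2.
Proof.
have cE t : coord ((a *: delta_mx ord0 t0, 0) : Cn) t = ((t == t0)%:R * a)%:C%C.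
  rewrite /coord /= !mxE/= ?eqxx; apply: complex_ext => //=.
  by rewrite mulrC.
have b0 : 0 <= `|a| / (1 - a) ^+ 2 by rewrite divr_ge0 ?sqr_ge0.
split; apply/eqP; rewrite -(@eqrXn2 _ 2) ?enorm_ge0//; apply/eqP; rewrite enorm_sqrE.
  rewrite (bigD1 t0)// big1 => [|t /negPf tt].
    by rewrite cE eqxx mul1r normc_real /= addr0.
  by rewrite cE tt mul0r normc_real normr0 expr0n.
rewrite (bigD1 t0)// big1 => [|t /negPf tt]; last first.
  by rewrite coordK cE tt mul0r /koebe mul0r normc0 expr0n.
rewrite coordK cE eqxx mul1r /= addr0; congr (_ ^+ 2).
rewrite /koebe -(rmorph1 (real_complex R)) -rmorphB -rmorphXn -fmorphV -rmorphM.
by rewrite normc_real normrM normfV [`|(1 - a) ^+ 2|]ger0_norm ?sqr_ge0.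
Qed.

Lemma cl_koebe_map_sharp (a : R) : (0 < m)%N -> (0 < n)%N -> `|a| < 1 ->
  exists x : 'rV[Cl]_n, [/\ slice_ball x, vnorm x = `|a| &
    vnorm (cl_koebe_map x) = `|a| / (1 - a) ^+ 2].
Proof.
move=> m0 n0 a1; have [I iI] := @imag_units_exists R m m0.
pose z : Cn := (a *: delta_mx ord0 (Ordinal n0), 0).
have [h1 h2] := koebe_map_axis (Ordinal n0) a.
exists (slice_pt I z); rewrite cl_koebe_map_slice// !vnorm_slice_pt//.
split=> //; split; first by exists I => //; exists z.
by rewrite /= vnorm_slice_pt// h1.
Qed.

End ExtremalSlice.

Theorem theorem3p3 (R : realType) (m n : nat) :
  (0 < m)%N -> (0 < n)%N ->
  (forall f : 'rV[clifford R m]_n -> 'rV[clifford R m]_n,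
     normalized_slice_starlike f ->
     forall x, slice_ball x ->
       vnorm x / (1 + vnorm x) ^+ 2 <= vnorm (f x) /\
       vnorm (f x) <= vnorm x / (1 - vnorm x) ^+ 2) /\
  (forall r : R, 0 < r < 1 ->
     (exists (f : 'rV[clifford R m]_n -> 'rV[clifford R m]_n)
             (x : 'rV[clifford R m]_n),
        [/\ normalized_slice_starlike f, slice_ball x, vnorm x = r &
            vnorm (f x) = vnorm x / (1 + vnorm x) ^+ 2]) /\
     (exists (f : 'rV[clifford R m]_n -> 'rV[clifford R m]_n)
             (x : 'rV[clifford R m]_n),
        [/\ normalized_slice_starlike f, slice_ball x, vnorm x = r &
            vnorm (f x) = vnorm x / (1 - vnorm x) ^+ 2])).
Proof.
move=> m0 n0; split=> [f nf x Bx|r /andP[r0 r1]]; first exact: slice_growth.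
have nk := @cl_koebe_map_normalized R m n m0.
split.
  (* The signed parameter [a] covers both bounds: [a = - r] turns [(1 - a)^2] into [(1 + r)^2], and
     [a = r] gives the upper bound. *)
  have [|x [Bx xr fx]] := @cl_koebe_map_sharp R m n (- r) m0 n0.
    by rewrite normrN gtr0_norm.
  exists cl_koebe_map, x; rewrite fx xr normrN gtr0_norm// opprK; split=> //.
have [|x [Bx xr fx]] := @cl_koebe_map_sharp R m n r m0 n0.
  by rewrite gtr0_norm.
by exists cl_koebe_map, x; rewrite fx xr gtr0_norm.
Qed.
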